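(* Let $1<p<N$, let $V:(0,+\infty)\to[0,+\infty]$ be a measurable function such that $V\in L^1((r_1,r_2))$ for some $r_2>r_1>0$, and let $K:(0,+\infty)\to(0,+\infty)$ be a measurable function such that $K\in L^s_{\mathrm{loc}}((0,+\infty))$ for some $s>1$. Assume that there exists $R_2>0$ such that $V(r)<+\infty$ for almost every $r>R_2$, $$\operatorname*{ess\,sup}_{r>R_2}\frac{K(r)}{r^{\alpha_\infty}V(r)^{\beta_\infty}}<+\infty\quad\text{for some } 0\le\beta_\infty\le1 \text{ and } \alpha_\infty\in\mathbb{R},$$ and $$\operatorname*{ess\,inf}_{r>R_2} r^{\gamma_\infty}V(r)>0\quad\text{for some }\gamma_\infty\le p.$$ Then $$\lim_{R\to+\infty}\mathcal{R}_\infty(q_2,R)=0$$ for every $q_2\in\mathbb{R}$ such that $$q_2>\max\{1,\ p\beta_\infty,\ q_*,\ q_{**}\},$$ where $$q_*=p\,\frac{\alpha_\infty-\gamma_\infty\beta_\infty+N}{N-\gamma_\infty},\qquad q_{**}=p\,\frac{p\alpha_\infty+(1-p\beta_\infty)\gamma_\infty+p(N-1)}{p(N-1)-\gamma_\infty(p-1)}.$$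
   Context: $B_R=\{x\in\mathbb{R}^N:|x|<R\}$. For $1<p<N$, $p^*=pN/(N-p)$ and $D^{1,p}(\mathbb{R}^N)=\{u\in L^{p^*}(\mathbb{R}^N):\nabla u\in L^p(\mathbb{R}^N)\}$ is the usual homogeneous Sobolev space; $D^{1,p}_{\mathrm{rad}}(\mathbb{R}^N)$ is its subspace of radial functions. $W:=D^{1,p}(\mathbb{R}^N)\cap L^p(\mathbb{R}^N,V(|x|)dx)$ and $W_r:=D^{1,p}_{\mathrm{rad}}(\mathbb{R}^N)\cap L^p(\mathbb{R}^N,V(|x|)dx)$, both with norm $\|u\|^p:=\int_{\mathbb{R}^N}\left(|\nabla u|^p+V(|x|)|u|^p\right)dx$. For $R>0$ and $q>1$ (values in $[0,+\infty]$): $$\mathcal{R}_\infty(q,R):=\sup_{u\in W_r,\ h\in W,\ \|u\|=\|h\|=1}\int_{\mathbb{R}^N\setminus B_R}K(|x|)|u|^{q-1}|h|\,dx.$$ Conventions: $V(r)^0=1$ for every $r$ (even if $V(r)=0$); the quotient $K(r)/(r^{\alpha}V(r)^{\beta})$ is $+\infty$ where its denominator vanishes. *)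

(* Defs.v *)
From HB Require Import structures.
From mathcomp Require Import all_boot all_order all_algebra.
From mathcomp Require Import all_classical all_reals all_analysis.
From mathcomp Require Import measurable_realfun.

Set Implicit Arguments.
Unset Strict Implicit.
Unset Printing Implicit Defensive.

Import Order.TTheory GRing.Theory Num.Theory.
Import numFieldNormedType.Exports.

Local Open Scope classical_set_scope.
Local Open Scope ring_scope.

(* The sigma-algebra on row vectors is the one generated by the coordinates,
   as the library does for tuples; on R^n it is the Borel sigma-algebra. *)
Definition rV_display : measure_display.
Proof. exact: default_measure_display. Qed.

Section measurable_rV.
Context {R : realType}.
Variable n : nat.

Let coors : 'I_n -> 'rV[R]_n -> measurableTypeR R := fun i x => x 0 i.

Let rV_set0 : g_sigma_preimage coors set0.
Proof. exact: sigma_algebra0. Qed.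

Let rV_setC A : g_sigma_preimage coors A -> g_sigma_preimage coors (~` A).
Proof. exact: sigma_algebraC. Qed.

Let rV_bigcup (F : (set 'rV[R]_n)^nat) : (forall i, g_sigma_preimage coors (F i)) ->
  g_sigma_preimage coors (\bigcup_i (F i)).
Proof. exact: sigma_algebra_bigcup. Qed.

HB.instance Definition _ := @isMeasurable.Build rV_display
  'rV[R]_n (g_sigma_preimage coors) rV_set0 rV_setC rV_bigcup.

End measurable_rV.

Section rV_cons.
Context {R : realType}.

Lemma measurable_coord n (i : 'I_n) :
  measurable_fun [set: 'rV[R]_n] (fun x => x 0 i : measurableTypeR R).
Proof.
move=> _ Y mY; rewrite setTI; apply: sub_sigma_algebra => /=.
rewrite -bigcup_seq/=; exists i => /=; first by rewrite mem_index_enum.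
by exists Y => //; rewrite setTI.
Qed.

Lemma measurable_fun_rV d (T : measurableType d) n (f : T -> 'rV[R]_n) :
  (forall i, measurable_fun [set: T] (fun t => f t 0 i : measurableTypeR R)) ->
  measurable_fun [set: T] f.
Proof.
move=> mf _ A mA; rewrite setTI; move: A mA.
apply: smallest_sub.
  split; first by rewrite /= preimage_set0.
  - by move=> A /= mA; rewrite setTD preimage_setC; exact: measurableC.
  - by move=> F /= mF; rewrite preimage_bigcup; exact: bigcupT_measurable.
rewrite -bigcup_seq/=; apply: bigcup_sub => i _ A [B mB <-] /=.
by rewrite setTI -[X in measurable X]setTI; exact: mf.
Qed.

Definition rV_cons n (z : measurableTypeR R * 'rV[R]_n) : 'rV[R]_n.+1 :=
  row_mx (z.1%:M : 'rV_1) z.2.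

Definition rV_uncons n (x : 'rV[R]_n.+1) : measurableTypeR R * 'rV[R]_n :=
  (x 0 0, \row_i x 0 (lift 0 i)).

Lemma rV_cons0 n z : @rV_cons n z 0 0 = z.1.
Proof.
rewrite (_ : 0 = lshift n (0 : 'I_1)); last exact/val_inj.
by rewrite [LHS](row_mxEl (z.1%:M : 'rV_1) z.2) mxE.
Qed.

Lemma rV_consS n z i : @rV_cons n z 0 (lift 0 i) = z.2 0 i.
Proof.
rewrite (_ : lift 0 i = rshift 1 i); last exact/val_inj.
by rewrite [LHS](row_mxEr (z.1%:M : 'rV_1) z.2).
Qed.

Lemma rV_consK n : cancel (@rV_cons n) (@rV_uncons n).
Proof.
case=> a x; rewrite /rV_uncons rV_cons0; congr pair.
by apply/rowP => i; rewrite mxE rV_consS.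
Qed.

Lemma measurable_rV_cons n : measurable_fun [set: measurableTypeR R * 'rV[R]_n] (@rV_cons n).
Proof.
apply: measurable_fun_rV => i; case: (unliftP 0 i) => [j ->|->].
  under eq_fun do rewrite rV_consS.
  exact: measurableT_comp (measurable_coord j) measurable_snd.
under eq_fun do rewrite rV_cons0.
exact: measurable_fst.
Qed.

Lemma measurable_rV_uncons n : measurable_fun [set: 'rV[R]_n.+1] (@rV_uncons n).
Proof.
apply: measurable_fun_pair; first exact: measurable_coord.
apply: measurable_fun_rV => i.
apply: (eq_measurable_fun (fun x : 'rV[R]_n.+1 => x 0 (lift 0 i))).
  by move=> x _; rewrite mxE.
exact: measurable_coord.
Qed.

End rV_cons.

Section lebesgue_rV_step.
Context {R : realType} (n : nat).
Variable m : {sigma_finite_measure set 'rV[R]_n -> \bar R}.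
Local Open Scope ereal_scope.

Let prod_meas : {measure set (measurableTypeR R * 'rV[R]_n)%type -> \bar R} :=
  @lebesgue_measure R \x m.

Definition lebesgue_rV_step : set 'rV[R]_n.+1 -> \bar R :=
  pushforward (@lebesgue_measure R \x m) (@rV_cons R n).

Let measurable_preimage (A : set 'rV[R]_n.+1) :
  measurable A -> measurable (@rV_cons R n @^-1` A).
Proof. by move=> mA; rewrite -[X in measurable X]setTI; exact: measurable_rV_cons. Qed.

Let step0 : lebesgue_rV_step set0 = 0.
Proof. by exact: (measure0 prod_meas). Qed.

Let step_ge0 A : 0 <= lebesgue_rV_step A.
Proof. exact: (measure_ge0 prod_meas). Qed.

Let step_sigma_additive : semi_sigma_additive lebesgue_rV_step.
Proof.
move=> F mF tF mUF; rewrite /lebesgue_rV_step /pushforward preimage_bigcup.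
apply: (@measure_semi_sigma_additive _ _ _ prod_meas).
- by move=> k; exact: measurable_preimage.
- apply/trivIsetP => /= i j _ _ ij; rewrite -preimage_setI.
  by move/trivIsetP : tF => /(_ _ _ _ _ ij) ->//; rewrite preimage_set0.
- by rewrite -preimage_bigcup; exact: measurable_preimage.
Qed.

HB.instance Definition _ := isMeasure.Build _ _ _
  lebesgue_rV_step step0 step_ge0 step_sigma_additive.

Let step_sigma_finite : sigma_finite [set: 'rV[R]_n.+1] lebesgue_rV_step.
Proof.
have /sigma_finiteP[F [TF ndF Foo]] := sigma_finiteT (@lebesgue_measure R).
have /sigma_finiteP[G [TG ndG Goo]] := sigma_finiteT m.
exists (fun k => @rV_uncons R n @^-1` (F k `*` G k)).
  apply/seteqP; split => // x _.
  have [i _ Fi] : (\bigcup_i F i) (rV_uncons x).1 by rewrite -TF.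
  have [j _ Gj] : (\bigcup_i G i) (rV_uncons x).2 by rewrite -TG.
  exists (maxn i j) => //; split.
  - by move: Fi; exact/subsetPset/ndF/leq_maxl.
  - by move: Gj; exact/subsetPset/ndG/leq_maxr.
move=> k; have [mFk Fk] := Foo k; have [mGk Gk] := Goo k; split.
  rewrite -[X in measurable X]setTI; apply: measurable_rV_uncons => //.
  exact: measurableX.
rewrite /lebesgue_rV_step /pushforward -comp_preimage.
rewrite (_ : _ \o _ = id); last by apply/funext => z; exact: rV_consK.
by rewrite preimage_id product_measure1E// lte_mul_pinfty// ge0_fin_numE.
Qed.

HB.instance Definition _ := Measure_isSigmaFinite.Build _ _ _
  lebesgue_rV_step step_sigma_finite.

End lebesgue_rV_step.

Fixpoint lebesgue_rV (R : realType) (n : nat) :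
    {sigma_finite_measure set 'rV[R]_n -> \bar R} :=
  match n with
  | 0 => \d_(0 : 'rV[R]_0)
  | n'.+1 => lebesgue_rV_step (lebesgue_rV R n')
  end.
Arguments lebesgue_rV {R} n.

(* On a product of Borel sets, lebesgue_rV is the product of the lengths. *)
Lemma lebesgue_rV_box (R : realType) n (A : 'I_n -> set (measurableTypeR R)) :
  (forall i, measurable (A i)) ->
  lebesgue_rV n [set x : 'rV[R]_n | forall i, A i (x 0 i)] =
  (\prod_(i < n) lebesgue_measure (A i))%E.
Proof.
elim: n A => [|n ih] A mA.
  by rewrite big_ord0 /= diracE mem_set//= => -[].
rewrite big_ord_recl -ih//.
transitivity ((@lebesgue_measure R \x lebesgue_rV n)%E
    (A ord0 `*` [set x : 'rV[R]_n | forall i, A (lift ord0 i) (x 0 i)])).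
  rewrite /= /lebesgue_rV_step /pushforward; congr product_measure1.
  apply/seteqP; split => -[a x] /=.
    move=> Ax; split => [|i]; first by have := Ax 0; rewrite rV_cons0.
    by have := Ax (lift 0 i); rewrite rV_consS.
  move=> [Aa Ax] i; case: (unliftP 0 i) => [j ->|->].
    by rewrite rV_consS; exact: Ax.
  by rewrite rV_cons0.
apply: product_measure1E => //=.
rewrite (_ : [set x : 'rV[R]_n | _] = \bigcap_(i in [set: 'I_n])
  ((fun x : 'rV[R]_n => x 0 i : measurableTypeR R) @^-1` A (lift 0 i))).
  apply: fin_bigcap_measurable => // i _.
  by rewrite -[X in measurable X]setTI; exact: measurable_coord.
by apply/seteqP; split => x /= Ax i; [move=> _|]; exact: Ax.
Qed.

Section sobolev.
Context {R : realType} {N : nat}.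
Implicit Types (u h : 'rV[R]_N -> R) (g : 'rV[R]_N -> 'rV[R]_N) (p q : R).

Notation mu := (@lebesgue_rV R N).

(* The norm `|x| of the library on row vectors is the sup norm. *)
Definition enorm (x : 'rV[R]_N) : R := Num.sqrt (\sum_(i < N) x 0 i ^+ 2).

Definition eball (r : R) : set 'rV[R]_N := [set x | enorm x < r].

Definition partial (i : 'I_N) (phi : 'rV[R]_N -> R) : 'rV[R]_N -> R :=
  'D_(delta_mx 0 i) phi.

Fixpoint class_C (k : nat) (phi : 'rV[R]_N -> R) : Prop :=
  continuous phi /\
  if k is k'.+1 then forall i : 'I_N,
    (forall x, derivable phi x (delta_mx 0 i)) /\ class_C k' (partial i phi)
  else True.

Definition test_function (phi : 'rV[R]_N -> R) : Prop :=
  (forall k, class_C k phi) /\ compact (closure [set x | phi x != 0]).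

Definition locally_integrable_rV (f : 'rV[R]_N -> R) : Prop :=
  measurable_fun setT f /\
  forall C : set 'rV[R]_N, compact C -> (\int[mu]_(x in C) `|f x|%:E < +oo)%E.

(* g is the gradient of u in the sense of distributions. *)
Definition weak_gradient u g : Prop :=
  [/\ locally_integrable_rV u,
      forall i, locally_integrable_rV (fun x => g x 0 i) &
      forall phi, test_function phi -> forall i : 'I_N,
        \int[mu]_x (u x * partial i phi x) = - \int[mu]_x (g x 0 i * phi x)].

(* A weak gradient is unique up to equality almost everywhere; grad u is a
   chosen representative, and is meaningless when u has no weak gradient. *)
Definition grad u : 'rV[R]_N -> 'rV[R]_N := get (weak_gradient u).

Definition sobolev_exponent p : R := p * N%:R / (N%:R - p).

(* Elements of D^{1,p} are represented by Borel functions. *)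
Definition D1p p u : Prop :=
  [/\ u \in Lfun mu (sobolev_exponent p)%:E,
      exists g, weak_gradient u g &
      forall i, (fun x => grad u x 0 i) \in Lfun mu p%:E].

Definition radial u : Prop :=
  exists f : R -> R, {ae mu, forall x, u x = f (enorm x)}.

Local Open Scope ereal_scope.

(* The potentials V and K below need only be Lebesgue measurable. The integral
   of a nonnegative function is the supremum of the integrals of the Borel
   simple functions below it, which for a Lebesgue measurable function is its
   Lebesgue integral.
   Since 0 * +oo = 0, membership in W only forces u = 0 almost everywhere on
   the set where V(|x|) = +oo. *)
Definition W p (V : R -> \bar R) u : Prop :=
  D1p p u /\ \int[mu]_x (V (enorm x) * (`|u x| `^ p)%:E) < +oo.

Definition W_rad p V u : Prop := W p V u /\ radial u.

Definition W_norm p (V : R -> \bar R) u : \bar R :=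
  (\int[mu]_x ((enorm (grad u x) `^ p)%:E + V (enorm x) * (`|u x| `^ p)%:E))
    `^ p^-1.

Definition R_infty p (V : R -> \bar R) (K : R -> R) q (r : R) : \bar R :=
  ereal_sup [set \int[mu]_(x in ~` eball r)
      (K (enorm x) * `|u.1 x| `^ (q - 1) * `|u.2 x|)%:E | u in
    [set u : ('rV[R]_N -> R) * ('rV[R]_N -> R) |
      [/\ W_rad p V u.1, W p V u.2, W_norm p V u.1 = 1 & W_norm p V u.2 = 1]]].

End sobolev.
Arguments R_infty {R} N p V K q r.

(* Measurability with respect to the Lebesgue (completed Borel) sigma-algebra. *)
Definition Lebesgue_measurable_fun (R : realType) d (T : measurableType d)
    (D : set R) (f : R -> T) : Prop :=
  @measurable_fun _ _
    (g_sigma_algebraType (completed_algebra_gen (@lebesgue_measure R))) T D f.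

(* lebesgue_measure restricted to ]a, +oo[ *)
Definition lebesgue_above (R : realType) (a : R) :
    {measure set (measurableTypeR R) -> \bar R} :=
  mrestr lebesgue_measure (measurable_itv `]a, +oo[).

Definition q_star (R : realType) (p N alpha beta gamma : R) : R :=
  p * ((alpha - gamma * beta + N) / (N - gamma)).

Definition q_2star (R : realType) (p N alpha beta gamma : R) : R :=
  p * ((p * alpha + (1 - p * beta) * gamma + p * (N - 1)) /
       (p * (N - 1) - gamma * (p - 1))).

(* Main.v *)
(* Write t = |x|^2 and x = (x_0, y). A radial u is, far from the origin, a
   Borel function F of t. Test its weak gradient, in the direction x_0 only,
   against S(t) H(x_0) B(y), where S' is a difference of two interval cutoffs
   with equal integrals, H cuts off {x_0 < 0} and B is a cutoff of a small cube
   Q. The weight 2 x_0 produced by differentiating t turns the law of t above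
   each y in Q into Lebesgue measure, so the identity compares two averages of
   F. Shrinking one interval to a point (Lebesgue differentiation), applying
   |z| <= tau + tau^(1-p) |z|^p to both error terms and choosing shells of
   thickness |x|^(1+gamma/p) in t gives |u(x)| <= C |x|^(-nu) for all normalised
   radial u, with p nu = N - 1 - gamma (p-1)/p.
   Let b = min(1, q/p). Since V >= c r^(-gamma), V^beta is at most a power of r
   times V^b. If q >= p the integrand is at most a power of r times
   V |u|^(p-1) |h| |u|^(q-p), and the decay of u applies; if q < p it is a
   product of powers, with exponents adding up to 1, of V|u|^p, V|h|^p and
   |x|^(-s), s > N. In both cases it is at most
   M r^(-eps) (V|u|^p + V|h|^p + |x|^(-s)). *)

From HB Require Import structures.
Require Import Defs.
From mathcomp Require Import all_boot all_order all_algebra.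
From mathcomp Require Import all_classical all_reals all_analysis.
From mathcomp Require Import measurable_realfun ess_sup_inf.
From mathcomp Require Import ring lra.
Set Implicit Arguments.
Unset Strict Implicit.
Unset Printing Implicit Defensive.
Import Order.TTheory GRing.Theory Num.Theory.
Import numFieldNormedType.Exports.
Local Open Scope classical_set_scope.
Local Open Scope ring_scope.

(** * Smooth functions of one variable *)

(** The usual route to radial decay (polar coordinates, then integrating u' along a ray) assumes a
    regular profile, whereas here u is known only through its distributional gradient and its
    profile is arbitrary. The sector test function brings everything back to product measure: 2 x_0
    is the Jacobian of t = |y|^2 + x_0^2 for fixed y, the half space makes this substitution one to
    one, and the smallness of the cube forces x_0 > r/2 on the shells, where H is constant and drops
    out of the derivative. Testing only the direction x_0 costs nothing, as the partial derivative
    is at most the length of the gradient. The thickness l of the shells balances two losses: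
    averaging u over the shell costs l^-1 r^(1+gamma), the gradient costs l/r. The choice l =
    r^(1+gamma/p) makes both of size r^-nu after Young's inequality, and gamma <= p keeps l <= r^2,
    so the shells stay at distance comparable to r. Measurability is the other obstacle: V is
    exchanged for a Borel function equal to it almost everywhere, while K enters only through upper
    bounds, for which monotonicity of the integral suffices. *)

Section smooth_line.
Context {R : realType}.
Implicit Types (f g : R -> R) (k : nat).

(** Mirror of [class_C] on the line. Cutoffs are built here and reach row vectors through
    [class_C_comp], composed with a coordinate or with |x|^2. *)
Fixpoint Ck k f : Prop :=
  continuous f /\
  if k is k'.+1 then (forall x, derivable f x 1) /\ Ck k' (f^`())%classic
  else True.

Lemma Ck_cont k f : Ck k f -> continuous f.
Proof. by case: k => [|k] []. Qed.

Lemma CkS k f f' : (forall x : R, is_derive x 1 f (f' x)) -> Ck k f' -> Ck k.+1 f.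
Proof.
move=> ff' Cf'; split.
  move=> x; apply: differentiable_continuous; apply/derivable1_diffP.
  by have [] := ff' x.
split; first by move=> x; have [] := ff' x.
by rewrite (_ : (f^`())%classic = f')//; apply/funext => x; rewrite derive1E derive_val.
Qed.

Lemma CkW k f : Ck k.+1 f -> Ck k f.
Proof. by elim: k f => [f [cf _]|k ih f [cf [df /ih]]]; split. Qed.

Lemma Ck_is_derive k f (x : R) : Ck k.+1 f -> is_derive x 1 f ((f^`())%classic x).
Proof. by move=> [_ [df _]]; split; rewrite ?derive1E. Qed.

Lemma Ck_cst k (c : R) : Ck k (fun=> c).
Proof.
elim: k c => [|k ih] c; first by split => // x; exact: cvg_cst.
by apply: (@CkS _ _ (fun=> 0)) => // x; exact: is_derive_cst.
Qed.

Lemma Ck_id k : Ck k id.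
Proof.
case: k => [|k]; first by split => // x; exact: cvg_id.
by apply: (@CkS _ _ (fun=> 1)); exact: Ck_cst.
Qed.

Lemma Ck_add k f g : Ck k f -> Ck k g -> Ck k (f \+ g).
Proof.
elim: k f g => [|k ih] f g Cf Cg.
  by split => // x; apply: cvgD; [exact: (Ck_cont Cf)|exact: (Ck_cont Cg)].
apply: (@CkS _ _ ((f^`())%classic \+ (g^`())%classic)).
  move=> x; have df := Ck_is_derive x Cf; have dg := Ck_is_derive x Cg.
  exact: is_deriveD.
by apply: ih; solve [case: Cf => _ []//|case: Cg => _ []//].
Qed.

Lemma Ck_mul k f g : Ck k f -> Ck k g -> Ck k (f \* g).
Proof.
elim: k f g => [|k ih] f g Cf Cg.
  by split => // x; apply: cvgM; [exact: (Ck_cont Cf)|exact: (Ck_cont Cg)].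
apply: (@CkS _ _ ((f \* (g^`())%classic) \+ (g \* (f^`())%classic))).
  move=> x; have df := Ck_is_derive x Cf; have dg := Ck_is_derive x Cg.
  exact: is_deriveM.
by apply: Ck_add; apply: ih; solve [exact: CkW|case: Cf => _ []//|case: Cg => _ []//].
Qed.

Lemma Ck_comp k f g : Ck k f -> Ck k g -> Ck k (f \o g).
Proof.
elim: k f g => [|k ih] f g Cf Cg.
  split => // x; apply: continuous_comp; first exact: (Ck_cont Cg).
  exact: (Ck_cont Cf).
have H (x : R) : is_derive x 1 (f \o g) ((((f^`())%classic \o g) \* (g^`())%classic) x).
  have df := Ck_is_derive (g x) Cf; have dg := Ck_is_derive x Cg.
  exact: is_derive1_comp.
apply: CkS H _.
apply: Ck_mul; last by case: Cg => _ [].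
by apply: ih; [case: Cf => _ []|exact: CkW].
Qed.

Lemma Ck_exp k f n : Ck k f -> Ck k (fun x => f x ^+ n).
Proof.
move=> Cf; elim: n => [|n ih].
  by under eq_fun do rewrite expr0; exact: Ck_cst.
by under eq_fun do rewrite exprS; exact: Ck_mul.
Qed.

Lemma Ck_primitive k f F : Ck k f -> (forall x : R, is_derive x 1 F (f x)) -> Ck k.+1 F.
Proof. by move=> Cf Ff; exact: CkS Ff Cf. Qed.

(** Meant for the junction of two formulas at 0, as in [flat] and in s|s|: a quadratic bound makes
    the difference quotient tend to 0. *)
Lemma is_derive0_sqr (f : R -> R) (C : R) : 0 < C -> (forall h, `|f h| <= C * h ^+ 2) ->
  is_derive (0 : R) 1 f 0.
Proof.
move=> C0 fC.
have f00 : f 0 = 0 by apply/normr0_eq0/le_anti; rewrite normr_ge0 (le_trans (fC 0))// expr0n mulr0.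
have H : h^-1 *: (f (h *: 1 + 0) - f 0) @[h --> 0^'] --> (0 : R).
  apply/cvgr0Pnorm_le => e e0; near=> h.
  have h0 : h != 0 by near: h; exact: nbhs_dnbhs_neq.
  rewrite f00 subr0 addr0 /GRing.scale/= mulr1 normrM normfV ler_pdivrMl ?normr_gt0//.
  rewrite (le_trans (fC h))// -real_normK ?num_real//.
  rewrite expr2 mulrA mulrC ler_pM2l ?normr_gt0// -ler_pdivlMl//.
  near: h; apply: dnbhs0_le; rewrite mulr_gt0// invr_gt0//.
by split; [apply/cvg_ex; exists 0|exact/cvg_lim].
Unshelve. all: by end_near. Qed.

(* [flat 0 t = exp (- 1 / t)] extended by [0] for [t <= 0]; the family is closed under differentiation. *)
Definition flat n (t : R) : R := if 0 < t then t^-1 ^+ n * expR (- t^-1) else 0.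

Lemma flat_ge0 n t : 0 <= flat n t.
Proof. by rewrite /flat; case: ifPn => // t0; rewrite mulr_ge0 ?expR_ge0// exprn_ge0// invr_ge0 ltW. Qed.

(** From exp(y) = exp(y/m)^m >= (y/m)^m with y = 1/t and m = n + 2: the factor t^-n is absorbed and
    t^2 remains, the form that [is_derive0_sqr] asks for. *)
Lemma flat_sqr n t : flat n t <= n.+2%:R ^+ n.+2 * t ^+ 2.
Proof.
rewrite /flat; case: ifPn => [t0|_]; last first.
  by apply: mulr_ge0; [exact: exprn_ge0|exact: sqr_ge0].
have m0 : 0 < n.+2%:R :> R by [].
have : (n.+2%:R^-1 * t^-1) ^+ n.+2 <= expR t^-1.
  rewrite (_ : expR t^-1 = expR (n.+2%:R^-1 * t^-1) ^+ n.+2); last first.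
    by rewrite -expRM_natl mulVKf// lt0r_neq0.
  rewrite lerXn2r ?nnegrE ?expR_ge0//.
    by rewrite mulr_ge0// invr_ge0 ltW.
  by rewrite (le_trans _ (expR_ge1Dx _))// lerDr.
rewrite exprMn (exprVn n.+2%:R) mulrC ler_pdivrMr ?exprn_gt0// mulrC => H.
rewrite expRN ler_pdivrMr ?expR_gt0// mulrAC -(ler_pM2r (_ : 0 < t^-1 ^+ 2)) ?exprn_gt0 ?invr_gt0//.
by rewrite -exprD addn2 -[X in _ <= X]mulrA -exprMn divff ?lt0r_neq0// expr1n mulr1.
Qed.

Lemma flat_derive n (t : R) : is_derive t 1 (flat n) (flat n.+2 t - n%:R * flat n.+1 t).
Proof.
have [t0|t0|<-] := ltgtP 0 t.
- have eqf : \near t, t^-1 ^+ n * expR (- t^-1) = flat n t.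
    near=> s; rewrite /flat ifT//; near: s; exact: lt_nbhsr.
  apply: near_eq_is_derive eqf _.
  have dV : is_derive t 1 (fun t => t^-1) (- t ^- 2).
    by apply: is_derive_eq (@is_deriveV R id t 1 1 (lt0r_neq0 t0) _) _; rewrite /GRing.scale/= mulr1.
  have dX : is_derive t 1 (fun t => t^-1 ^+ n) (n%:R * t^-1 ^+ n.-1 * - t ^- 2).
    by have := is_deriveX n dV; rewrite exprfctE; exact.
  have dE : is_derive t 1 (fun t => expR (- t^-1)) (expR (- t^-1) * t ^- 2).
    have := @is_derive1_comp R expR (fun t => - t^-1) t _ _ (is_derive_expR _) (is_deriveN dV).
    by rewrite opprK.
  apply: is_derive_eq (is_deriveM dX dE) _.
  rewrite /flat t0 /GRing.scale/= -exprVn.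
  by case: n dX => [|n] _ /=; rewrite ?exprS; ring.
- have eqf : \near t, 0 = flat n t.
    near=> s; rewrite /flat ifF//; apply/negbTE; rewrite -leNgt ltW//; near: s; exact: lt_nbhsl.
  apply: near_eq_is_derive eqf _.
  by rewrite /flat !ltNge (ltW t0)/= mulr0 subr0; exact: is_derive_cst.
- rewrite /flat ltxx mulr0 subr0.
  apply: (@is_derive0_sqr (flat n) (n.+2%:R ^+ n.+2)) => [|h]; first by rewrite exprn_gt0.
  by rewrite ger0_norm ?flat_ge0// flat_sqr.
Unshelve. all: by end_near. Qed.

Lemma flat_Ck k n : Ck k (flat n).
Proof.
elim: k n => [|k ih] n.
  split=> // x; apply: differentiable_continuous; apply/derivable1_diffP.
  by have [] := flat_derive n x.
apply: (@CkS _ _ (flat n.+2 \+ ((fun=> - n%:R) \* flat n.+1))).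
  by move=> x; apply: is_derive_eq (flat_derive n x) _; rewrite /= mulNr.
by apply: Ck_add => //; apply: Ck_mul => //; exact: Ck_cst.
Qed.
End smooth_line.

(** * Smooth cutoffs of intervals and their primitives *)

Section plateau.
Context {R : realType}.
Notation leb := (@lebesgue_measure R).
Implicit Types (f : R -> R) (c d t : R) (n : nat).

Lemma continuous_supp_integrable f c d : continuous f ->
  (forall t, ~~ (c <= t <= d) -> f t = 0) -> leb.-integrable setT (EFin \o f).
Proof.
move=> cf f0; have -> : EFin \o f = (EFin \o f) \_ `[c, d].
  apply/funext => t; rewrite patchE; case: ifPn => //= tcd.
  by rewrite f0//; apply: contra tcd => tcd; rewrite inE/= in_itv.
apply: (integrable_mkcond _ _).1; first exact: measurable_itv.
apply: continuous_compact_integrable; first exact: segment_compact.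
exact: continuous_subspaceT.
Qed.

(** Starting at -oo makes the primitive of a compactly supported function vanish to the left of the
    support and equal the total mass to the right of it. *)
Definition primitive f t : R := \int[leb]_(s in `]-oo, t]) f s.

Lemma primitive_is_derive f c d t : continuous f ->
  (forall t, ~~ (c <= t <= d) -> f t = 0) -> is_derive t 1 (primitive f) (f t).
Proof.
move=> cf f0; have intf := continuous_supp_integrable cf f0.
have tt1 : t < t + 1 by rewrite ltrDl.
have inty : leb.-integrable `]-oo, t + 1] (EFin \o f).
  by apply: integrableS intf => //; exact: measurable_itv.
have [|] := @continuous_FTC1 R f -oo%O t (t + 1) tt1 inty _ (cf t).
  by rewrite ltNye_eq.
by rewrite derive1E => df f't; split.
Qed.

Lemma primitive_le f c d t : (forall t, ~~ (c <= t <= d) -> f t = 0) ->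
  t < c -> primitive f t = 0.
Proof.
move=> f0 tc; rewrite /primitive (@eq_Rintegral _ _ _ _ _ (fun=> 0)) ?Rintegral_cst ?mul0r//.
move=> s; rewrite inE/= in_itv/= => st; apply: f0.
by rewrite negb_and -!ltNge (le_lt_trans st tc).
Qed.

Lemma primitive_ge f c d t : (forall t, ~~ (c <= t <= d) -> f t = 0) ->
  d <= t -> primitive f t = \int[leb]_s f s.
Proof.
move=> f0 dt; rewrite /primitive Rintegral_mkcond; apply: eq_Rintegral => s _.
rewrite patchE; case: ifPn => // st; rewrite f0//.
apply: contra st => /andP[_ sd]; rewrite inE/= in_itv/=; exact: le_trans dt.
Qed.

Lemma primitive_itv f t : leb.-integrable setT (EFin \o f) -> (forall t, 0 <= f t) ->
  0 <= primitive f t <= \int[leb]_s f s.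
Proof.
move=> intf f0; rewrite Rintegral_ge0//= /primitive Rintegral_mkcond.
apply: le_Rintegral => //.
  rewrite -restrict_EFin; apply: (integrable_mkcond _ _).1; first exact: measurable_itv.
  by apply: integrableS intf.
by move=> s _; rewrite patchE; case: ifPn.
Qed.

Definition bump c d t : R := flat 0 (t - c) * flat 0 (d - t).

Lemma flat0_lt1 t : flat 0 t < 1.
Proof.
rewrite /flat; case: ifPn => // t0.
by rewrite expr0 mul1r expR_lt1 oppr_lt0 invr_gt0.
Qed.

Lemma flat0_gt0 t : 0 < t -> 0 < flat 0 t.
Proof. by move=> t0; rewrite /flat t0 expr0 mul1r expR_gt0. Qed.

Lemma flat_le0 n t : t <= 0 -> flat n t = 0.
Proof. by rewrite /flat leNgt => /negbTE ->. Qed.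

Lemma bump_Ck k c d : Ck k (bump c d).
Proof.
apply: (@Ck_mul _ _ (fun t => flat 0 (t - c)) (fun t => flat 0 (d - t))).
  apply: (@Ck_comp _ _ (flat 0) (fun t => t - c)); first exact: flat_Ck.
  by apply: (@Ck_add _ _ id (fun=> - c)); [exact: Ck_id|exact: Ck_cst].
apply: (@Ck_comp _ _ (flat 0) (fun t => d - t)); first exact: flat_Ck.
rewrite (_ : (fun t => d - t) = (fun=> d) \+ ((fun=> -1) \* id)); last first.
  by apply/funext => t /=; rewrite mulN1r.
apply: Ck_add; first exact: Ck_cst.
by apply: Ck_mul; [exact: Ck_cst|exact: Ck_id].
Qed.

Lemma bump_itv c d t : 0 <= bump c d t < 1.
Proof.
rewrite mulr_ge0 ?flat_ge0//= -[ltRHS]mulr1.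
by rewrite ltr_pM ?flat_ge0 ?flat0_lt1.
Qed.

Lemma bump_gt0 c d t : c < t < d -> 0 < bump c d t.
Proof. by move=> /andP[ct td]; rewrite mulr_gt0// flat0_gt0// subr_gt0. Qed.

Lemma bump0 c d t : ~~ (c < t < d) -> bump c d t = 0.
Proof.
rewrite negb_and -!leNgt /bump => /orP[ct|dt].
  by rewrite flat_le0 ?mul0r// subr_le0.
by rewrite (flat_le0 _ (_ : d - t <= 0)) ?mulr0// subr_le0.
Qed.

(** Powers of a number in [0, 1) replace rescaling: for every n the function lives in the same
    interval and in [0, 1], and it tends pointwise to the indicator of []c, d[]. *)
Definition plateau n c d t : R := 1 - (1 - bump c d t) ^+ n.

Lemma plateau_Ck k n c d : Ck k (plateau n c d).
Proof.
have CB (g : R -> R) : Ck k g -> Ck k (fun t => 1 - g t).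
  move=> Cg; rewrite (_ : (fun t => _) = (fun=> 1) \+ ((fun=> -1) \* g)).
    by apply: Ck_add; [exact: Ck_cst|apply: Ck_mul => //; exact: Ck_cst].
  by apply/funext => t /=; rewrite mulN1r.
apply: (CB (fun t => (1 - bump c d t) ^+ n)); apply: Ck_exp.
by apply: CB; exact: bump_Ck.
Qed.

Lemma plateau_itv n c d t : 0 <= plateau n c d t <= 1.
Proof.
have /andP[b0 b1] := bump_itv c d t.
have b1' : 0 <= 1 - bump c d t by rewrite subr_ge0 ltW.
rewrite subr_ge0 exprn_ile1//=; last by rewrite gerBl.
by rewrite gerBl exprn_ge0.
Qed.

Lemma plateau0 n c d t : ~~ (c < t < d) -> plateau n c d t = 0.
Proof. by move=> /bump0; rewrite /plateau => ->; rewrite subr0 expr1n subrr. Qed.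

Lemma plateau_cvg c d t :
  plateau n c d t @[n --> \oo] --> (\1_`]c, d[ t : R).
Proof.
rewrite indicE; have [|tcd] := boolP (t \in _).
  rewrite inE/= in_itv/= => /bump_gt0 b0; have /andP[_ b1] := bump_itv c d t.
  rewrite /plateau -[X in _ --> X](subr0 1); apply: cvgB; first exact: cvg_cst.
  by apply: cvg_expr; rewrite ger0_norm ?subr_ge0 ?(ltW b1)// gtrBl.
rewrite (_ : (fun n => _) = cst 0); first exact: cvg_cst.
apply/funext => n; rewrite plateau0//; apply: contra tcd => tcd.
by rewrite inE/= in_itv.
Qed.

Lemma plateau_cont n c d : continuous (plateau n c d).
Proof. exact: (Ck_cont (plateau_Ck 0 n c d)). Qed.

Lemma plateau_supp n c d t : ~~ (c <= t <= d) -> plateau n c d t = 0.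
Proof.
move=> tcd; apply: plateau0; apply: contra tcd => /andP[/ltW -> /ltW ->]//.
Qed.

Lemma plateau_integrable n c d : leb.-integrable setT (EFin \o plateau n c d).
Proof.
by apply: (@continuous_supp_integrable (plateau n c d) c d) => [|t];
  [exact: plateau_cont|exact: plateau_supp].
Qed.

Definition plateau_mass n c d : R := \int[leb]_t plateau n c d t.

Lemma plateau_massE n c d : plateau_mass n c d = \int[leb]_(t in `]c, d[) plateau n c d t.
Proof.
rewrite Rintegral_mkcond; apply: eq_Rintegral => t _; rewrite patchE.
case: ifPn => // tcd; rewrite plateau0//; apply: contra tcd => tcd.
by rewrite inE/= in_itv.
Qed.

Lemma Rintegral1_oo c d : c <= d -> \int[leb]_(t in `]c, d[) 1 = d - c.
Proof.
move=> cd; rewrite Rintegral_cst; last exact: measurable_itv.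
rewrite mul1r /= lebesgue_measure_itv/= lte_fin.
by case: ltgtP cd => //= ->; rewrite subrr.
Qed.

Lemma integrable1_oo c d : leb.-integrable `]c, d[ (EFin \o cst 1).
Proof.
apply/integrableP; split; first exact/measurable_EFinP/measurable_cst.
under eq_integral do rewrite /= normr1.
rewrite integral_cst//=.
by rewrite lebesgue_measure_itv/= mul1e; case: ifP => //; rewrite -EFinB ltry.
Qed.

Lemma plateau_mass_cvg c d : c <= d -> plateau_mass n c d @[n --> \oo] --> d - c.
Proof.
move=> cd; under eq_fun do rewrite plateau_massE.
rewrite -(Rintegral1_oo cd).
apply: fine_cvg; rewrite fineK; last first.
  rewrite integral_cst//=.
  by rewrite lebesgue_measure_itv/= mul1e; case: ifP.
have [||||||_ _] := @dominated_convergence _ _ R leb `]c, d[ _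
  (fun n t => (plateau n c d t)%:E) (cst 1%E) (cst 1%E); last by exact.
- exact: measurable_itv.
- move=> n; apply/measurable_EFinP; apply: measurable_funTS.
  by apply: continuous_measurable_fun; exact: plateau_cont.
- exact: measurable_cst.
- apply: aeW => t; rewrite /= in_itv/= => tcd; apply: cvg_EFin; first exact: nearW.
  have := @plateau_cvg c d t; rewrite indicE mem_set//= in_itv//.
- exact: integrable1_oo.
- apply: aeW => t n _; rewrite lee_fin; have /andP[p0 p1] := plateau_itv n c d t.
  by rewrite ger0_norm.
Qed.

Lemma plateau_mass_itv n c d : c <= d -> 0 <= plateau_mass n c d <= d - c.
Proof.
move=> cd; rewrite Rintegral_ge0/=; last by move=> t _; case/andP: (plateau_itv n c d t).
rewrite plateau_massE.
rewrite -(Rintegral1_oo cd).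
apply: le_Rintegral => //.
- exact: integrableS (plateau_integrable n c d).
- exact: integrable1_oo.
- by move=> t _; case/andP: (plateau_itv n c d t).
Qed.
End plateau.

(** * Functions of class C^k on R^n *)

(** Reduces directional derivatives to derivatives in one real variable, so that the chain rule and
    integration along a coordinate can be taken from the line. *)
Lemma is_derive_line (R : realType) (V : normedModType R) (f : V -> R) x v (a : R) :
  is_derive (0 : R) 1 (fun h : R => f (h *: v + x)) a <-> is_derive x v f a.
Proof.
have E : (fun h : R => h^-1 *: (f ((h *: 1 + 0) *: v + x) - f (0 *: v + x))) =
         (fun h : R => h^-1 *: (f (h *: v + x) - f x)).
  by apply/funext => h; rewrite addr0 scale0r add0r /GRing.scale/= mulr1.
split=> -[df <-]; split.
- by move: df; rewrite /derivable E.
- by rewrite /derive E.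
- by rewrite /derivable E.
- by rewrite /derive E.
Qed.

Section class_C_theory.
Context {R : realType} {N : nat}.
Implicit Types (f g q : 'rV[R]_N -> R) (k : nat) (x v : 'rV[R]_N).

Lemma class_C_cont k f : class_C k f -> continuous f.
Proof. by case: k => [|k] []. Qed.

Lemma class_CS k f (f' : 'I_N -> 'rV[R]_N -> R) : continuous f ->
  (forall i x, is_derive x (delta_mx 0 i) f (f' i x)) ->
  (forall i, class_C k (f' i)) -> class_C k.+1 f.
Proof.
move=> cf ff' Cf'; split=> // i; split; first by move=> x; have [] := ff' i x.
rewrite (_ : partial i f = f' i)//; apply/funext => x.
by rewrite /partial; have [_ ->] := ff' i x.
Qed.

Lemma class_CW k f : class_C k.+1 f -> class_C k f.
Proof.
elim: k f => [|k ih] f; first by move=> [cf _]; split.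
by move=> [cf df]; split=> // i; have [dfi /ih] := df i; split.
Qed.

Lemma class_C_derivable k f i x : class_C k.+1 f ->
  is_derive x (delta_mx 0 i) f (partial i f x).
Proof. by move=> [_ /(_ i)[df _]]; split. Qed.

Lemma class_C_partial k f i : class_C k.+1 f -> class_C k (partial i f).
Proof. by move=> [_ /(_ i)[]]. Qed.

Lemma class_C_cst k (c : R) : @class_C R N k (fun=> c).
Proof.
have cc (a : R) : continuous (fun _ : 'rV[R]_N => a) by exact: cst_continuous.
elim: k c => [|k ih] c; first by split.
apply: (@class_CS _ _ (fun _ _ => 0)) => // i x; exact: is_derive_cst.
Qed.

Lemma continuous_addf f g : continuous f -> continuous g -> continuous (f \+ g).
Proof. by move=> cf cg x; exact: (continuousD (cf x) (cg x)). Qed.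

Lemma continuous_mulf f g : continuous f -> continuous g -> continuous (f \* g).
Proof. by move=> cf cg x; exact: (continuousM (cf x) (cg x)). Qed.

Lemma class_C_add k f g : class_C k f -> class_C k g -> class_C k (f \+ g).
Proof.
elim: k f g => [|k ih] f g Cf Cg.
  by split => //; apply: continuous_addf; [exact: (class_C_cont Cf)|exact: (class_C_cont Cg)].
apply: (@class_CS _ _ (fun i => partial i f \+ partial i g)).
- by apply: continuous_addf; [exact: (class_C_cont Cf)|exact: (class_C_cont Cg)].
- move=> i x; have df := class_C_derivable i x Cf; have dg := class_C_derivable i x Cg.
  exact: is_deriveD.
- by move=> i; apply: ih; exact: class_C_partial.
Qed.

Lemma class_C_mul k f g : class_C k f -> class_C k g -> class_C k (f \* g).
Proof.
elim: k f g => [|k ih] f g Cf Cg.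
  by split => //; apply: continuous_mulf; [exact: (class_C_cont Cf)|exact: (class_C_cont Cg)].
apply: (@class_CS _ _ (fun i => (f \* partial i g) \+ (g \* partial i f))).
- by apply: continuous_mulf; [exact: (class_C_cont Cf)|exact: (class_C_cont Cg)].
- move=> i x; have df := class_C_derivable i x Cf; have dg := class_C_derivable i x Cg.
  exact: is_deriveM.
- by move=> i; apply: class_C_add; apply: ih; solve [exact: class_CW|exact: class_C_partial].
Qed.

Lemma class_C_sum k (I : Type) (r : seq I) (F : I -> 'rV[R]_N -> R) :
  (forall i, class_C k (F i)) -> class_C k (fun x => \sum_(i <- r) F i x).
Proof.
move=> CF; elim: r => [|a r ih].
  by under eq_fun do rewrite big_nil; exact: class_C_cst.
by under eq_fun do rewrite big_cons; exact: class_C_add.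
Qed.

Lemma class_C_prod k (I : Type) (r : seq I) (F : I -> 'rV[R]_N -> R) :
  (forall i, class_C k (F i)) -> class_C k (fun x => \prod_(i <- r) F i x).
Proof.
move=> CF; elim: r => [|a r ih].
  by under eq_fun do rewrite big_nil; exact: class_C_cst.
by under eq_fun do rewrite big_cons; exact: class_C_mul.
Qed.

Lemma is_derive_comp1 (psi : R -> R) q x v (a b : R) :
  is_derive (q x) 1 psi a -> is_derive x v q b -> is_derive x v (psi \o q) (a * b).
Proof.
move=> dpsi /is_derive_line dq; apply/is_derive_line.
apply: (@is_derive1_comp R psi (fun h => q (h *: v + x)) 0 a b) => //.
by rewrite scale0r add0r.
Qed.

Lemma continuous_compf (psi : R -> R) q : continuous psi -> continuous q -> continuous (psi \o q).
Proof. by move=> cp cq x; exact: (continuous_comp (cq x) (cp (q x))). Qed.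

Lemma class_C_comp k (psi : R -> R) q : Ck k psi -> class_C k q -> class_C k (psi \o q).
Proof.
elim: k psi q => [|k ih] psi q Cp Cq.
  split => //; apply: continuous_compf; [exact: (Ck_cont Cp)|exact: (class_C_cont Cq)].
apply: (@class_CS _ _ (fun i => ((psi^`())%classic \o q) \* partial i q)).
- by apply: continuous_compf; [exact: (Ck_cont Cp)|exact: (class_C_cont Cq)].
- move=> i x; apply: is_derive_comp1; first exact: Ck_is_derive Cp.
  exact: class_C_derivable Cq.
- move=> i; apply: class_C_mul; last exact: class_C_partial.
  by apply: ih; [case: Cp => _ []|exact: class_CW].
Qed.

Lemma is_derive_coord (i : 'I_N) x v : is_derive x v (fun y : 'rV[R]_N => y 0 i) (v 0 i).
Proof.
have H : h^-1 *: ((h *: v + x) 0 i - x 0 i) @[h --> (0 : R)^'] --> v 0 i.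
  apply: (@cvg_near_cst _ _ _ _ _); near=> h.
  rewrite !mxE addrK /GRing.scale/= mulKf//; near: h; exact: nbhs_dnbhs_neq.
by split; [apply/cvg_ex; exists (v 0 i)|exact/cvg_lim].
Unshelve. all: by end_near. Qed.

Lemma class_C_coord k (i : 'I_N) : class_C k (fun x : 'rV[R]_N => x 0 i).
Proof.
case: k => [|k]; first by split => //; exact: coord_continuous.
apply: (@class_CS _ _ (fun j _ => (delta_mx 0 j : 'rV[R]_N) 0 i)); first exact: coord_continuous.
  by move=> j x; exact: is_derive_coord.
by move=> j; exact: class_C_cst.
Qed.

(** The variable t of the overview: polynomial, hence smooth at the origin too, and additive over
    coordinates, so that freezing all but one leaves t = c + s^2. *)
Definition sqn x : R := \sum_(i < N) x 0 i ^+ 2.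

Lemma class_C_sqn k : class_C k sqn.
Proof.
apply: class_C_sum => i; rewrite (_ : (fun x => _) = (fun x => x 0 i) \* (fun x => x 0 i))//.
by apply: class_C_mul; exact: class_C_coord.
Qed.

Lemma is_derive_sqn (i : 'I_N) x : is_derive x (delta_mx 0 i) sqn (2 * x 0 i).
Proof.
have := class_C_derivable i x (class_C_sqn 1); rewrite (_ : partial i sqn x = 2 * x 0 i)//.
rewrite /partial /sqn.
have -> : (fun x : 'rV[R]_N => \sum_(j < N) x 0 j ^+ 2) =
          \sum_(j < N) (fun x : 'rV[R]_N => x 0 j ^+ 2).
  by apply/funext => y; rewrite fct_sumE.
have dj (j : 'I_N) : is_derive x (delta_mx 0 i) (fun x : 'rV[R]_N => x 0 j ^+ 2)
    ((2 * x 0 j) * (i == j)%:R).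
  have d := is_derive_coord j x (delta_mx 0 i).
  have := is_deriveX 2 d; rewrite exprfctE => d2; apply: is_derive_eq d2 _.
  by rewrite /GRing.scale/= mxE eqxx/= expr1 eq_sym.
rewrite derive_sum; last by move=> j; have [] := dj j.
rewrite (bigD1 i)//= big1 ?addr0; first by have [_ ->] := dj i; rewrite eqxx mulr1.
by move=> j ji; have [_ ->] := dj j; rewrite eq_sym (negbTE ji) mulr0.
Qed.

Lemma test_functionP phi (M : R) : (forall k, class_C k phi) ->
  (forall x, phi x != 0 -> forall i, `|x 0 i| <= M) -> test_function phi.
Proof.
move=> Cphi phiM; split=> //.
pose B := [set x : 'rV[R]_N | forall i, `[- M, M]%classic (x 0 i)].
have cB : compact B by apply: (@rV_compact _ _ (fun=> `[- M, M]%classic)) => _; exact: segment_compact.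
apply: (subclosed_compact _ cB); first exact: closed_closure.
have clB : closed B by apply: compact_closed cB; exact: norm_hausdorff.
rewrite [X in _ `<=` X](closure_id B).1//; apply: closure_subset => x /= /phiM xM i.
by rewrite /= in_itv/= -ler_norml; exact: xM.
Qed.
End class_C_theory.

(** * Change of variables and nonmeasurable integrands *)

Section weighted_pushforward.
Local Open Scope ereal_scope.
Context d d' (X : measurableType d) (Y : measurableType d') (R : realType).
Variables (mu : {measure set X -> \bar R}) (p : X -> Y) (k : X -> R).
Hypotheses (mp : measurable_fun setT p) (mk : measurable_fun setT k).
Hypothesis k0 : forall x, (0 <= k x)%R.

(** Image under [p] of the measure with density [k]. One change of variables then covers [rV_cons]
    and translations (density 1) and t = c + s|s| (density 2|s|); with [p] the identity it turns a
    nonnegative function into a measure. *)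
Definition weighted_pushforward (A : set Y) : \bar R := \int[mu]_(x in p @^-1` A) (k x)%:E.

Let wp0 : weighted_pushforward set0 = 0.
Proof. by rewrite /weighted_pushforward preimage_set0 integral_set0. Qed.

Let wp_ge0 A : 0 <= weighted_pushforward A.
Proof. by apply: integral_ge0 => x _; rewrite lee_fin. Qed.

Let mpre A : measurable A -> measurable (p @^-1` A).
Proof. by move=> mA; rewrite -[X in measurable X]setTI; exact: mp. Qed.

Let wp_sigma_additive : semi_sigma_additive weighted_pushforward.
Proof.
move=> F mF tF mUF; rewrite /weighted_pushforward preimage_bigcup.
apply: (@semi_sigma_additive_nng_induced _ _ _ mu (EFin \o k)).
- exact/measurable_EFinP.
- by move=> x; rewrite lee_fin.
- by move=> n; exact: mpre.
- apply/trivIsetP => /= i j _ _ ij; rewrite -preimage_setI.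
  by move/trivIsetP : tF => /(_ _ _ _ _ ij) ->//; rewrite preimage_set0.
- by rewrite -preimage_bigcup; exact: mpre.
Qed.

Lemma weighted_pushforward_measure :
  exists m : {measure set Y -> \bar R}, forall A, m A = weighted_pushforward A.
Proof.
pose b := isMeasure.Build _ _ _ weighted_pushforward wp0 wp_ge0 wp_sigma_additive.
by exists (HB.pack_for (Measure.type Y R) weighted_pushforward b).
Qed.

Import HBNNSimple.

(** The measure [nu] need only agree with the pushforward on measurable sets, so it can be Lebesgue
    measure itself, identified beforehand by a uniqueness theorem. The proof passes from simple
    functions to the limit by monotone convergence. *)
Lemma ge0_integral_weighted_pushforward (nu : {measure set Y -> \bar R}) (F : Y -> \bar R) :
  (forall A, measurable A -> nu A = weighted_pushforward A) ->
  measurable_fun setT F -> (forall y, 0 <= F y) ->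
  \int[nu]_y F y = \int[mu]_x (F (p x) * (k x)%:E).
Proof.
move=> nuE mF F0.
pose f_ := nnsfun_approx measurableT mF.
transitivity (limn (fun n => \int[nu]_x (f_ n x)%:E)).
  rewrite -monotone_convergence//.
  - apply: eq_integral => y _; apply/esym/cvg_lim => //.
    by apply: cvg_nnsfun_approx => // *; exact: F0.
  - by move=> n; exact/measurable_EFinP/measurable_funP.
  - by move=> n y _; rewrite lee_fin.
  - by move=> y _ m n mn; rewrite lee_fin; exact/lefP/nd_nnsfun_approx.
have mfp n : measurable_fun setT (fun x => (f_ n (p x))%:E).
  by apply/measurable_EFinP; apply: measurableT_comp => //; exact: measurable_funP.
have mkE : measurable_fun setT (fun x => (k x)%:E) by exact/measurable_EFinP.
transitivity (limn (fun n => \int[mu]_x ((f_ n (p x))%:E * (k x)%:E))); last first.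
  rewrite -monotone_convergence//; last 3 first.
    - by move=> n; exact: emeasurable_funM.
    - by move=> n x _; rewrite mule_ge0// lee_fin.
    - by move=> x _ m n mn; rewrite lee_wpmul2r// lee_fin; [exact: k0|exact/lefP/nd_nnsfun_approx].
  apply: eq_integral => x _; apply/cvg_lim => //.
  apply: cvgeZr => //.
  by apply: cvg_nnsfun_approx => // *; exact: F0.
apply: congr_lim; apply/funext => n; rewrite integralT_nnsfun sintegralE.
under [RHS]eq_integral.
  move=> x _; rewrite fimfunE -fsumEFin// ge0_mule_fsuml; last first.
    by move=> y; rewrite EFinM nnfun_muleindic_ge0.
  under eq_fsbigr do rewrite EFinM -muleA; over.
rewrite ge0_integral_fsum//; last 2 first.
  - move=> r; apply: emeasurable_funM => //; apply: emeasurable_funM => //.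
    by apply/measurable_EFinP; apply: measurableT_comp => //.
  - move=> r x _; rewrite muleA mule_ge0 ?lee_fin//.
    exact: nnfun_muleindic_ge0.
apply: eq_fsbigr => r /set_mem [y _ <-{r}].
rewrite ge0_integralZl//; last 3 first.
  - by apply: emeasurable_funM => //; apply/measurable_EFinP; apply: measurableT_comp => //.
  - by move=> x _; rewrite mule_ge0// lee_fin.
  - by rewrite lee_fin.
congr (_ * _); rewrite nuE// /weighted_pushforward integral_mkcond.
apply: eq_integral => x _; rewrite epatch_indic muleC.
by congr (_ * _).
Qed.
End weighted_pushforward.

Section integral_nonmeasurable.
Local Open Scope ereal_scope.
Context d (T : measurableType d) (R : realType) (mu : {measure set T -> \bar R}).
Implicit Types f g : T -> \bar R.

(** The integral of a nonnegative function is a supremum over the simple functions below it, and a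
    larger function has more of them. *)
Lemma ge0_le_integral_nonmeasurable f g : (forall x, 0 <= f x) ->
  (forall x, f x <= g x) -> \int[mu]_x f x <= \int[mu]_x g x.
Proof.
move=> f0 fg; have g0 x : 0 <= g x by exact: le_trans (fg x).
rewrite !ge0_integralTE//; apply: ereal_sup_le => _ [h hf <-].
by exists h => // x; exact: le_trans (hf x) (fg x).
Qed.

(** Only the upper function is measurable. Raising it to +oo on the exceptional null set keeps its
    integral and makes it dominate the positive part of [f] everywhere, where monotonicity of the
    supremum applies. *)
Lemma integral_le_ae f g : measurable_fun setT g -> (forall x, 0 <= g x) ->
  {ae mu, forall x, f x <= g x} -> \int[mu]_x f x <= \int[mu]_x g x.
Proof.
move=> mg g0 [N [mN N0 fgN]].
pose g' x := maxe (g x) ((cst +oo \_ N) x).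
have mg' : measurable_fun setT g'.
  by apply: measurable_maxe => //; apply/(measurable_restrictT _ mN); exact: measurable_cst.
have g'0 x : 0 <= g' x by rewrite le_max g0.
have -> : \int[mu]_x g x = \int[mu]_x g' x.
  apply: ae_eq_integral => //; exists N; split=> // x /= ng; apply: contrapT => Nx.
  by apply: ng => _; rewrite /g' patchE memNset// max_l.
rewrite integralE; apply: (@le_trans _ _ (\int[mu]_x f^\+ x)).
  by rewrite -[leRHS]sube0 leeB// integral_ge0.
apply: ge0_le_integral_nonmeasurable => // x.
rewrite funeposE ge_max g'0 andbT /g' patchE.
case: ifPn => [_|xN]; first by rewrite max_r ?leey.
rewrite max_l//; apply: contrapT => fg; move: xN; rewrite notin_setE; apply.
by apply: fgN.
Qed.

(** Dual device: the measurable lower function is set to 0 on the null set. The negative part of [f]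
    vanishes almost everywhere, so its integral is 0 by [integral_le_ae]. *)
Lemma integral_ge_ae f g : measurable_fun setT g -> (forall x, 0 <= g x) ->
  {ae mu, forall x, g x <= f x} -> \int[mu]_x g x <= \int[mu]_x f x.
Proof.
move=> mg g0 [N [mN N0 fgN]].
have gf x : ~ N x -> g x <= f x by move=> Nx; apply: contrapT => H; exact/Nx/fgN.
have fN0 : \int[mu]_x f^\- x = 0.
  apply/eqP; rewrite eq_le integral_ge0// andbT.
  apply: (@le_trans _ _ (\int[mu]_x 0)); last by rewrite integral0.
  apply: integral_le_ae => //; exists N; split=> // x /= H; apply: contrapT => Nx; apply: H.
  by rewrite funenegE ge_max lexx andbT leeNl oppe0 (le_trans (g0 x))// gf.
pose g' := g \_ (~` N).
have -> : \int[mu]_x g x = \int[mu]_x g' x.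
  apply: ae_eq_integral => //; first by apply/(measurable_restrictT _ (measurableC mN)); exact: measurable_funTS.
  exists N; split=> // x /= ng; apply: contrapT => Nx.
  by apply: ng => _; rewrite /g' patchE mem_set.
rewrite [leRHS]integralE fN0 sube0; apply: ge0_le_integral_nonmeasurable => x.
  by rewrite /g' patchE; case: ifP.
rewrite funeposE /g' patchE; case: ifPn => [|_]; last by rewrite le_max lexx orbT.
by rewrite inE => /gf gfx; rewrite le_max gfx.
Qed.
End integral_nonmeasurable.

(** * The substitution t = c + s^2 *)

Section signed_square.
Context {R : realType}.
Notation leb := (@lebesgue_measure R).

Lemma is_derive_sqr_abs (s : R) : is_derive s 1 (fun s : R => s * `|s|) (2 * `|s|).
Proof.
have dX : is_derive s 1 (fun s : R => s ^+ 2) (2 * s).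
  have := is_deriveX 2 (@is_derive_id _ _ s 1); rewrite exprfctE => d; apply: is_derive_eq d _.
  by rewrite /GRing.scale/= mulr1 expr1.
have [s0|s0|->] := ltgtP s 0.
- have eqf : \near s, - (s ^+ 2) = s * `|s|.
    near=> t; rewrite ltr0_norm ?mulrN//; near: t; exact: lt_nbhsl.
  apply: near_eq_is_derive eqf _.
  by apply: is_derive_eq (is_deriveN dX) _; rewrite ltr0_norm// mulrN.
- have eqf : \near s, (s ^+ 2) = s * `|s|.
    near=> t; rewrite gtr0_norm//; near: t; exact: lt_nbhsr.
  by apply: near_eq_is_derive eqf _; rewrite gtr0_norm.
- rewrite normr0 mulr0; apply: (@is_derive0_sqr R _ 1) => // h.
  by rewrite normrM normr_id mul1r -real_normK ?num_real.
Unshelve. all: by end_near. Qed.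

(** An increasing bijection of the line that equals c + s^2 for s >= 0, so that preimages of
    intervals are intervals. *)
Definition signed_sqr (c s : R) : R := c + s * `|s|.

Lemma is_derive_signed_sqr c (s : R) : is_derive s 1 (signed_sqr c) (2 * `|s|).
Proof.
rewrite /signed_sqr -[X in is_derive _ _ _ X]add0r.
have d1 := is_derive_sqr_abs s; have d2 : is_derive s 1 (fun=> c) 0 by exact: is_derive_cst.
exact: (is_deriveD d2 d1).
Qed.

Lemma signed_sqr_cont c : continuous (signed_sqr c).
Proof.
move=> s; apply: differentiable_continuous; apply/derivable1_diffP.
by have [] := is_derive_signed_sqr c s.
Qed.

Lemma signed_sqr_mono c : {mono signed_sqr c : s t / s <= t}.
Proof.
apply: le_mono => s t st; rewrite /signed_sqr ltrD2l.
have [s0|s0] := leP 0 s.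
  by rewrite !ger0_norm ?(le_trans s0 (ltW st))// -!expr2 ltr_pXn2r ?nnegrE ?(le_trans s0 (ltW st)).
rewrite (ltr0_norm s0) mulrN -expr2; have [t0|t0] := ltP t 0.
  rewrite (ltr0_norm t0) mulrN -expr2 ltrN2 -sqrrN -[ltRHS]sqrrN.
  by rewrite ltr_pXn2r ?nnegrE ?oppr_ge0 ?ltW// ltrN2.
rewrite ger0_norm// -expr2 (lt_le_trans _ (sqr_ge0 t))// oppr_lt0.
by rewrite exprn_even_gt0//= lt_eqF.
Qed.

Lemma signed_sqr_surj c t : exists s, signed_sqr c s = t.
Proof.
exists (Num.sg (t - c) * Num.sqrt `|t - c|).
rewrite /signed_sqr normrM normr_sg ger0_norm ?sqrtr_ge0// mulrACA -expr2 sqr_sqrtr//.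
have [/eqP|_] := eqVneq (t - c) 0.
  by rewrite subr_eq0 => /eqP ->; rewrite subrr normr0 mulr0 addr0.
by rewrite mulr1 -numEsg addrC subrK.
Qed.

(** Both sides are measures in [A]; they agree on []a, b]] by the fundamental theorem of calculus,
    which characterises Lebesgue measure. *)
Lemma signed_sqr_preimage c A : measurable A ->
  leb A = (\int[leb]_(s in signed_sqr c @^-1` A) (2 * `|s|)%:E)%E.
Proof.
have c2 : continuous (fun s : R => 2 * `|s|).
  by move=> s; apply: cvgM; [exact: cvg_cst|exact: norm_continuous].
have m2 : measurable_fun setT (fun s : R => 2 * `|s|) by exact: continuous_measurable_fun.
have ms : measurable_fun setT (signed_sqr c) by apply: continuous_measurable_fun; exact: signed_sqr_cont.
have k0 (s : R) : 0 <= 2 * `|s| by rewrite mulr_ge0.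
have [m mE] := @weighted_pushforward_measure _ _ _ (measurableTypeR R) R leb (signed_sqr c) _ ms m2 k0.
move=> mA; rewrite -[RHS](mE A); move: A mA; apply: lebesgue_measure_unique.
move=> _ [[a b] /= _ <-]; rewrite mE /weighted_pushforward.
have [a' a'E] := signed_sqr_surj c a; have [b' b'E] := signed_sqr_surj c b.
have -> : signed_sqr c @^-1` `]a, b] = `]a', b']%classic.
  apply/seteqP; split=> s; rewrite /= !in_itv/= -a'E -b'E;
  by rewrite (leW_mono (signed_sqr_mono c)) (signed_sqr_mono c).
rewrite lebesgue_measure_itv/= lte_fin -a'E -b'E (leW_mono (signed_sqr_mono c)).
have [ab|ba] := ltP a' b'; last first.
  by rewrite set_itv_ge ?integral_set0// bnd_simp -leNgt.
rewrite integral_itv_obnd_cbnd; last exact/measurable_EFinP/measurable_funTS.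
rewrite (@continuous_FTC2 _ (fun s => 2 * `|s|) (signed_sqr c) a' b')//.
- exact: continuous_subspaceT.
- split.
  + by move=> s _; have [] := is_derive_signed_sqr c s.
  + by apply: cvg_at_right_filter; exact: signed_sqr_cont.
  + by apply: cvg_at_left_filter; exact: signed_sqr_cont.
- by move=> s _; rewrite derive1E; have [_ ->] := is_derive_signed_sqr c s.
Qed.

Lemma ge0_integral_sqr_subst c (F : R -> \bar R) : measurable_fun setT F ->
  (forall t, (0 <= F t)%E) ->
  (\int[leb]_(t in `]c, +oo[) F t =
   \int[leb]_(s in `]0%R, +oo[) (F (c + s ^+ 2)%R * (2 * s)%:E))%E.
Proof.
move=> mF F0.
have m2 : measurable_fun setT (fun s : R => 2 * `|s|).
  apply: continuous_measurable_fun => s.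
  by apply: cvgM; [exact: cvg_cst|exact: norm_continuous].
have ms : measurable_fun setT (signed_sqr c) by apply: continuous_measurable_fun; exact: signed_sqr_cont.
have k0 (s : R) : 0 <= 2 * `|s| by rewrite mulr_ge0.
rewrite integral_mkcond (@ge0_integral_weighted_pushforward _ _ (measurableTypeR R) (measurableTypeR R) R leb
  (signed_sqr c) _ ms m2 k0 leb _ (@signed_sqr_preimage c)).
- rewrite [RHS]integral_mkcond; apply: eq_integral => s _; rewrite !patchE.
  have -> : (signed_sqr c s \in `]c, +oo[%classic) = (s \in `]0, +oo[%classic).
    have c0 : signed_sqr c 0 = c by rewrite /signed_sqr mul0r addr0.
    apply/idP/idP; rewrite !inE/= !in_itv/= !andbT -{1}c0;
    by rewrite (leW_mono (signed_sqr_mono c)).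
  case: ifPn; rewrite ?mul0e//.
  by rewrite inE/= in_itv/= andbT => s0; rewrite /signed_sqr gtr0_norm.
- by apply/(measurable_restrictT _ (measurable_itv _)); exact: measurable_funTS.
- by move=> t; rewrite patchE; case: ifP.
Qed.
End signed_square.

(** * Lebesgue measure on row vectors *)

Section rV_measure.
Context {R : realType}.
Notation leb := (@lebesgue_measure R).

Lemma ge0_integral_rV_prod n (F : 'rV[R]_n.+1 -> \bar R) :
  measurable_fun setT F -> (forall x, (0 <= F x)%E) ->
  (\int[lebesgue_rV n.+1]_x F x = \int[(leb \x lebesgue_rV n)%E]_z F (rV_cons z))%E.
Proof.
move=> mF F0.
have m1 : measurable_fun [set: measurableTypeR R * 'rV[R]_n] (fun=> 1 : R) by exact: measurable_cst.
rewrite (@ge0_integral_weighted_pushforward _ _ _ _ R (leb \x lebesgue_rV n)%E (@rV_cons R n)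
  (fun=> 1) (@measurable_rV_cons R n) m1 _ (lebesgue_rV n.+1))//.
  by apply: eq_integral => z _; rewrite mule1.
move=> A mA; rewrite /weighted_pushforward integral_cst ?mul1e//.
by rewrite -[X in measurable X]setTI; exact: measurable_rV_cons.
Qed.

Lemma ge0_integral_rV_cons n (F : 'rV[R]_n.+1 -> \bar R) :
  measurable_fun setT F -> (forall x, (0 <= F x)%E) ->
  (\int[lebesgue_rV n.+1]_x F x =
   \int[lebesgue_rV n]_y \int[leb]_s F (rV_cons (s, y)))%E.
Proof.
move=> mF F0; rewrite ge0_integral_rV_prod//.
rewrite (@fubini_tonelli2 _ _ _ _ _ leb (lebesgue_rV n) (F \o @rV_cons R n))//.
  by apply: measurableT_comp => //; exact: measurable_rV_cons.
by move=> z; exact: F0.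
Qed.

Lemma ge0_integral_rV_cons1 n (F : 'rV[R]_n.+1 -> \bar R) :
  measurable_fun setT F -> (forall x, (0 <= F x)%E) ->
  (\int[lebesgue_rV n.+1]_x F x =
   \int[leb]_s \int[lebesgue_rV n]_y F (rV_cons (s, y)))%E.
Proof.
move=> mF F0; rewrite ge0_integral_rV_prod//.
rewrite (@fubini_tonelli1 _ _ _ _ _ leb (lebesgue_rV n) (F \o @rV_cons R n))//.
  by apply: measurableT_comp => //; exact: measurable_rV_cons.
by move=> z; exact: F0.
Qed.

Lemma measurable_rV_slice d (T : measurableType d) n (F : 'rV[R]_n.+1 -> T) (y : 'rV[R]_n) :
  measurable_fun setT F -> measurable_fun setT (fun s : R => F (rV_cons (s, y))).
Proof.
move=> mF; apply: (measurableT_comp mF).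
by apply: (measurableT_comp (@measurable_rV_cons R n)); exact: measurable_pair2.
Qed.

Lemma measurable_rV_slice_set n (Z : set 'rV[R]_n.+1) (y : 'rV[R]_n) : measurable Z ->
  measurable [set s : R | Z (rV_cons (s, y))].
Proof.
move=> mZ; have := @measurable_rV_slice _ _ n id y (@measurable_id _ _ _) measurableT Z mZ.
by rewrite setTI.
Qed.

Lemma negligible_rV_slices n (Z : set 'rV[R]_n.+1) : measurable Z ->
  lebesgue_rV n.+1 Z = 0%E ->
  {ae lebesgue_rV n, forall y, leb [set s | Z (rV_cons (s, y))] = 0%E}.
Proof.
move=> mZ Z0.
pose F x : \bar R := (\1_Z x)%:E.
have mF : measurable_fun setT F by apply/measurable_EFinP; exact: measurable_indic.
have F0 x : (0 <= F x)%E by rewrite lee_fin.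
have : (\int[lebesgue_rV n]_y \int[leb]_s F (rV_cons (s, y)) = 0)%E.
  by rewrite -ge0_integral_rV_cons// integral_indic// setIT.
have mG : measurable_fun setT (fun y => \int[leb]_s F (rV_cons (s, y)))%E.
  apply: (@measurable_fun_fubini_tonelli_G _ _ _ _ _ leb (F \o @rV_cons R n)) => [|z]; last exact: F0.
  by apply: measurableT_comp => //; exact: measurable_rV_cons.
have G0 y : (0 <= \int[leb]_s F (rV_cons (s, y)))%E by exact: integral_ge0.
move=> I0; have /ae_eq_integral_abs : (\int[lebesgue_rV n]_y `|\int[leb]_s F (rV_cons (s, y))| = 0)%E.
  by under eq_integral do rewrite gee0_abs//.
move=> /(_ measurableT mG); apply: filterS => y /(_ I) /=.
rewrite /F (_ : (fun s => (\1_Z (rV_cons (s, y)))%:E) = (fun s => (\1_[set s | Z (rV_cons (s, y))] s)%:E)).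
  rewrite integral_indic ?setIT//.
  exact: measurable_rV_slice_set.
by apply/funext => s; rewrite !indicE.
Qed.

Definition obox n (a b : 'I_n -> R) : set 'rV[R]_n := [set x | forall i, a i < x 0 i < b i].

Lemma measurable_rV_forall n (A : 'I_n -> set (measurableTypeR R)) : (forall i, measurable (A i)) ->
  measurable [set x : 'rV[R]_n | forall i, A i (x 0 i)].
Proof.
move=> mA; rewrite (_ : [set x : 'rV[R]_n | _] = \bigcap_(i in [set: 'I_n])
  ((fun x : 'rV[R]_n => x 0 i : measurableTypeR R) @^-1` A i)).
  apply: fin_bigcap_measurable => // i _.
  by rewrite -[X in measurable X]setTI; exact: measurable_coord.
by apply/seteqP; split => x /= Ax i; [move=> _|]; exact: Ax.
Qed.

Lemma oboxE n (a b : 'I_n -> R) : obox a b = [set x | forall i, `]a i, b i[%classic (x 0 i)].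
Proof. by apply/seteqP; split=> x /= + i => /(_ i); rewrite in_itv. Qed.

Lemma measurable_obox n (a b : 'I_n -> R) : measurable (obox a b).
Proof. by rewrite oboxE; apply: (@measurable_rV_forall n (fun i => `]a i, b i[%classic)) => i; exact: measurable_itv. Qed.

Lemma lebesgue_obox n (a b : 'I_n -> R) : (forall i, a i <= b i) ->
  lebesgue_rV n (obox a b) = (\prod_(i < n) (b i - a i))%:E.
Proof.
move=> ab; rewrite oboxE (@lebesgue_rV_box R n (fun i => `]a i, b i[%classic)); last by move=> i; exact: measurable_itv.
rewrite -prodEFin; apply: eq_bigr => i _; rewrite lebesgue_measure_itv/= lte_fin.
by case: ltgtP (ab i) => //= ->; rewrite subrr.
Qed.

(** The sigma-algebra is generated by the coordinates, so open sets must be shown measurable: each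
    is the union of the countably many rational boxes that it contains. *)
Lemma continuous_measurable_rV n (f : 'rV[R]_n -> R) : continuous f -> measurable_fun setT f.
Proof.
move=> cf; apply: (measurability _ (RGenOpens.measurableE R)).
move=> _ [_ [a [b ->] <-]]; rewrite setTI.
have : open (f @^-1` `]a, b[) by apply: open_comp => // x _; exact: cf.
move: (f @^-1` _) => O oO.
pose B (z : 'rV[rat]_n * nat) : set 'rV[R]_n :=
  obox (fun i => ratr (z.1 0 i) - z.2.+1%:R^-1) (fun i => ratr (z.1 0 i) + z.2.+1%:R^-1).
pose G (m : nat) : set 'rV[R]_n :=
  if @unpickle ('rV[rat]_n * nat)%type m is Some z then
    if `[< B z `<=` O >] then B z else set0 else set0.
have -> : O = \bigcup_m G m.
  apply/seteqP; split=> [x Ox|x [m _]]; last first.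
    by rewrite /G; case: unpickle => // z; case: ifPn => // /asboolP + Bx; exact.
  have /nbhs_ballP[e /= e0 xeO] := open_nbhs_nbhs (conj oO Ox).
  (* Half the radius: the box is centred at a rational point within 1/(k+1) of x, so its points lie
     within 2/(k+1) of x. *)
  have [k ke] : exists k : nat, k.+1%:R^-1 < e / 2.
    have e2 : 0 < e / 2 by rewrite divr_gt0.
    exists (Num.truncn (e / 2)^-1); rewrite invf_plt ?posrE//.
    by rewrite truncnS_gt.
  have k0 : 0 < k.+1%:R^-1 :> R by rewrite invr_gt0.
  have /choice[q qP] : forall i : 'I_n, exists q : rat, x 0 i - k.+1%:R^-1 < ratr q < x 0 i + k.+1%:R^-1.
    move=> i; have [|q] := @rat_in_itvoo R (x 0 i - k.+1%:R^-1) (x 0 i + k.+1%:R^-1).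
      by rewrite ltrD2l gtrN.
    by rewrite in_itv/=; exists q.
  exists (pickle (\row_i q i, k)) => //; rewrite /G pickleK.
  case: ifPn => [_|/asboolP[]].
    move=> i /=; rewrite mxE; have /andP[q1 q2] := qP i.
    by rewrite ltrBlDr q2 -ltrBlDr q1.
  move=> y yB; apply: xeO; split=> // i j /=; rewrite !ord1.
  have := yB j; rewrite /= mxE; have := qP j.
  rewrite /ball/=; move: (k.+1%:R^-1 : R) ke => r ke /andP[q1 q2] /andP[y1 y2].
  rewrite ltr_norml; apply/andP; split; lra.
apply: bigcupT_measurable => m; rewrite /G; case: unpickle => // z; case: ifP => // _.
exact: measurable_obox.
Qed.
End rV_measure.

Section rV_sqn.
Context {R : realType}.
Notation leb := (@lebesgue_measure R).

Lemma rV_bounded n (x : 'rV[R]_n) : exists k : nat, forall i, `|x 0 i| < k%:R.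
Proof.
exists (\sum_i (Num.truncn `|x 0%R i|).+1)%N => i.
by rewrite (lt_le_trans (truncnS_gt _))// ler_nat (bigD1 i)//= leq_addr.
Qed.

(** Open boxes are stable under intersection and exhaust the space; they generate because a
    coordinate slab is the union of the boxes whose other sides are ]-k, k[. *)
Lemma obox_measure_unique n (m1 m2 : {measure set 'rV[R]_n -> \bar R}) :
  (forall a b, m1 (obox a b) = m2 (obox a b)) -> (forall a b, (m1 (obox a b) < +oo)%E) ->
  forall A, measurable A -> m1 A = m2 A.
Proof.
move=> m12 m1oo.
pose G : set (set 'rV[R]_n) := [set A | exists a b, A = obox a b].
pose g (k : nat) : set 'rV[R]_n := obox (fun=> - k%:R) (fun=> k%:R).
apply: (@measure_unique _ _ _ G g) => //.
- apply/seteqP; split; last first.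
    apply: smallest_sub; first exact: sigma_algebra_measurable.
    by move=> _ [a [b ->]]; exact: measurable_obox.
  apply: smallest_sub; first exact: smallest_sigma_algebra.
  rewrite -bigcup_seq/=; apply: bigcup_sub => i _ _ [B mB <-] /=; rewrite setTI.
  move: B mB; rewrite RGenOpens.measurableE; apply: smallest_sub.
    split; first by rewrite /= preimage_set0; exact: sigma_algebra0.
    - move=> A /= mA; rewrite setTD preimage_setC -setTD; exact: sigma_algebraCD.
    - by move=> F /= mF; rewrite preimage_bigcup; exact: sigma_algebra_bigcup.
  move=> _ [a [b ->]] /=.
  rewrite (_ : _ @^-1` _ = \bigcup_k (obox (fun j => if j == i then a else - k%:R)
     (fun j => if j == i then b else k%:R))).
    apply: sigma_algebra_bigcup => k; apply: sub_sigma_algebra.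
    by eexists; eexists.
  apply/seteqP; split=> x /=; last first.
    by move=> [k _ /(_ i)]; rewrite eqxx in_itv.
  rewrite in_itv/= => xi; have [k xk] := rV_bounded x; exists k => // j.
  by case: eqP => [->//|_]; rewrite -ltr_norml.
- move=> _ _ [a [b ->]] [a' [b' ->]].
  exists (fun i => Num.max (a i) (a' i)), (fun i => Num.min (b i) (b' i)).
  apply/seteqP; split=> [x [/= h h'] i|x h].
    by have := h i; have := h' i; rewrite gt_max lt_min => /andP[-> ->] /andP[-> ->].
  split=> i; have := h i; rewrite gt_max lt_min => /andP[/andP[? ?] /andP[? ?]]; exact/andP.
- by move=> k; exists (fun=> - k%:R), (fun=> k%:R).
- apply/seteqP; split=> // x _; have [k xk] := rV_bounded x; exists k => // j.
  by rewrite -ltr_norml.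
- by move=> _ [a [b ->]]; exact: m12.
- by move=> k; exact: m1oo.
Qed.

Lemma sqn_ge0 n (x : 'rV[R]_n) : 0 <= sqn x.
Proof. by apply: sumr_ge0 => i _; rewrite sqr_ge0. Qed.

Lemma sqn_coord n (x : 'rV[R]_n) i : x 0 i ^+ 2 <= sqn x.
Proof. by rewrite /sqn (bigD1 i)//= lerDl sumr_ge0// => j _; rewrite sqr_ge0. Qed.

Lemma enormE n (x : 'rV[R]_n) : enorm x = Num.sqrt (sqn x).
Proof. by []. Qed.

Lemma sqn_cons n (s : R) (y : 'rV[R]_n) : sqn (rV_cons (s, y)) = sqn y + s ^+ 2.
Proof.
rewrite /sqn big_ord_recl rV_cons0 addrC; congr (_ + _).
by apply: eq_bigr => i _; rewrite rV_consS.
Qed.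

Lemma sqn_cont n : continuous (@sqn R n).
Proof. exact: (class_C_cont (class_C_sqn 0)). Qed.

Lemma measurable_sqn n : measurable_fun setT (@sqn R n).
Proof. exact: continuous_measurable_rV (@sqn_cont n). Qed.

Lemma measurable_enorm n : measurable_fun setT (@enorm R n).
Proof.
rewrite (_ : @enorm R n = fun z => Num.sqrt (sqn z)); last by apply/funext => z; exact: enormE.
exact: (measurableT_comp (continuous_measurable_fun (@sqrt_continuous R)) (@measurable_sqn n)).
Qed.

Lemma coord_le_enorm n (x : 'rV[R]_n) i : `|x 0 i| <= enorm x.
Proof.
rewrite enormE -(ler_pXn2r (n := 2)) ?nnegrE ?sqrtr_ge0// sqr_sqrtr ?sqn_ge0// real_normK ?num_real//.
exact: sqn_coord.
Qed.

Lemma sqn_lt_obox n (d : R) (x : 'rV[R]_n) : 0 <= d -> sqn x < d ^+ 2 -> obox (fun=> - d) (fun=> d) x.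
Proof.
move=> d0 xd i; rewrite -ltr_norml -(@ltr_pXn2r _ 2) ?nnegrE// real_normK ?num_real//.
exact: le_lt_trans (sqn_coord x i) xd.
Qed.

Definition rV_tail n (x : 'rV[R]_n.+1) : 'rV[R]_n := (rV_uncons x).2.

Lemma rV_tail_cons n (s : R) (y : 'rV[R]_n) : rV_tail (rV_cons (s, y)) = y.
Proof. by rewrite /rV_tail rV_consK. Qed.

Lemma measurable_rV_tail n : measurable_fun setT (@rV_tail n).
Proof. exact: (measurableT_comp measurable_snd (@measurable_rV_uncons R n)). Qed.

(** The derivative of |x|^2 in the direction x_0, restricted to the half space x_0 > 0 and to the
    cylinder above [Q]. *)
Definition half_weight n (Q : set 'rV[R]_n) (x : 'rV[R]_n.+1) : R :=
  Num.max 0 (2 * x 0 0) * \1_Q (rV_tail x).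

Lemma half_weight_ge0 n (Q : set 'rV[R]_n) x : 0 <= half_weight Q x.
Proof. by rewrite mulr_ge0// le_max lexx. Qed.

Lemma measurable_half_weight n (Q : set 'rV[R]_n) : measurable Q ->
  measurable_fun setT (half_weight Q).
Proof.
move=> mQ; apply: measurable_funM.
  apply: measurable_maxr; first exact: measurable_cst.
  by apply: measurable_funM => //; exact: measurable_coord.
have m1 : measurable_fun setT (\1_Q : 'rV[R]_n -> R) by exact: measurable_indic.
exact: (measurableT_comp m1 (@measurable_rV_tail n)).
Qed.

(* The weight 2 x_0 makes |x|^2 Lebesgue distributed above any fixed tail [y]. *)
Lemma ge0_integral_half_weight n (Q : set 'rV[R]_n) (c : R) (F : R -> \bar R) :
  measurable Q -> (forall y, Q y -> sqn y <= c) ->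
  measurable_fun setT F -> (forall t, (0 <= F t)%E) -> (forall t, t <= c -> F t = 0%E) ->
  (\int[lebesgue_rV n.+1]_x (F (sqn x) * (half_weight Q x)%:E) =
   lebesgue_rV n Q * \int[leb]_t F t)%E.
Proof.
move=> mQ Qc mF F0 Fc.
have mG : measurable_fun setT (fun x : 'rV[R]_n.+1 => F (sqn x) * (half_weight Q x)%:E)%E.
  apply: emeasurable_funM; first by apply: measurableT_comp => //; exact: measurable_sqn.
  by apply/measurable_EFinP; exact: measurable_half_weight.
rewrite ge0_integral_rV_cons//; last first.
  by move=> x; rewrite mule_ge0// lee_fin half_weight_ge0.
transitivity (\int[lebesgue_rV n]_y ((\int[leb]_t F t) * (\1_Q y)%:E))%E; last first.
  rewrite ge0_integralZl//; first last.
  - exact: integral_ge0.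
  - by apply/measurable_EFinP; exact: measurable_indic.
  by rewrite integral_indic// setIT muleC.
apply: eq_integral => y _.
have [Qy|Qy] := boolP (y \in Q); last first.
  rewrite indicE (negbTE Qy) mule0 integral0_eq// => s _.
  by rewrite /half_weight rV_tail_cons indicE (negbTE Qy) mulr0 mule0.
rewrite indicE Qy mule1.
have -> : (\int[leb]_t F t = \int[leb]_(t in `]sqn y, +oo[) F t)%E.
  rewrite [RHS]integral_mkcond; apply: eq_integral => t _; rewrite patchE.
  case: ifPn => // /negP ty; apply: Fc; rewrite (le_trans _ (Qc y (set_mem Qy)))// leNgt.
  by apply/negP => yt; apply: ty; rewrite inE/= in_itv/= yt.
rewrite ge0_integral_sqr_subst// [RHS]integral_mkcond; apply: eq_integral => s _.
rewrite patchE sqn_cons /half_weight rV_tail_cons indicE Qy mulr1 rV_cons0/=.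
case: ifPn => [|/negP s0]; first by rewrite inE/= in_itv/= andbT => s0; rewrite max_r// mulr_ge0// ltW.
rewrite max_l ?mule0// leNgt pmulr_rgt0//.
by apply/negP => s1; apply: s0; rewrite inE/= in_itv/= s1.
Qed.
End rV_sqn.

(** * Integrals of functions of |x|^2 compared with integrals on the line *)

Section rV_sqn_upper.
Context {R : realType}.
Notation leb := (@lebesgue_measure R).
Implicit Types F : R -> \bar R.

Lemma measurable_preimage_itv d (T : measurableType d) (f : T -> R) (i : interval R) :
  measurable_fun setT f -> measurable [set x | f x \in i].
Proof.
move=> mf; have := mf measurableT [set` i] (measurable_itv i).
by rewrite setTI.
Qed.

Lemma measurable_set_lt d (T : measurableType d) (f : T -> R) (r : R) :
  measurable_fun setT f -> measurable [set x | f x < r].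
Proof.
move=> mf; have := measurable_preimage_itv `]-oo, r[ mf.
by congr measurable; apply/seteqP; split=> x /=; rewrite in_itv.
Qed.

Lemma measurable_set_ge d (T : measurableType d) (f : T -> R) (r : R) :
  measurable_fun setT f -> measurable [set x | r <= f x].
Proof.
move=> mf; have := measurable_preimage_itv `[r, +oo[ mf.
by congr measurable; apply/seteqP; split=> x /=; rewrite in_itv/= andbT.
Qed.

Lemma ge0_integral_shift (c : R) F : measurable_fun setT F -> (forall t, (0 <= F t)%E) ->
  (\int[leb]_t F t = \int[leb]_t F (c + t)%R)%E.
Proof.
move=> mF F0.
have mc : measurable_fun setT (fun t : R => c + t) by exact: measurable_funD.
have m1 : measurable_fun setT (fun _ : R => 1 : R) by exact: measurable_cst.
have [m mE] := @weighted_pushforward_measure _ _ _ (measurableTypeR R) R leb (fun t : R => c + t) _ mc m1 (fun=> ler01).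
have lE A : measurable A -> leb A = weighted_pushforward leb (fun t : R => c + t) (fun=> 1) A.
  move=> mA; rewrite -[RHS](mE A); move: A mA; apply: lebesgue_measure_unique.
  move=> _ [[a b] /= _ <-]; rewrite mE /weighted_pushforward.
  have -> : (fun t : R => c + t) @^-1` `]a, b] = `]a - c, b - c]%classic.
    by apply/seteqP; split=> s /=; rewrite !in_itv/= lerBrDl ltrBlDl.
  rewrite integral_cst//= mul1e !lebesgue_measure_itv/= !lte_fin ltrD2r.
  by case: ifP => // _; rewrite -!EFinB opprB addrA subrK.
rewrite (@ge0_integral_weighted_pushforward _ _ (measurableTypeR R) (measurableTypeR R) R leb
  (fun t : R => c + t) _ mc m1 (fun=> ler01) leb F lE mF F0).
by apply: eq_integral => t _; rewrite mule1.
Qed.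

(** Where |s| >= kappa the Jacobian 2|s| of t = tau + s^2 is at least 2 kappa; each of the two half
    lines contributes 1/(2 kappa). *)
Lemma ge0_integral_sqr_le (tau kappa : R) F : 0 < kappa -> measurable_fun setT F ->
  (forall t, (0 <= F t)%E) ->
  (\int[leb]_s (F (tau + s ^+ 2)%R * (\1_[set s | kappa <= `|s|] s)%:E) <=
   (kappa^-1)%:E * \int[leb]_t F t)%E.
Proof.
move=> k0 mF F0; set f := fun s : R => (F (tau + s ^+ 2)%R * (\1_[set s | kappa <= `|s|] s)%:E)%E.
have f0 s : (0 <= f s)%E by rewrite mule_ge0// lee_fin.
have ms : measurable [set s : R | kappa <= `|s|].
  have mn : measurable_fun setT (fun s : R => `|s|) by exact: measurableT_comp.
  exact: (measurable_set_ge kappa mn).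
have mFs : measurable_fun setT (fun s : R => F (tau + s ^+ 2)%R).
  by apply: measurableT_comp => //; exact: measurable_funD.
have mf : measurable_fun setT f.
  by apply: emeasurable_funM => //; apply/measurable_EFinP; exact: measurable_indic.
have fN s : f (- s)%R = f s.
  rewrite /f sqrrN !indicE; congr (_ * (nat_of_bool _)%:R%:E)%E.
  by apply/idP/idP; rewrite !inE/= normrN.
have f00 : f 0%R = 0%E.
  by rewrite /f indicE memNset ?mule0//= normr0 leNgt k0.
have posint : (\int[leb]_(s in `]0%R, +oo[) f s <= ((2 * kappa)^-1)%:E * \int[leb]_t F t)%E.
  apply: (@le_trans _ _ ((2 * kappa)^-1%:E * \int[leb]_(t in `]tau, +oo[) F t)%E); last first.
    rewrite lee_wpmul2l ?lee_fin ?invr_ge0 ?mulr_ge0 ?(ltW k0)//.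
    by apply: ge0_subset_integral => //; exact: measurable_itv.
  rewrite (@ge0_integral_sqr_subst R tau F)// -ge0_integralZl//; first last.
  - by rewrite lee_fin invr_ge0 mulr_ge0// ltW.
  - by move=> s; rewrite /= in_itv/= andbT => s0; rewrite mule_ge0// lee_fin mulr_ge0// ltW.
  - apply: measurable_funTS; apply: emeasurable_funM => //.
    by apply/measurable_EFinP; exact: measurable_funM.
  have m2 : measurable_fun setT (fun s : R => (2 * kappa)^-1%:E * (F (tau + s ^+ 2)%R * (2 * s)%:E))%E.
    apply: emeasurable_funM; first exact: measurable_cst.
    apply: emeasurable_funM => //.
    by apply/measurable_EFinP; exact: measurable_funM.
  apply: ge0_le_integral => //.
  - exact: measurable_funTS.
  - exact: measurable_funTS.
  - move=> s; rewrite /= in_itv/= andbT => s0; rewrite muleCA lee_wpmul2l// -EFinM lee_fin.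
    rewrite mulrC -ler_pdivrMr ?invr_gt0 ?mulr_gt0// invrK indicE.
    have [|] := boolP (s \in _).
      by rewrite inE/= gtr0_norm// mul1r => ks; rewrite ler_pM2l.
    by rewrite mul0r mulr_ge0// ltW.
have zero_oo : (\int[leb]_(s in `[0%R, +oo[) f s = \int[leb]_(s in `]0%R, +oo[) f s)%E.
  rewrite integral_mkcond [RHS]integral_mkcond; apply: eq_integral => s _; rewrite !patchE.
  have [->|s0] := eqVneq s 0; first by rewrite f00 !if_same.
  rewrite (_ : (s \in `[0, +oo[%classic) = (s \in `]0, +oo[%classic))//.
  by apply/idP/idP; rewrite !inE/= !in_itv/= !andbT lt_neqAle eq_sym s0.
have negint : (\int[leb]_(s in `]-oo, 0%R]) f s = \int[leb]_(s in `]0%R, +oo[) f s)%E.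
  by rewrite -zero_oo ge0_integration_by_substitution0//; apply: eq_integral => s _; rewrite fN.
have -> : (\int[leb]_s f s = \int[leb]_(s in `]-oo, 0%R]) f s + \int[leb]_(s in `]0%R, +oo[) f s)%E.
  rewrite -ge0_integral_setU//=; first last.
  - apply/disj_set2P/seteqP; split=> // s [] /=; rewrite !in_itv/= andbT => s0 s1.
    by have := le_lt_trans s0 s1; rewrite ltxx.
  - exact: measurable_funTS.
  congr (integral _ _ _); apply/seteqP; split=> // s _ /=.
  by rewrite !in_itv/= andbT; case: leP; [left|right].
rewrite negint (le_trans (leeD posint posint))//.
rewrite -ge0_muleDl ?lee_fin ?invr_ge0 ?mulr_ge0 ?(ltW k0)//.
rewrite -EFinD lee_wpmul2r ?integral_ge0// lee_fin.
by rewrite (_ : _ + _ = kappa^-1)//; field; rewrite lt0r_neq0.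
Qed.

Lemma lebesgue_sqn_lt n (d : R) :
  (lebesgue_rV n [set y : 'rV[R]_n | (sqn y < d)%R] < +oo)%E.
Proof.
have [d0|d0] := leP d 0.
  rewrite (_ : [set y : 'rV[R]_n | sqn y < d] = set0) ?measure0//.
  by apply/seteqP; split=> // y /= yd; have := lt_le_trans yd d0; rewrite ltNge sqn_ge0.
apply: (@le_lt_trans _ _ (lebesgue_rV n (@obox R n (fun=> - (1 + d)) (fun=> 1 + d)))).
  apply: le_measure; rewrite ?inE.
  - exact: (measurable_set_lt _ (@measurable_sqn R n)).
  - exact: measurable_obox.
  - move=> y /= yd; apply: sqn_lt_obox; first by rewrite addr_ge0// ltW.
    by rewrite (lt_trans yd)//; nra.
by rewrite lebesgue_obox ?ltry// => _; lra.
Qed.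

(** A substitute for polar coordinates: away from the origin the law of |x|^2 has bounded density on
    bounded sets. Induction on the dimension, since at every such point either x_0 or the remaining
    vector is bounded below. *)
Lemma integral_sqn_le n (c d : R) : 0 < c -> exists2 C : R, 0 <= C &
  forall F, measurable_fun setT F -> (forall t, (0 <= F t)%E) ->
  (forall t, ~~ (c < t < d) -> F t = 0%E) ->
  (\int[lebesgue_rV n]_x F (sqn x) <= C%:E * \int[leb]_t F t)%E.
Proof.
elim: n c => [|n ih] c c0.
  exists 0 => // F mF F0 Fcd; rewrite mul0e integral0_eq// => x _.
  by apply: Fcd; rewrite /sqn big_ord0 ltNge ltW.
(* The tail will satisfy |y|^2 >= c/2, while the induction hypothesis wants a function vanishing
   outside an open interval; any left end below c/2 works. *)
have [|C C0 IH] := ih (c / 4); first by rewrite divr_gt0.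
set kappa := Num.sqrt (c / 2).
have k0 : 0 < kappa by rewrite sqrtr_gt0 divr_gt0.
have k2 : kappa ^+ 2 = c / 2 by rewrite sqr_sqrtr// divr_ge0// ltW.
pose D := [set y : 'rV[R]_n | sqn y < d].
have mD : measurable D by exact: (measurable_set_lt _ (@measurable_sqn R n)).
have Dfin : lebesgue_rV n D \is a fin_num by rewrite ge0_fin_numE// lebesgue_sqn_lt.
pose S := [set s : R | s ^+ 2 < d].
have mS : measurable S.
  have ms : measurable_fun setT (fun s : R => s ^+ 2) by [].
  exact: (measurable_set_lt d ms).
have Sfin : leb S \is a fin_num.
  rewrite ge0_fin_numE//.
  apply: (@le_lt_trans _ _ (leb `[- (1 + `|d|), 1 + `|d|]%classic)).
    apply: le_measure; rewrite ?inE => // s /= sd; rewrite in_itv/= -ler_norml.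
    rewrite leNgt; apply/negP => ds.
    have : (1 + `|d|) ^+ 2 < d.
      apply: le_lt_trans sd; rewrite -[leRHS]real_normK ?num_real//.
      by rewrite ler_pXn2r ?nnegrE ?addr_ge0// ltW.
    by have := ler_norm d; have := normr_ge0 d; nra.
  by rewrite lebesgue_measure_itv/=; case: ifP => _; rewrite -?EFinB ltry.
exists (kappa^-1 * fine (lebesgue_rV n D) + C * fine (leb S)).
  by rewrite addr_ge0// mulr_ge0 ?invr_ge0 ?fine_ge0// ltW.
move=> F mF F0 Fcd.
have mFq m : measurable_fun setT (fun x : 'rV[R]_m => F (sqn x)).
  by apply: measurableT_comp => //; exact: measurable_sqn.
(* As kappa^2 = c/2, every x with c < |x|^2 < d lies in [SA] or in [SB]. On [SA] the substitution is
   made along x_0, with y confined to [D]; on [SB] the induction hypothesis is applied in y, with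
   x_0 confined to [S]. Both [D] and [S] have finite measure. *)
pose SA := [set x : 'rV[R]_n.+1 | kappa <= `|x 0 0|] `&` (@rV_tail R n @^-1` D).
pose SB := [set x : 'rV[R]_n.+1 | c / 2 <= sqn (rV_tail x)] `&` [set x | x 0 0 ^+ 2 < d].
have mc : measurable_fun setT (fun x : 'rV[R]_n.+1 => x 0 0) by exact: measurable_coord.
have mSA : measurable SA.
  apply: measurableI.
    have mn : measurable_fun setT (fun x : 'rV[R]_n.+1 => `|x 0 0|) by exact: measurableT_comp.
    exact: (measurable_set_ge kappa mn).
  by rewrite -[X in measurable X]setTI; exact: measurable_rV_tail.
have mSB : measurable SB.
  apply: measurableI.
    have mn : measurable_fun setT (fun x : 'rV[R]_n.+1 => sqn (rV_tail x)).
      by apply: measurableT_comp; [exact: measurable_sqn|exact: measurable_rV_tail].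
    exact: (measurable_set_ge (c / 2) mn).
  have mn : measurable_fun setT (fun x : 'rV[R]_n.+1 => x 0 0 ^+ 2) by exact: measurable_funX.
  exact: (measurable_set_lt d mn).
have mI (A : set 'rV[R]_n.+1) : measurable A -> measurable_fun setT (fun x => F (sqn x) * (\1_A x)%:E)%E.
  by move=> mA; apply: emeasurable_funM; [exact: mFq|]; apply/measurable_EFinP; exact: measurable_indic.
have I0 (A : set 'rV[R]_n.+1) x : (0 <= F (sqn x) * (\1_A x)%:E)%E by rewrite mule_ge0// lee_fin.
apply: (@le_trans _ _ (\int[lebesgue_rV n.+1]_x (F (sqn x) * (\1_SA x)%:E + F (sqn x) * (\1_SB x)%:E))%E).
  apply: ge0_le_integral => //.
  - exact: mFq.
  - by apply: emeasurable_funD; exact: mI.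
  - move=> x _.
    have [xcd|xcd] := boolP (c < sqn x < d); last by rewrite Fcd// !mul0e adde0.
    have xE : sqn x = sqn (rV_tail x) + x 0 0 ^+ 2.
      rewrite /sqn big_ord_recl addrC; congr (_ + _); apply: eq_bigr => i _.
      by rewrite /rV_tail mxE.
    have t0 := sqn_ge0 (rV_tail x); have s0 := sqr_ge0 (x 0 0).
    have /andP[cx xd] := xcd.
    have [kx|kx] := leP kappa `|x 0 0|.
      rewrite [X in (_ <= _ * X + _)%E](_ : _ = 1%E); last first.
        by rewrite indicE mem_set//; split=> //=; rewrite /D/=; lra.
      by rewrite mule1 leeDl.
    rewrite [X in (_ <= _ + _ * X)%E](_ : _ = 1%E); last first.
      rewrite indicE mem_set//; split=> /=; last lra.
      have : x 0 0 ^+ 2 < c / 2.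
        by rewrite -k2 -real_normK ?num_real// ltr_pXn2r ?nnegrE// ltW.
      lra.
    by rewrite mule1 leeDr.
rewrite ge0_integralD//; [|exact: mI|exact: mI].
rewrite EFinD ge0_muleDl ?lee_fin ?mulr_ge0 ?invr_ge0 ?fine_ge0// ?(ltW k0)//.
apply: leeD.
- rewrite ge0_integral_rV_cons//; last exact: mI.
  rewrite EFinM fineK// -muleA (muleC (lebesgue_rV n D)) muleA.
  apply: (@le_trans _ _ (\int[lebesgue_rV n]_y (((kappa^-1)%:E * \int[leb]_t F t) * (\1_D y)%:E))%E).
    apply: integral_le_ae.
    + by apply: emeasurable_funM => //; apply/measurable_EFinP; exact: measurable_indic.
    + by move=> y; rewrite !mule_ge0// ?lee_fin ?invr_ge0 ?integral_ge0// ltW.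
    + apply: aeW => y; rewrite [X in (_ <= _ * X%:E)%E]indicE.
      have [yD|yD] := boolP (y \in D).
        rewrite mule1; apply: le_trans (ge0_integral_sqr_le (sqn y) k0 mF F0).
        rewrite le_eqVlt; apply/orP; left; apply/eqP/eq_integral => s _.
        rewrite sqn_cons; congr (_ * _%:E)%E; rewrite !indicE; congr (nat_of_bool _)%:R.
        apply/idP/idP; rewrite !inE/= /SA /= rV_cons0 rV_tail_cons; first by case.
        by move=> ks; split=> //; rewrite -inE.
      rewrite mule0 integral0_eq// => s _; rewrite [X in (_ * X%:E)%E]indicE memNset ?mule0//.
      by rewrite /SA /= rV_tail_cons => -[_ /mem_set]; exact/negP.
  rewrite ge0_integralZl//; first last.
  + by rewrite mule_ge0// ?lee_fin ?invr_ge0 ?integral_ge0// ltW.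
  + by apply/measurable_EFinP; exact: measurable_indic.
  by rewrite integral_indic// setIT.
- rewrite ge0_integral_rV_cons1//; last exact: mI.
  rewrite EFinM fineK// -muleA (muleC (leb S)) muleA.
  apply: (@le_trans _ _ (\int[leb]_s ((C%:E * \int[leb]_t F t) * (\1_S s)%:E))%E).
    apply: integral_le_ae.
    + by apply: emeasurable_funM => //; apply/measurable_EFinP; exact: measurable_indic.
    + by move=> y; rewrite !mule_ge0// ?lee_fin ?integral_ge0.
    + apply: aeW => s; rewrite [X in (_ <= _ * X%:E)%E]indicE.
      have [sS|sS] := boolP (s \in S); last first.
        rewrite mule0 integral0_eq// => y _; rewrite [X in (_ * X%:E)%E]indicE memNset ?mule0//.
        by rewrite /SB /= rV_cons0 => -[_ /mem_set]; exact/negP.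
      rewrite mule1.
      pose Fs (t : R) : \bar R := (F (s ^+ 2 + t)%R * (\1_[set t | c / 2 <= t] t)%:E)%E.
      have mFs0 : measurable_fun setT (fun t : R => F (s ^+ 2 + t)%R).
        by apply: measurableT_comp => //; exact: measurable_funD.
      have mFs : measurable_fun setT Fs.
        apply: emeasurable_funM => //; apply/measurable_EFinP; apply: measurable_indic.
        exact: (measurable_set_ge (c / 2) (@measurable_id _ _ setT)).
      have Fs0 t : (0 <= Fs t)%E by rewrite /Fs mule_ge0// lee_fin.
      apply: (@le_trans _ _ (C%:E * \int[leb]_t Fs t)%E); last first.
        rewrite lee_wpmul2l ?lee_fin// (ge0_integral_shift (s ^+ 2) mF F0).
        apply: ge0_le_integral => // t _.
        by rewrite /Fs -[leRHS]mule1 lee_wpmul2l// lee_fin indicE; case: (_ \in _).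
      have Fscd t : ~~ (c / 4 < t < d) -> Fs t = 0%E.
        move=> tcd; rewrite /Fs; have [ct|ct] := leP (c / 2) t; last first.
          by rewrite indicE memNset ?mule0//= leNgt ct.
        rewrite Fcd ?mul0e//; move: tcd; rewrite !negb_and -!leNgt => /orP[|] h; last first.
          by apply/orP; right; rewrite (le_trans h)// lerDr sqr_ge0.
        by exfalso; lra.
      apply: le_trans (IH Fs mFs Fs0 Fscd).
      rewrite le_eqVlt; apply/orP; left; apply/eqP/eq_integral => y _.
      rewrite sqn_cons addrC /Fs; congr (_ * _%:E)%E; rewrite !indicE; congr (nat_of_bool _)%:R.
      apply/idP/idP; rewrite !inE/= /SB /= rV_cons0 rV_tail_cons; first by case.
      by move=> ks; split=> //; rewrite inE in sS.
  rewrite ge0_integralZl//; first last.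
  + by rewrite mule_ge0// ?lee_fin ?integral_ge0.
  + by apply/measurable_EFinP; exact: measurable_indic.
  by rewrite integral_indic// setIT.
Qed.
End rV_sqn_upper.

(** * Null sets under |x|^2 and Borel profiles of radial functions *)

Section radial_repr.
Context {R : realType}.
Notation leb := (@lebesgue_measure R).

Lemma integral_indicT d (T : measurableType d) (mu : {measure set T -> \bar R}) (A : set T) :
  measurable A -> (\int[mu]_x (\1_A x)%:E = mu A)%E.
Proof. by move=> mA; rewrite integral_indic// setIT. Qed.

Lemma lebesgue_obox_gt0 n (a b : 'I_n -> R) : (forall i, a i < b i) ->
  (0 < lebesgue_rV n (obox a b))%E.
Proof.
move=> ab; rewrite lebesgue_obox; last by move=> i; exact: ltW.
by rewrite lte_fin prodr_gt0// => i _; rewrite subr_gt0.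
Qed.

Lemma ae_imply d (T : measurableType d) (mu : {measure set T -> \bar R}) (P Q : T -> Prop) :
  {ae mu, forall x, P x} -> (forall x, P x -> Q x) -> {ae mu, forall x, Q x}.
Proof.
by move=> [Z [mZ Z0 PZ]] PQ; exists Z; split=> // x /= nQ; apply: PZ => Px; exact/nQ/PQ.
Qed.

Lemma ae_witness d (T : measurableType d) (mu : {measure set T -> \bar R}) (A : set T) (P : T -> Prop) :
  measurable A -> (0 < mu A)%E -> {ae mu, forall x, P x} -> exists2 x, A x & P x.
Proof.
move=> mA A0 [Z [mZ Z0 PZ]]; apply: contrapT => H.
have AZ : A `<=` Z by move=> x Ax; apply: PZ => Px; apply: H; exists x.
have : (mu A <= mu Z)%E by apply: le_measure; rewrite ?inE.
by rewrite [X in (_ <= X)%E]Z0 leNgt A0.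
Qed.

(** The inverse image under |x|^2 of a null set of ]0, +oo[ is null: [integral_sqn_le] applies on
    each interval ]1/(k+1), k+1[, and these exhaust the half line. *)
Lemma ae_sqn n (P : R -> Prop) : {ae leb, forall t, P t} ->
  {ae lebesgue_rV n, forall x : 'rV[R]_n, 0 < sqn x -> P (sqn x)}.
Proof.
move=> [Z [mZ Z0 PZ]].
pose I (k : nat) : set R := `]k.+1%:R^-1, k.+1%:R[%classic.
have mI k : measurable (I k `&` Z) by apply: measurableI => //; exact: measurable_itv.
have mk k : measurable (@sqn R n @^-1` (I k `&` Z)).
  by rewrite -[X in measurable X]setTI; exact: measurable_sqn.
have : (lebesgue_rV n).-negligible (\bigcup_k (@sqn R n @^-1` (I k `&` Z))).
  apply: negligible_bigcup => k; exists (@sqn R n @^-1` (I k `&` Z)); split=> //.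
  have [|C C0 H] := @integral_sqn_le R n k.+1%:R^-1 k.+1%:R; first by rewrite invr_gt0.
  have E : (\int[leb]_t (\1_(I k `&` Z) t : R)%:E = 0)%E.
    rewrite integral_indic//; last exact: mI.
    apply: (@subset_measure0 _ _ _ leb _ Z) => //; last by move=> t [[]].
    by apply: measurableI => //; exact: mI.
  have := H (fun t => (\1_(I k `&` Z) t : R)%:E).
  rewrite E mule0 => {}H; apply/eqP; rewrite -measure_le0.
  apply: (@le_trans _ _ (\int[lebesgue_rV n]_x (\1_(@sqn R n @^-1` (I k `&` Z)) x : R)%:E)%E).
    by rewrite (integral_indicT _ (mk k)).
  apply: H.
  - by apply/measurable_EFinP; exact: measurable_indic.
  - by move=> t; rewrite lee_fin.
  - move=> t tk; rewrite indicE memNset// => -[]; rewrite /I/= in_itv/= => tk'.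
    by rewrite tk' in tk.
apply: negligibleS.
move=> x /not_implyP[x0 Px].
have [k kx] : exists k : nat, Num.max (sqn x) (sqn x)^-1 < k.+1%:R.
  by exists (Num.truncn (Num.max (sqn x) (sqn x)^-1)); rewrite truncnS_gt.
exists k => //; split; last exact: PZ.
move: kx; rewrite gt_max => /andP[k1 k2].
by rewrite /I /= in_itv/= k1 andbT invf_plt// posrE.
Qed.

(** After the substitution t = c + s^2 the measure of the exceptional set is the integral over a
    null set in s. *)
Lemma ae_sqrt_shift (c : R) (P : R -> Prop) : {ae leb, forall s, P s} ->
  {ae leb, forall t : R, c < t -> P (Num.sqrt (t - c))}.
Proof.
move=> [Z [mZ Z0 PZ]].
pose f (t : R) := Num.sqrt (t - c).
have mf : measurable_fun setT f.
  apply: (measurableT_comp (f := @Num.sqrt R)).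
    by apply: continuous_measurable_fun; exact: sqrt_continuous.
  exact: measurable_funB.
have mfZ : measurable (f @^-1` Z) by rewrite -[X in measurable X]setTI; exact: mf.
have mc : measurable `]c, +oo[%classic by exact: measurable_itv.
exists (f @^-1` Z `&` `]c, +oo[%classic); split; first exact: measurableI.
  have m1 : measurable_fun setT (fun t : R => (\1_(f @^-1` Z) t : R)%:E).
    by apply/measurable_EFinP; exact: measurable_indic.
  rewrite -integral_indic// (@ge0_integral_sqr_subst R c (fun t : R => (\1_(f @^-1` Z) t : R)%:E))//.
  have mg : measurable_fun `](0 : R), +oo[%classic
      (fun s : R => (\1_(f @^-1` Z) (c + s ^+ 2) : R)%:E * (2 * s)%:E)%E.
    apply: measurable_funTS; apply: emeasurable_funM.
      by apply: (measurableT_comp m1); exact: measurable_funD.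
    by apply/measurable_EFinP; exact: measurable_funM.
  rewrite (@ae_eq_integral _ _ _ leb `](0 : R), +oo[%classic (cst 0%E))//; first by rewrite integral0.
  exists Z; split=> // s /not_implyP[]; rewrite /= in_itv/= andbT => s0 H.
  apply: contrapT => Zs; apply: H; rewrite indicE memNset ?mul0e//=.
  by rewrite /f (addrC c) addrK sqrtr_sqr gtr0_norm.
move=> t /not_implyP[ct Pt]; split; last by rewrite /= in_itv/= ct.
exact: PZ.
Qed.

Lemma ae_enorm n (P : R -> Prop) : {ae leb, forall r, P r} ->
  {ae lebesgue_rV n, forall x : 'rV[R]_n, 0 < enorm x -> P (enorm x)}.
Proof.
move=> /(@ae_sqrt_shift 0) /(@ae_sqn n) /ae_imply; apply => x H.
by rewrite enormE sqrtr_gt0 => x0; have := H x0 x0; rewrite subr0.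
Qed.

(* A generic ray parallel to the first axis provides a Borel profile, even
   though the profile in the definition of [radial] is arbitrary. *)
Lemma radial_profile n (u : 'rV[R]_n.+1 -> R) (T1 : R) : 0 < T1 ->
  measurable_fun setT u -> radial u ->
  exists2 F : R -> R, measurable_fun setT F &
    {ae lebesgue_rV n.+1, forall x, T1 < sqn x -> u x = F (sqn x)}.
Proof.
move=> T10 mu [f [Z [mZ Z0 ufZ]]].
(* With e <= 1 one has e^2 <= e, so the n squares of coordinates sum to at most n e < (n+1) e <= T1;
   the whole shell |x|^2 > T1 is then visible from the ray above [y0]. *)
pose e := Num.min 1 (T1 / (n.+1)%:R).
have e0 : 0 < e by rewrite lt_min ltr01 divr_gt0.
have e1 : e <= 1 by rewrite ge_min lexx.
have [y0 y0e y0Z] : exists2 y : 'rV[R]_n, obox (fun=> - e) (fun=> e) y &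
    leb [set s | Z (rV_cons (s, y))] = 0%E.
  apply: (@ae_witness _ _ (lebesgue_rV n)).
  - exact: measurable_obox.
  - by apply: lebesgue_obox_gt0 => i; lra.
  - exact: negligible_rV_slices.
have y0T : sqn y0 < T1.
  apply: (@le_lt_trans _ _ (\sum_(i < n) e)).
    apply: ler_sum => i _; have := y0e i; rewrite -ltr_norml => yi.
    rewrite -real_normK ?num_real//; apply: (@le_trans _ _ (e ^+ 2)).
      by rewrite lerXn2r ?nnegrE// ltW.
    by rewrite expr2 -[leRHS]mul1r ler_pM2r.
  rewrite sumr_const card_ord -mulr_natr.
  apply: (@lt_le_trans _ _ (e * n.+1%:R)); first by rewrite ltr_pM2l// ltr_nat.
  by rewrite -ler_pdivlMr// ge_min lexx orbT.
pose F (t : R) := u (rV_cons (Num.sqrt (t - sqn y0), y0)).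
exists F.
  have mS := measurable_rV_slice y0 mu.
  apply: (measurableT_comp mS).
  apply: (measurableT_comp (f := @Num.sqrt R)).
    by apply: continuous_measurable_fun; exact: sqrt_continuous.
  exact: measurable_funB.
have aeF : {ae leb, forall t, sqn y0 < t -> F t = f (Num.sqrt t)}.
  have aeZ : {ae leb, forall s, ~ Z (rV_cons (s, y0))}.
    exists [set s | Z (rV_cons (s, y0))]; split => //.
      exact: measurable_rV_slice_set.
    by move=> s /= /contrapT.
  apply: (ae_imply (@ae_sqrt_shift (sqn y0) _ aeZ)) => t H yt.
  have {}H := H yt; rewrite /F; have -> : u (rV_cons (Num.sqrt (t - sqn y0), y0)) =
      f (enorm (rV_cons (Num.sqrt (t - sqn y0), y0))).
    by apply: contrapT => H1; exact/H/ufZ.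
  by rewrite enormE sqn_cons sqr_sqrtr ?subr_ge0 ?ltW// addrC subrK.
have aeu : {ae lebesgue_rV n.+1, forall x, u x = f (enorm x)} by exists Z.
have := @ae_sqn n.+1 _ aeF; apply: filterS2 aeu => x ux H Tx.
by rewrite ux H// ?(lt_trans T10)// (lt_trans y0T).
Qed.
End radial_repr.

(** * Weak gradients *)

Section compact_support.
Context {R : realType}.
Notation leb := (@lebesgue_measure R).

Definition csupp n (M : R) (f : 'rV[R]_n -> R) :=
  forall x, f x != 0 -> forall i, `|x 0 i| <= M.

Lemma csuppP n M (f : 'rV[R]_n -> R) (x : 'rV[R]_n) i : csupp M f -> M < `|x 0 i| -> f x = 0.
Proof. by move=> fM xi; apply/eqP; apply: contraTT xi => /fM/(_ i); rewrite leNgt. Qed.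

Definition cbox n (M : R) : set 'rV[R]_n := [set x | forall i, `[- M, M]%classic (x 0 i)].

Arguments cbox : clear implicits.

Lemma compact_cbox n M : compact (cbox n M).
Proof. by apply: (@rV_compact _ _ (fun=> `[- M, M]%classic)) => _; exact: segment_compact. Qed.

Lemma measurable_cbox n M : measurable (cbox n M).
Proof. by apply: (@measurable_rV_forall _ n (fun=> `[- M, M]%classic)) => i; exact: measurable_itv. Qed.

Lemma cboxP n M (x : 'rV[R]_n) : cbox n M x <-> forall i, `|x 0 i| <= M.
Proof. by split=> + i => /(_ i); rewrite /= in_itv/= -ler_norml. Qed.

Lemma cbox_fin n M : (lebesgue_rV n (cbox n M) < +oo)%E.
Proof.
apply: (@le_lt_trans _ _ (lebesgue_rV n (@obox R n (fun=> - (`|M| + 1)) (fun=> `|M| + 1)))).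
  apply: le_measure; rewrite ?inE; [exact: measurable_cbox|exact: measurable_obox|].
  move=> x /cboxP xM i; rewrite -ltr_norml (le_lt_trans (xM i))//.
  by rewrite (le_lt_trans (ler_norm M))// ltrDl.
rewrite lebesgue_obox ?ltry// => _; have := normr_ge0 M; lra.
Qed.

Lemma continuous_csupp_bounded n M (f : 'rV[R]_n -> R) : continuous f -> csupp M f ->
  exists2 C : R, 0 <= C & forall x, `|f x| <= C * \1_(cbox n M) x.
Proof.
move=> cf fM.
have : compact (f @` cbox n M).
  by apply: continuous_compact; [exact: continuous_subspaceT|exact: compact_cbox].
move=> /compact_bounded [C [_ HC]].
exists (`|C| + 1); first by rewrite addr_ge0.
move=> x; have [xM|xM] := boolP (x \in cbox n M).
  rewrite indicE xM mulr1; apply: HC; last by exists x => //; rewrite inE in xM.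
  by rewrite (le_lt_trans (ler_norm C))// ltrDl.
rewrite indicE (negbTE xM) mulr0; have -> : f x = 0; last by rewrite normr0.
apply/eqP; apply: contraNT xM => fx; rewrite inE; apply/cboxP; exact: fM.
Qed.

Lemma integrable_indic_cbox n M (C : R) : 
  (lebesgue_rV n).-integrable setT (fun x : 'rV[R]_n => (C * \1_(cbox n M) x)%:E).
Proof.
apply/integrableP; split.
  apply/measurable_EFinP; apply: measurable_funM => //; apply: measurable_indic.
  exact: measurable_cbox.
have -> : (fun x : 'rV[R]_n => `|(C * \1_(cbox n M) x)%:E|)%E =
    (fun x => `|C|%:E * (\1_(cbox n M) x : R)%:E)%E.
  by apply/funext => x; rewrite /= normrM EFinM (ger0_norm (_ : 0 <= \1_(cbox n M) x)).
rewrite ge0_integralZl//; last first.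
  by apply/measurable_EFinP; apply: measurable_indic; exact: measurable_cbox.
rewrite (integral_indicT _ (@measurable_cbox n M)) lte_mul_pinfty//.
exact: cbox_fin.
Qed.

Lemma continuous_csupp_integrable n M (f : 'rV[R]_n -> R) : continuous f -> csupp M f ->
  (lebesgue_rV n).-integrable setT (EFin \o f).
Proof.
move=> cf fM; have [C C0 HC] := continuous_csupp_bounded cf fM.
apply: le_integrable (@integrable_indic_cbox n M C) => //.
  by apply/measurable_EFinP; exact: continuous_measurable_rV.
by move=> x _; rewrite /= lee_fin (le_trans (HC x))// ler_norm.
Qed.

Lemma rV_cons_cont n (s : R) : continuous (fun y : 'rV[R]_n => rV_cons (s, y) : 'rV[R]_n.+1).
Proof.
move=> y A /nbhs_ballP[e /= e0 eA]; apply/nbhs_ballP; exists e => // z [_ yz].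
apply: eA; split=> // i k; rewrite !ord1.
by case: (unliftP 0 k) => [j ->|->]; rewrite ?rV_consS ?rV_cons0; [exact: yz|exact: ballxx].
Qed.

Lemma rV_cons_cont1 n (y : 'rV[R]_n) : continuous (fun s : R => rV_cons (s, y) : 'rV[R]_n.+1).
Proof.
move=> s A /nbhs_ballP[e /= e0 eA]; apply/nbhs_ballP; exists e => // z sz.
apply: eA; split=> // i k; rewrite !ord1.
by case: (unliftP 0 k) => [j ->|->]; rewrite ?rV_consS ?rV_cons0//; exact: ballxx.
Qed.

Lemma rV_consD n (h a s : R) (y v : 'rV[R]_n) :
  rV_cons (h * a + s, h *: v + y) = h *: rV_cons (a, v) + rV_cons (s, y).
Proof.
apply/rowP => k; rewrite [RHS]mxE [X in _ = X + _]mxE; case: (unliftP 0 k) => [j ->|->].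
  rewrite [LHS](rV_consS (h * a + s, h *: v + y) j) [X in _ = _ + X](rV_consS (s, y) j).
  by rewrite [X in _ = _ * X + _](rV_consS (a, v) j) !mxE.
rewrite [LHS](rV_cons0 (h * a + s, h *: v + y)) [X in _ = _ + X](rV_cons0 (s, y)).
by rewrite [X in _ = _ * X + _](rV_cons0 (a, v)).
Qed.

Lemma csupp_partial n M (f : 'rV[R]_n -> R) i : csupp M f -> csupp M (partial i f).
Proof.
move=> fM x + j; apply: contraNT; rewrite -ltNge => xj; apply/eqP.
rewrite /partial.
have O : \near x, f x = (fun=> 0) x.
  have : open ((fun y : 'rV[R]_n => `|y 0 j|) @^-1` `]M, +oo[%classic).
    apply: open_comp; last exact: interval_open.
    move=> y _; apply: continuous_comp; [exact: coord_continuous|exact: norm_continuous].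
  move=> oU; have /(open_nbhs_nbhs) : open_nbhs x ((fun y : 'rV[R]_n => `|y 0 j|) @^-1` `]M, +oo[%classic).
    by split=> //=; rewrite in_itv/= xj.
  by apply: filterS => y /=; rewrite in_itv/= andbT => yj; exact: csuppP fM yj.
by rewrite (near_eq_derive _ O) derive_cst.
Qed.

(** Stated with positive and negative parts, a form that can be integrated over the other variables
    by Tonelli's theorem. *)
Lemma integral_derive0 (g h : R -> R) (M : R) : continuous h -> (forall s : R, is_derive s 1 g (h s)) ->
  (forall s, M < `|s| -> g s = 0) -> (forall s, M < `|s| -> h s = 0) ->
  (\int[leb]_s (Num.max (h s) 0)%:E = \int[leb]_s (Num.max (- h s) 0)%:E)%E.
Proof.
move=> ch gh gM hM; pose L := `|M| + 1.
have ML : M < L by rewrite (le_lt_trans (ler_norm M))// ltrDl.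
have L0 : 0 < L by rewrite ltr_wpDl.
have hL s : ~~ (- L <= s <= L) -> h s = 0.
  by rewrite -ler_norml -ltNge => Ls; apply: hM; exact: lt_trans Ls.
have ih := continuous_supp_integrable ch hL.
have I0 : (\int[leb]_s (h s)%:E = 0)%E.
  have -> : (\int[leb]_s (h s)%:E = \int[leb]_(s in `[(- L)%R, L%R]) (h s)%:E)%E.
    rewrite [RHS]integral_mkcond; apply: eq_integral => s _; rewrite patchE.
    case: ifPn => // sL; rewrite hL//; apply: contra sL => sL.
    by rewrite inE/= in_itv.
  rewrite (@continuous_FTC2 _ h g)//.
  - by rewrite !gM ?subee// ?normrN gtr0_norm.
  - by rewrite gtrN.
  - exact: continuous_subspaceT.
  - have cg : continuous g.
      by move=> s; apply: differentiable_continuous; apply/derivable1_diffP; have [] := gh s.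
    split; first by move=> s _; have [] := gh s.
    + by apply: cvg_at_right_filter; exact: cg.
    + by apply: cvg_at_left_filter; exact: cg.
  - by move=> s _; rewrite derive1E; have [_ ->] := gh s.
move: I0; rewrite integralE.
have Ep : (fun s => (EFin \o h)^\+ s)%E = (fun s => (Num.max (h s) 0)%:E).
  by apply/funext => s; rewrite funeposE/= EFin_max.
have En : (fun s => (EFin \o h)^\- s)%E = (fun s => (Num.max (- h s) 0)%:E).
  by apply/funext => s; rewrite funenegE/= EFin_max EFinN.
have p1 := integrable_pos_fin_num measurableT ih.
have n1 := integrable_neg_fin_num measurableT ih.
move: p1 n1; rewrite Ep En => p1 n1 /eqP; by rewrite sube_eq// ?add0e => /eqP.
Qed.

(** Coordinates are peeled off by Tonelli until the differentiated one is first; then the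
    fundamental theorem of calculus applies on each line in that direction. *)
Lemma integral_partial0 n i (F : 'rV[R]_n -> R) M : continuous F ->
  continuous (partial i F) -> (forall x, derivable F x (delta_mx 0 i)) -> csupp M F ->
  (\int[lebesgue_rV n]_x (Num.max (partial i F x) 0)%:E =
   \int[lebesgue_rV n]_x (Num.max (- partial i F x) 0)%:E)%E.
Proof.
elim: n i F => [[]//|n ih] i F cF cpF dF FM.
have mpF : measurable_fun setT (partial i F) by exact: continuous_measurable_rV.
have mp : measurable_fun setT (fun x => (Num.max (partial i F x) 0)%:E).
  by apply/measurable_EFinP; apply: measurable_maxr.
have mn : measurable_fun setT (fun x => (Num.max (- partial i F x) 0)%:E).
  by apply/measurable_EFinP; apply: measurable_maxr => //; exact: measurable_funN.
have p0 x : (0 <= (Num.max (partial i F x) 0)%:E)%E by rewrite lee_fin le_max lexx orbT.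
have n0 x : (0 <= (Num.max (- partial i F x) 0)%:E)%E by rewrite lee_fin le_max lexx orbT.
case: (unliftP 0 i) => [j ij|i0].
- rewrite (ge0_integral_rV_cons1 mp p0) (ge0_integral_rV_cons1 mn n0); apply: eq_integral => s _.
  pose G (y : 'rV[R]_n) := F (rV_cons (s, y)).
  have deltaE : delta_mx 0 i = rV_cons (0, delta_mx 0 j : 'rV[R]_n).
    apply/rowP => k; rewrite ij; case: (unliftP 0 k) => [l ->|->].
      by rewrite rV_consS !mxE (inj_eq lift_inj).
    by rewrite rV_cons0 mxE eq_liftF.
  have lineE y (h : R) : G (h *: delta_mx 0 j + y) = F (h *: delta_mx 0 i + rV_cons (s, y)).
    by rewrite /G deltaE -rV_consD mulr0 add0r.
  have dG y : is_derive y (delta_mx 0 j) G (partial i F (rV_cons (s, y))).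
    apply/is_derive_line; under eq_fun do rewrite lineE.
    by apply/is_derive_line; split.
  have pG : partial j G = fun y => partial i F (rV_cons (s, y)).
    by apply/funext => y; have [_ <-] := dG y.
  rewrite -[LHS]/(\int[lebesgue_rV n]_y (Num.max (partial i F (rV_cons (s, y))) 0)%:E)%E.
  have := ih j G; rewrite pG; apply.
  + by move=> y; apply: continuous_comp; [exact: rV_cons_cont|exact: cF].
  + by move=> y; apply: continuous_comp; [exact: rV_cons_cont|exact: cpF].
  + by move=> y; have [] := dG y.
  + by move=> y Gy k; have := FM _ Gy (lift 0 k); rewrite rV_consS.
- rewrite (ge0_integral_rV_cons mp p0) (ge0_integral_rV_cons mn n0); apply: eq_integral => y _.
  have deltaE : delta_mx 0 i = rV_cons (1, 0 : 'rV[R]_n).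
    apply/rowP => k; rewrite i0; case: (unliftP 0 k) => [l ->|->].
      by rewrite rV_consS !mxE eq_sym eq_liftF.
    by rewrite rV_cons0 mxE !eqxx.
  have lineE (s h : R) : F (rV_cons (h * 1 + s, y)) = F (h *: delta_mx 0 i + rV_cons (s, y)).
    by rewrite deltaE -rV_consD scaler0 add0r.
  have dG (s : R) : is_derive s 1 (fun s => F (rV_cons (s, y))) (partial i F (rV_cons (s, y))).
    apply/is_derive_line; under eq_fun do rewrite lineE.
    by apply/is_derive_line; split.
  apply: (@integral_derive0 (fun s => F (rV_cons (s, y))) (fun s => partial i F (rV_cons (s, y))) M) => //.
  + by move=> s; apply: continuous_comp; [exact: rV_cons_cont1|exact: cpF].
  + by move=> s sM; apply: (csuppP (i := 0) FM); rewrite rV_cons0.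
  + by move=> s sM; apply: (csuppP (i := 0) (csupp_partial (i := i) FM)); rewrite rV_cons0.
Qed.
End compact_support.
Arguments cbox {R} n M.

Section weak_gradient_theory.
Context {R : realType}.
Notation leb := (@lebesgue_measure R).

Lemma locally_integrable_cbox n (f : 'rV[R]_n -> R) M : locally_integrable_rV f ->
  (lebesgue_rV n).-integrable (cbox n M) (EFin \o f).
Proof.
move=> [mf fC]; apply/integrableP; split.
  by apply/measurable_EFinP; exact: measurable_funTS.
exact: fC (@compact_cbox _ n M).
Qed.

Lemma locally_integrable_mul n (f phi : 'rV[R]_n -> R) M C : locally_integrable_rV f ->
  measurable_fun setT phi -> csupp M phi -> (forall x, `|phi x| <= C) ->
  (lebesgue_rV n).-integrable setT (fun x => (f x * phi x)%:E).
Proof.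
move=> lf mphi phiM phiC; have [mf _] := lf.
have C0 : 0 <= C by exact: le_trans (phiC 0).
have i1 : (lebesgue_rV n).-integrable (cbox n M) (fun x => C%:E * (f x)%:E)%E.
  by apply: integrableZl; [exact: measurable_cbox|exact: locally_integrable_cbox].
have := (integrable_mkcond _ (@measurable_cbox R n M)).1 i1.
apply: le_integrable => //.
  by apply/measurable_EFinP; exact: measurable_funM.
move=> x _; rewrite /= patchE; case: ifPn => [_|xM].
  by rewrite abseM /= -EFinM lee_fin normrM mulrC ler_wpM2r// (ger0_norm C0).
suff -> : phi x = 0 by rewrite mulr0 normr0 abse0.
apply/eqP; apply: contraNT xM => px; rewrite inE; apply/cboxP; exact: phiM.
Qed.

Lemma test_function_csupp n (phi : 'rV[R]_n -> R) : test_function phi ->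
  exists M, csupp M phi.
Proof.
move=> [_ /compact_bounded[M [_ HM]]]; exists (`|M| + 1) => x px i.
have xc : closure [set x | phi x != 0] x by exact: subset_closure.
have Mx : M < `|M| + 1 by rewrite (le_lt_trans (ler_norm M))// ltrDl.
have := HM _ Mx _ xc; apply: le_trans.
have /mapP[j Hj ->] : `|x ord0 i| \in [seq `|x v.1 v.2| | v : 'I_1 * 'I_n].
  by apply/mapP; exists (ord0, i) => //=; rewrite mem_enum.
by rewrite [leRHS]/Num.norm /= mx_normrE; apply/bigmax_geP; right => /=; exists j.
Qed.

Lemma class_C_csupp_mul_integrable n (f phi : 'rV[R]_n -> R) M : locally_integrable_rV f ->
  continuous phi -> csupp M phi -> (lebesgue_rV n).-integrable setT (fun x => (f x * phi x)%:E).
Proof.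
move=> lf cphi phiM; have [C C0 HC] := continuous_csupp_bounded cphi phiM.
apply: (@locally_integrable_mul _ _ _ M C) => //.
  exact: continuous_measurable_rV.
by move=> x; rewrite (le_trans (HC x))// ler_piMr// indicE; case: (_ \in _).
Qed.

Definition box_bump n k (a b : 'I_n -> R) (x : 'rV[R]_n) : R :=
  \prod_(i < n) plateau k (a i) (b i) (x 0 i).

Lemma box_bump_class_C n j k (a b : 'I_n -> R) : class_C j (box_bump k a b).
Proof.
apply: class_C_prod => i.
by apply: (class_C_comp (q := fun x : 'rV[R]_n => x 0 i)); [exact: plateau_Ck|exact: class_C_coord].
Qed.

Lemma box_bump_itv n k (a b : 'I_n -> R) x : 0 <= box_bump k a b x <= 1.
Proof.
rewrite prodr_ge0/=; last by move=> i _; case/andP: (plateau_itv k (a i) (b i) (x 0 i)).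
by apply: prodr_ile1 => i _; exact: plateau_itv.
Qed.

Lemma box_bump_neq0 n k (a b : 'I_n -> R) (x : 'rV[R]_n) : box_bump k a b x != 0 -> obox a b x.
Proof.
move=> + i; apply: contraNT => xi; rewrite /box_bump (bigD1 i)//=.
by rewrite plateau0 ?mul0r.
Qed.

Lemma box_bump_cvg n (a b : 'I_n -> R) x :
  box_bump k a b x @[k --> \oo] --> (\1_(obox a b) x : R).
Proof.
have -> : (\1_(obox a b) x : R) = \prod_(i < n) \1_`]a i, b i[ (x 0 i).
  rewrite indicE; have [xab|xab] := boolP (x \in obox a b).
    rewrite big1// => i _; rewrite indicE mem_set//= in_itv/=.
    by rewrite inE in xab; exact: xab.
  have /existsNP[i xi] : ~ forall i, a i < x 0 i < b i.
    by move=> H; move: xab; rewrite notin_setE; apply.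
  rewrite (bigD1 i)//= indicE memNset ?mul0r//= in_itv/=; exact/negP.
apply: cvg_big => [|i _]; last exact: plateau_cvg.
by move=> z; exact: (@mul_continuous R z).
Qed.

Definition box_bound n (a b : 'I_n -> R) : R := \sum_(i < n) (`|a i| + `|b i|).

Lemma obox_bound n (a b : 'I_n -> R) x : obox a b x -> forall i, `|x 0 i| <= box_bound a b.
Proof.
move=> xab i; have /andP[ax xb] := xab i.
rewrite /box_bound (bigD1 i)//=.
have S : 0 <= \sum_(j < n | j != i) (`|a j| + `|b j|) by apply: sumr_ge0 => j _; rewrite addr_ge0.
apply: (@le_trans _ _ (`|a i| + `|b i|)); last by rewrite lerDl.
have := ler_norm (- a i); have := ler_norm (b i); rewrite normrN => bi ai.
have := normr_ge0 (a i); have := normr_ge0 (b i) => b0 a0.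
rewrite ler_norml; apply/andP; split; lra.
Qed.

Lemma box_bump_csupp n k (a b : 'I_n -> R) : csupp (box_bound a b) (box_bump k a b).
Proof. by move=> x /box_bump_neq0; exact: obox_bound. Qed.

(** Box bumps are test functions that converge to the indicator and are dominated by the indicator
    of one fixed cube, so dominated convergence carries the vanishing over. *)
Lemma fundamental_lemma_obox n (w : 'rV[R]_n -> R) a b : locally_integrable_rV w ->
  (forall phi, test_function phi -> \int[lebesgue_rV n]_x (w x * phi x) = 0) ->
  (\int[lebesgue_rV n]_x (w x * \1_(obox a b) x)%:E = 0)%E.
Proof.
move=> lw H; have [mw _] := lw; pose M := box_bound a b.
have mb k : measurable_fun setT (@box_bump n k a b).
  by apply: continuous_measurable_rV; exact: (class_C_cont (box_bump_class_C 0 k a b)).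
have iw : (lebesgue_rV n).-integrable setT (fun x => (w x * \1_(cbox n M) x)%:E).
  apply: (@locally_integrable_mul _ _ _ M 1) => //.
  - by apply: measurable_indic; exact: measurable_cbox.
  - by move=> x; rewrite indicE; case: (boolP (x \in _)) => [|_]; rewrite ?eqxx// inE => /cboxP.
  - by move=> x; rewrite indicE; case: (_ \in _); rewrite ?normr1 ?normr0.
have [|||||_ _] := @dominated_convergence _ _ R (lebesgue_rV n) setT measurableT
  (fun k x => (w x * box_bump k a b x)%:E) (fun x => (w x * \1_(obox a b) x)%:E)
  (fun x => `|(w x * \1_(cbox n M) x)%:E|)%E.
- by move=> k; apply/measurable_EFinP; exact: measurable_funM.
- apply/measurable_EFinP; apply: measurable_funM => //; apply: measurable_indic.
  exact: measurable_obox.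
- apply: aeW => x _; apply: cvg_EFin; first exact: nearW.
  by apply: cvgM; [exact: cvg_cst|exact: box_bump_cvg].
- exact: integrable_abse.
- apply: aeW => x k _; rewrite lee_fin !normrM ler_wpM2l//.
  have /andP[b0 b1] := box_bump_itv k a b x; rewrite ger0_norm// indicE.
  have [_|xM] := boolP (x \in _); first by rewrite normr1.
  rewrite normr0; have [->//|/box_bump_csupp bM] := eqVneq (box_bump k a b x) 0.
  by exfalso; move: xM; rewrite notin_setE; apply; apply/cboxP.
rewrite (_ : [sequence _]_k = cst 0%E).
  by move=> /(cvg_unique _ (@cvg_cst _ _ _ _ _)) <-.
apply/funext => k; rewrite /=.
have tb : test_function (@box_bump n k a b).
  by apply: (@test_functionP _ _ _ M); [move=> j; exact: box_bump_class_C|exact: box_bump_csupp].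
have := H _ tb; rewrite /Rintegral => h0.
rewrite -[LHS]fineK ?h0//.
apply: integrable_fin_num => //.
apply: (class_C_csupp_mul_integrable lw _ (@box_bump_csupp n k a b)).
exact: (class_C_cont (box_bump_class_C 0 k a b)).
Qed.
End weak_gradient_theory.

(** * Uniqueness of weak gradients, and classical gradients as weak ones *)

Section weak_gradient_unique.
Context {R : realType}.

Lemma integral_eq0_posneg d (T : measurableType d) (mu : {measure set T -> \bar R}) (f : T -> R) :
  mu.-integrable setT (EFin \o f) -> (\int[mu]_x (f x)%:E = 0)%E ->
  (\int[mu]_x (Num.max (f x) 0)%:E = \int[mu]_x (Num.max (- f x) 0)%:E)%E.
Proof.
move=> fi; rewrite integralE.
have Ep : (fun s => (EFin \o f)^\+ s)%E = (fun s => (Num.max (f s) 0)%:E).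
  by apply/funext => s; rewrite funeposE/= EFin_max.
have En : (fun s => (EFin \o f)^\- s)%E = (fun s => (Num.max (- f s) 0)%:E).
  by apply/funext => s; rewrite funenegE/= EFin_max EFinN.
have := integrable_pos_fin_num measurableT fi.
have := integrable_neg_fin_num measurableT fi.
by rewrite Ep En => p1 n1 /eqP; rewrite sube_eq// ?add0e => /eqP.
Qed.

Lemma ge0_integral_eq0_ae d (T : measurableType d) (mu : {measure set T -> \bar R}) (D : set T) (f : T -> R) :
  measurable D -> measurable_fun setT f -> (forall x, 0 <= f x) ->
  (\int[mu]_(x in D) (f x)%:E = 0)%E -> {ae mu, forall x, D x -> f x = 0}.
Proof.
move=> mD mf f0 If.
have : (\int[mu]_(x in D) `|(f x)%:E| = 0)%E.
  by rewrite -[RHS]If; apply: eq_integral => x _; rewrite gee0_abs// lee_fin.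
have mfD : measurable_fun D (EFin \o f) by apply/measurable_EFinP; exact: measurable_funTS.
move=> /(ae_eq_integral_abs mu mD mfD).1 /ae_imply; apply => x /= H Dx.
by have := H Dx => -[].
Qed.

Lemma obox_setI n (a b a' b' : 'I_n -> R) : obox a b `&` obox a' b' =
  obox (fun i => Num.max (a i) (a' i)) (fun i => Num.min (b i) (b' i)).
Proof.
apply/seteqP; split=> [x [/= h h'] i|x h].
  by have := h i; have := h' i; rewrite gt_max lt_min => /andP[-> ->] /andP[-> ->].
by split=> i; have := h i; rewrite gt_max lt_min => /andP[/andP[? ?] /andP[? ?]]; exact/andP.
Qed.

(** On each bounded box the positive and negative parts of [w] are densities of two finite measures.
    They agree on boxes, hence on all measurable sets, in particular on {w > 0} and {w < 0}, where
    one of them is 0. *)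
Lemma fundamental_lemma n (w : 'rV[R]_n -> R) : locally_integrable_rV w ->
  (forall phi, test_function phi -> \int[lebesgue_rV n]_x (w x * phi x) = 0) ->
  {ae lebesgue_rV n, forall x, w x = 0}.
Proof.
move=> lw H; have [mw _] := lw.
have key (k : nat) : (lebesgue_rV n).-negligible
    [set x | obox (fun=> - k%:R) (fun=> k%:R) x /\ w x <> 0].
  set B := obox _ _; have mB : measurable B by exact: measurable_obox.
  have mB1 : measurable_fun setT (\1_B : 'rV[R]_n -> R) by exact: measurable_indic.
  pose wp x := Num.max (w x) 0 * \1_B x; pose wn x := Num.max (- w x) 0 * \1_B x.
  have mp : measurable_fun setT wp by apply: measurable_funM => //; exact: measurable_maxr.
  have mn : measurable_fun setT wn.
    by apply: measurable_funM => //; apply: measurable_maxr => //; exact: measurable_funN.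
  have wp0 x : 0 <= wp x by rewrite mulr_ge0// le_max lexx orbT.
  have wn0 x : 0 <= wn x by rewrite mulr_ge0// le_max lexx orbT.
  have mid : measurable_fun setT (@id 'rV[R]_n) by exact: measurable_id.
  have [p pE] := @weighted_pushforward_measure _ _ _ _ R (lebesgue_rV n) id wp mid mp wp0.
  have [q qE] := @weighted_pushforward_measure _ _ _ _ R (lebesgue_rV n) id wn mid mn wn0.
  have iw a b : (lebesgue_rV n).-integrable setT (fun x => (w x * \1_(obox a b) x)%:E).
    apply: (@locally_integrable_mul _ _ _ _ (box_bound a b) 1) => //.
    - by apply: measurable_indic; exact: measurable_obox.
    - move=> x; rewrite indicE; case: (boolP (x \in _)) => [|_]; rewrite ?eqxx// inE => xab _.
      exact: obox_bound.
    - by move=> x; rewrite indicE; case: (_ \in _); rewrite ?normr1 ?normr0.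
  have maxI (A : set 'rV[R]_n) (f : R) x : Num.max (f * \1_A x) 0 = Num.max f 0 * \1_A x.
    by rewrite indicE; case: (_ \in _); rewrite ?mulr1// !mulr0 maxxx.
  have pob a b : p (obox a b) = (\int[lebesgue_rV n]_x
      (Num.max (w x * \1_(obox a b `&` B) x) 0)%:E)%E.
    rewrite pE /weighted_pushforward preimage_id integral_mkcond.
    by apply: eq_integral => x _; rewrite epatch_indic /= -EFinM maxI indicI/= mulrAC -mulrA.
  have qob a b : q (obox a b) = (\int[lebesgue_rV n]_x
      (Num.max (- (w x * \1_(obox a b `&` B) x)) 0)%:E)%E.
    rewrite qE /weighted_pushforward preimage_id integral_mkcond.
    apply: eq_integral => x _; rewrite epatch_indic /= -EFinM -mulNr maxI indicI/= mulrAC -mulrA//.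
  (* Intersecting with [B] gives a box again, so [fundamental_lemma_obox] applies and both measures
     are finite. *)
  have pq : forall A, measurable A -> p A = q A.
    apply: obox_measure_unique => a b.
      rewrite pob qob /B obox_setI; apply: (integral_eq0_posneg (iw _ _)).
      exact: fundamental_lemma_obox.
    rewrite pob /B obox_setI.
    have := integrable_pos_fin_num measurableT (iw (fun i => Num.max (a i) (- k%:R)) (fun i => Num.min (b i) k%:R)).
    rewrite ge0_fin_numE; last by apply: integral_ge0.
    by under eq_integral do rewrite funeposE -EFin_max.
  pose A := [set x | 0 < w x]; pose A' := [set x | w x < 0].
  have mA : measurable A.
    have := measurable_preimage_itv `]0, +oo[ mw.
    by congr measurable; apply/seteqP; split=> x /=; rewrite in_itv/= andbT.
  have mA' : measurable A' by exact: (measurable_set_lt 0 mw).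
  (* [q] has density 0 on {w > 0}; hence so does [p], up to a null set. *)
  have p0 : p A = 0%E.
    rewrite pq// qE /weighted_pushforward integral0_eq// => x; rewrite /A/= => wx.
    by rewrite /wn max_r ?mul0r// oppr_le0 ltW.
  have q0 : q A' = 0%E.
    rewrite -pq// pE /weighted_pushforward integral0_eq// => x; rewrite /A'/= => wx.
    by rewrite /wp max_r ?mul0r// ltW.
  have aep : {ae lebesgue_rV n, forall x, A x -> wp x = 0}.
    by apply: ge0_integral_eq0_ae => //; rewrite -[RHS]p0 pE.
  have aen : {ae lebesgue_rV n, forall x, A' x -> wn x = 0}.
    by apply: ge0_integral_eq0_ae => //; rewrite -[RHS]q0 qE.
  have : {ae lebesgue_rV n, forall x, ~ (B x /\ w x <> 0)}.
    apply: filterS2 aep aen => x hp hn [Bx /eqP wx].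
    have B1 : \1_B x = 1 :> R by rewrite indicE mem_set.
    move: wx; rewrite neq_lt => /orP[wx|wx].
      have := hn wx; rewrite /wn B1 mulr1 max_l ?oppr_ge0 ?ltW// => /eqP.
      by rewrite oppr_eq0 lt_eqF.
    by have := hp wx; rewrite /wp B1 mulr1 max_l ?ltW// => /eqP; rewrite gt_eqF.
  by move=> [Z [mZ Z0 HZ]]; exists Z; split=> // x Bx; apply: HZ => /=; apply.
have := negligible_bigcup key; move=> [Z [mZ Z0 HZ]]; exists Z; split=> // x /= wx.
apply: HZ; have [k xk] := rV_bounded x; exists k => //; split=> // i.
by rewrite -ltr_norml.
Qed.

Lemma locally_integrableP n (f : 'rV[R]_n -> R) : measurable_fun setT f ->
  (forall M, (lebesgue_rV n).-integrable (cbox n M) (EFin \o f)) -> locally_integrable_rV f.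
Proof.
move=> mf iM; split=> // C /compact_bounded[M [_ HM]].
pose L := `|M| + 1; have ML : M < L by rewrite (le_lt_trans (ler_norm M))// ltrDl.
have CL : C `<=` cbox n L.
  move=> x Cx; apply/cboxP => i; apply: le_trans (HM _ ML _ Cx).
  have /mapP[j Hj ->] : `|x ord0 i| \in [seq `|x v.1 v.2| | v : 'I_1 * 'I_n].
    by apply/mapP; exists (ord0, i) => //=; rewrite mem_enum.
  by rewrite [leRHS]/Num.norm /= mx_normrE; apply/bigmax_geP; right => /=; exists j.
have /integrableP[_] := iM L; apply: le_lt_trans.
rewrite integral_mkcond [leRHS]integral_mkcond; apply: ge0_le_integral_nonmeasurable => x.
  by rewrite patchE; case: ifP.
rewrite !patchE; case: ifPn => [|_]; last by case: ifP => // _; exact: abse_ge0.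
by rewrite inE => /CL xL; rewrite mem_set.
Qed.

Lemma weak_gradient_unique n (u : 'rV[R]_n -> R) g g' : weak_gradient u g -> weak_gradient u g' ->
  {ae lebesgue_rV n, forall x, g x = g' x}.
Proof.
move=> [_ lg wg] [_ lg' wg'].
have : {ae lebesgue_rV n, forall x, forall i : 'I_n, g x 0 i - g' x 0 i = 0}.
  apply: filter_forall => i.
  have [mg _] := lg i; have [mg' _] := lg' i.
  apply: fundamental_lemma.
    apply: locally_integrableP => [|M]; first exact: measurable_funB.
    have := integrableB (@measurable_cbox R n M) (locally_integrable_cbox M (lg i)) (locally_integrable_cbox M (lg' i)).
    by apply: eq_integrable => //; exact: measurable_cbox.
  move=> phi tphi; have [M phiM] := test_function_csupp tphi.
  have cphi : continuous phi by exact: (class_C_cont (tphi.1 0)).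
  have i1 := class_C_csupp_mul_integrable (lg i) cphi phiM.
  have i2 := class_C_csupp_mul_integrable (lg' i) cphi phiM.
  under eq_Rintegral do rewrite mulrBl.
  rewrite RintegralB//; apply/eqP; rewrite subr_eq0; apply/eqP/oppr_inj.
  by rewrite -wg// -wg'.
apply: filterS => x H; apply/rowP => i; apply/eqP; rewrite -subr_eq0; exact/eqP.
Qed.

Lemma grad_ae n (u : 'rV[R]_n -> R) g : weak_gradient u g ->
  {ae lebesgue_rV n, forall x, grad u x = g x}.
Proof.
move=> wg; apply: (weak_gradient_unique _ wg).
by apply: (@getPex _ (weak_gradient u)); exists g.
Qed.

Lemma Rintegral_partial0 n i (F : 'rV[R]_n -> R) M : class_C 1 F -> csupp M F ->
  \int[lebesgue_rV n]_x partial i F x = 0.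
Proof.
move=> CF FM.
have cF := class_C_cont CF; have cpF := class_C_cont (class_C_partial i CF).
have dF x : derivable F x (delta_mx 0 i) by have [] := class_C_derivable i x CF.
have := integral_partial0 cF cpF dF FM => E.
have ip := continuous_csupp_integrable cpF (csupp_partial FM).
have n1 := integrable_neg_fin_num measurableT ip.
rewrite /Rintegral integralE.
have Ep : (fun s => (EFin \o partial i F)^\+ s)%E = (fun s => (Num.max (partial i F s) 0)%:E).
  by apply/funext => s; rewrite funeposE/= EFin_max.
have En : (fun s => (EFin \o partial i F)^\- s)%E = (fun s => (Num.max (- partial i F s) 0)%:E).
  by apply/funext => s; rewrite funenegE/= EFin_max EFinN.
by move: n1; rewrite Ep En E => n1; rewrite subee.
Qed.

Definition gradient n (u : 'rV[R]_n -> R) (x : 'rV[R]_n) : 'rV[R]_n := \row_i partial i u x.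

Lemma continuous_csupp_locally_integrable n (f : 'rV[R]_n -> R) M : continuous f -> csupp M f ->
  locally_integrable_rV f.
Proof.
move=> cf fM; apply: locally_integrableP => [|L]; first exact: continuous_measurable_rV.
apply: integrableS (continuous_csupp_integrable cf fM) => //; exact: measurable_cbox.
Qed.

(** The derivative of the compactly supported product of [u] and the test function integrates to
    0. *)
Lemma weak_gradient_class_C n (u : 'rV[R]_n -> R) M : class_C 1 u -> csupp M u ->
  weak_gradient u (gradient u).
Proof.
move=> Cu uM.
have lu : locally_integrable_rV u by exact: continuous_csupp_locally_integrable (class_C_cont Cu) uM.
have lg i : locally_integrable_rV (fun x => gradient u x 0 i).
  under eq_fun do rewrite mxE.
  exact: continuous_csupp_locally_integrable (class_C_cont (class_C_partial i Cu)) (csupp_partial uM).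
split=> // phi tphi i; have [L phiL] := test_function_csupp tphi.
have Cphi := tphi.1 1; have cphi := class_C_cont Cphi.
have cpphi := class_C_cont (class_C_partial i Cphi).
have Fsupp : csupp M (u \* phi).
  by move=> x /=; rewrite mulf_eq0 negb_or => /andP[/uM].
have := Rintegral_partial0 i (class_C_mul Cu Cphi) Fsupp.
have -> : partial i (u \* phi) = (fun x => u x * partial i phi x + gradient u x 0 i * phi x).
  apply/funext => x; rewrite mxE.
  have du := class_C_derivable i x Cu; have dphi := class_C_derivable i x Cphi.
  have [_ E] := is_deriveM du dphi; rewrite /partial -/(u * phi) E /GRing.scale/=.
  by rewrite [X in _ = _ + X]mulrC.
rewrite RintegralD//.
- by move/eqP; rewrite addr_eq0 => /eqP.
- exact: class_C_csupp_mul_integrable lu cpphi (csupp_partial phiL).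
- exact: class_C_csupp_mul_integrable (lg i) cphi phiL.
Qed.
End weak_gradient_unique.

(** * The sector test function *)

Lemma cross_sub_le (R : realDomainType) (P P' m m' : R) : 0 <= P <= m -> 0 <= P' <= m' ->
  `|m' * P - m * P'| <= m * m'.
Proof.
move=> /andP[P0 Pm] /andP[P0' Pm']; rewrite ler_norml; apply/andP; split.
  rewrite lerNl opprB; apply: (@le_trans _ _ (m * P')); last by rewrite ler_wpM2l// (le_trans P0).
  by rewrite gerBl mulr_ge0// (le_trans P0').
apply: (@le_trans _ _ (m' * P)); first by rewrite gerBl mulr_ge0// (le_trans P0).
by rewrite mulrC ler_wpM2r// (le_trans P0').
Qed.

Lemma sector_bound (R : realFieldType) (M S D b s r : R) : 0 < r -> 0 <= M -> 0 <= D -> r / 2 < s ->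
  `|S| <= D -> 0 <= b <= 1 -> `|S * M * b| <= D * M * (r^-1 * (2 * s)).
Proof.
move=> r0 M0 D0 rs SD /andP[b0 b1]; rewrite !normrM (ger0_norm M0) (ger0_norm b0).
have s1 : 1 <= r^-1 * (2 * s) by rewrite ler_pdivlMl//; lra.
apply: ler_pM => //; last exact: le_trans s1.
  by rewrite mulr_ge0.
by rewrite ler_wpM2r.
Qed.

Lemma measurable_scaled_plateau (R : realType) k (c d m : R) :
  measurable_fun setT (fun t => (m * plateau k c d t)%:E).
Proof.
apply/measurable_EFinP; apply: measurable_funM => //.
by apply: continuous_measurable_fun; exact: plateau_cont.
Qed.

Lemma scaled_plateau_integral (R : realType) k (c d m : R) : 0 <= m ->
  (\int[@lebesgue_measure R]_t (m * plateau k c d t)%:E = (m * plateau_mass k c d)%:E)%E.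
Proof.
move=> m0; under eq_integral do rewrite EFinM.
rewrite ge0_integralZl_EFin//; first last.
- by apply/measurable_EFinP; apply: continuous_measurable_fun; exact: plateau_cont.
- by move=> t _; rewrite lee_fin; case/andP: (plateau_itv k c d t).
rewrite EFinM; congr (_ * _)%E; rewrite /plateau_mass /Rintegral fineK//.
exact: (integrable_fin_num measurableT (plateau_integrable k c d)).
Qed.

Opaque primitive plateau plateau_mass.

Section sector_test.
Context {R : realType} {n : nat}.
Notation leb := (@lebesgue_measure R).
Variables (c d c0 d0 r dl : R) (k1 k : nat).
Hypotheses (r_gt0 : 0 < r) (rc : r ^+ 2 <= c) (cd : c < d) (dc0 : d <= c0) (cd0 : c0 < d0).
Hypothesis dlr : forall y : 'rV[R]_n, obox (fun=> - dl) (fun=> dl) y -> sqn y <= r ^+ 2 / 2.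

(* The masses are interchanged so that the derivative [shell_step'] has integral [0]. *)
Definition shell_step (t : R) : R :=
  plateau_mass k c0 d0 * primitive (plateau k c d) t -
  plateau_mass k c d * primitive (plateau k c0 d0) t.

Definition shell_step' (t : R) : R :=
  plateau_mass k c0 d0 * plateau k c d t - plateau_mass k c d * plateau k c0 d0 t.

(** The cutoff H: constant on x_0 <= 0 (value 0) and on x_0 >= r/2. Its upper value is the mass of
    the plateau instead of 1, a factor divided out in [sector_inequality]; the index [k1] stays
    fixed while [k] tends to infinity. *)
Definition half_step : R -> R := primitive (plateau k1 0 (r / 2)).

Definition sector_test (x : 'rV[R]_n.+1) : R :=
  shell_step (sqn x) * half_step (x 0 0) * box_bump k (fun=> - dl) (fun=> dl) (rV_tail x).

Lemma primitive_plateau_is_derive m e f (t : R) : is_derive t 1 (primitive (plateau m e f)) (plateau m e f t).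
Proof.
by apply: (@primitive_is_derive _ _ e f) => [|s]; [exact: plateau_cont|exact: plateau_supp].
Qed.

Lemma primitive_plateau_Ck j m e f : Ck j (primitive (@plateau R m e f)).
Proof.
apply: CkW; apply: (@Ck_primitive _ j (plateau m e f)); first exact: plateau_Ck.
by move=> t; exact: primitive_plateau_is_derive.
Qed.

Lemma shell_step_is_derive (t : R) : is_derive t 1 shell_step (shell_step' t).
Proof.
have d1 := primitive_plateau_is_derive k c d t.
have d2 := primitive_plateau_is_derive k c0 d0 t.
exact: (is_deriveB (is_deriveZ (plateau_mass k c0 d0) d1) (is_deriveZ (plateau_mass k c d) d2)).
Qed.

Lemma shell_step_Ck j : Ck j shell_step.
Proof.
rewrite (_ : shell_step = ((fun=> plateau_mass k c0 d0) \* primitive (plateau k c d)) \+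
  ((fun=> - plateau_mass k c d) \* primitive (plateau k c0 d0))); last first.
  by apply/funext => t; rewrite /shell_step /= mulNr.
by apply: Ck_add; apply: Ck_mul; solve [exact: Ck_cst|exact: primitive_plateau_Ck].
Qed.

Let cd_le : c <= d. Proof. exact: ltW. Qed.

Let cd0_le : c0 <= d0. Proof. exact: ltW. Qed.

Lemma primitive_plateau_ge m e f (t : R) : f <= t -> primitive (plateau m e f) t = plateau_mass m e f.
Proof. by apply: (@primitive_ge _ _ e f) => s; exact: plateau_supp. Qed.

Lemma primitive_plateau_lt m e f (t : R) : t < e -> primitive (@plateau R m e f) t = 0.
Proof. by apply: (@primitive_le _ _ e f) => s; exact: plateau_supp. Qed.

Lemma primitive_plateau_itv m e f (t : R) : 0 <= primitive (plateau m e f) t <= plateau_mass m e f.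
Proof.
apply: primitive_itv; first exact: plateau_integrable.
by move=> s; case/andP: (plateau_itv m e f s).
Qed.

(** To the right of both intervals the primitives equal the two masses, and the crossed products
    cancel: this is what makes the support compact. *)
Lemma shell_step0 t : ~~ (c <= t <= d0) -> shell_step t = 0.
Proof.
have dt : d0 < t -> d <= t by move=> /ltW; apply: le_trans; exact: le_trans cd0_le.
have tc0 : t < c -> t < c0 by move=> tc; apply: (lt_le_trans tc); exact: le_trans dc0.
rewrite negb_and -!ltNge => /orP[tc|tc]; rewrite /shell_step.
  rewrite (primitive_plateau_lt k d tc) (primitive_plateau_lt k d0 (tc0 tc)).
  by move: (plateau_mass _ _ _) (plateau_mass _ _ _) => m m'; rewrite !mulr0 subrr.
rewrite (primitive_plateau_ge k c (dt tc)) (primitive_plateau_ge k c0 (ltW tc)).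
by move: (plateau_mass _ _ _) (plateau_mass _ _ _) => m m'; rewrite mulrC subrr.
Qed.

Lemma shell_step_le t : `|shell_step t| <= (d - c) * (d0 - c0).
Proof.
have := primitive_plateau_itv k c d t; have := primitive_plateau_itv k c0 d0 t.
have := plateau_mass_itv k cd_le; have := plateau_mass_itv k cd0_le.
rewrite /shell_step; move: (plateau_mass _ _ _) (plateau_mass _ _ _) (primitive _ _) (primitive _ _).
move=> m m' P P' /andP[m0 mL] /andP[m0' mL'] pm qm.
by apply: (le_trans (cross_sub_le qm pm)); exact: ler_pM.
Qed.

Lemma shell_step'_le t : `|shell_step' t| <= (d0 - c0) * \1_`]c, d[ t + (d - c) * \1_`]c0, d0[ t.
Proof.
have /andP[m0 mL] := plateau_mass_itv k cd_le.
have /andP[m0' mL'] := plateau_mass_itv k cd0_le.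
have pl e f : plateau k e f t <= \1_`]e, f[ t.
  rewrite indicE; have [_|tef] := boolP (t \in _); first by case/andP: (plateau_itv k e f t).
  by rewrite plateau0//; apply: contra tef => tef; rewrite inE/= in_itv.
have pl0 e f : 0 <= plateau k e f t by case/andP: (plateau_itv k e f t).
move: (pl c d) (pl c0 d0) (pl0 c d) (pl0 c0 d0) m0 m0' mL mL'; rewrite /shell_step'.
move: (plateau_mass _ _ _) (plateau_mass _ _ _) (plateau _ _ _ _) (plateau _ _ _ _) => m m' P P'.
move=> pP pP' P0 P0' m0 m0' mL mL'; apply: (le_trans (ler_normB _ _)).
by rewrite !ger0_norm ?mulr_ge0//; apply: lerD; exact: ler_pM.
Qed.

(** Above the cube |y|^2 <= r^2/2, so |x|^2 >= r^2 leaves x_0^2 >= r^2/2 > (r/2)^2. The support thus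
    avoids the zone where [half_step] varies. *)
Lemma sector_coord (x : 'rV[R]_n.+1) : c <= sqn x -> obox (fun=> - dl) (fun=> dl) (rV_tail x) ->
  r / 2 < `|x 0 0|.
Proof.
move=> cx /dlr xQ.
have xE : sqn x = sqn (rV_tail x) + x 0 0 ^+ 2.
  rewrite /sqn big_ord_recl addrC; congr (_ + _); apply: eq_bigr => i _.
  by rewrite /rV_tail mxE.
rewrite -(@ltr_pXn2r _ 2) ?nnegrE ?divr_ge0 ?(ltW r_gt0)// real_normK ?num_real//.
have r2 : 0 < r ^+ 2 by rewrite exprn_gt0.
rewrite expr_div_n; move: (r ^+ 2) (x 0 0 ^+ 2) r2 xQ rc xE cx => a b; lra.
Qed.

Lemma half_step_sign (s : R) : r / 2 < `|s| -> half_step s = plateau_mass k1 0 (r / 2) * (0 < s)%R%:R.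
Proof.
move=> rs; have [s0|s0] := ltP 0 s.
  rewrite mulr1 /half_step primitive_plateau_ge//; move: rs; rewrite gtr0_norm//; exact: ltW.
have s0' : s < 0.
  rewrite lt_neqAle s0 andbT; apply/eqP => s00; move: rs; rewrite s00 normr0 ltNge.
  by rewrite divr_ge0// ltW.
by rewrite mulr0 /half_step primitive_plateau_lt.
Qed.

Lemma sector_test_class_C j : class_C j sector_test.
Proof.
apply: class_C_mul; first apply: class_C_mul.
- by apply: class_C_comp; [exact: shell_step_Ck|exact: class_C_sqn].
- apply: (class_C_comp (q := fun x : 'rV[R]_n.+1 => x 0 0)); last exact: class_C_coord.
  exact: primitive_plateau_Ck.
- rewrite (_ : (fun x => _) = (fun x : 'rV[R]_n.+1 =>
     \prod_(i < n) plateau k (- dl) dl (x 0 (lift 0 i)))); last first.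
    by apply/funext => x; apply: eq_bigr => i _; rewrite /rV_tail mxE.
  apply: class_C_prod => i.
  by apply: (class_C_comp (q := fun x : 'rV[R]_n.+1 => x 0 (lift 0 i)));
    [exact: plateau_Ck|exact: class_C_coord].
Qed.

Lemma sector_test_neq0 (x : 'rV[R]_n.+1) : sector_test x != 0 ->
  [/\ c <= sqn x <= d0, obox (fun=> - dl) (fun=> dl) (rV_tail x) & r / 2 < x 0 0].
Proof.
rewrite /sector_test !mulf_eq0 !negb_or => /andP[/andP[s1 s2] s3].
have tx : c <= sqn x <= d0 by apply: contraNT s1 => /shell_step0 ->.
have Qx := box_bump_neq0 s3; split=> //.
have /andP[cx _] := tx; have := sector_coord cx Qx => rx.
move: s2; rewrite half_step_sign//; case: ltP => [x0 _|]; last by rewrite mulr0 eqxx.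
by rewrite gtr0_norm in rx.
Qed.

Lemma sector_test_csupp : csupp (1 + d0) sector_test.
Proof.
move=> x /sector_test_neq0[/andP[cx xd] _ _] i.
have d00 : 0 <= d0 by apply: le_trans xd; exact: sqn_ge0.
rewrite -(@ler_pXn2r _ 2) ?nnegrE ?addr_ge0// real_normK ?num_real//.
by rewrite (le_trans (sqn_coord x i))// (le_trans xd)//; nra.
Qed.

Lemma sector_test_test : test_function sector_test.
Proof. exact: (test_functionP sector_test_class_C sector_test_csupp). Qed.

(** On the support 2 x_0 / r > 1, so the factor 2 x_0 / r can be inserted for free; it supplies the
    weight under which |x|^2 has a computable law. *)
Lemma sector_test_le x : `|sector_test x| <=
  (d - c) * (d0 - c0) * plateau_mass k1 0 (r / 2) *
  (r^-1 * half_weight (obox (fun=> - dl) (fun=> dl)) x) * \1_`[c, d0] (sqn x).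
Proof.
have r2 : (0 : R) <= r / 2 by rewrite divr_ge0// ltW.
have M0 : 0 <= plateau_mass k1 0 (r / 2) by case/andP: (plateau_mass_itv k1 r2).
have h0 := half_weight_ge0 (obox (fun=> - dl) (fun=> dl)) x.
have D0 : 0 <= (d - c) * (d0 - c0) by rewrite mulr_ge0// subr_ge0.
have [->|x0] := eqVneq (sector_test x) 0.
  rewrite normr0; apply: mulr_ge0; last by rewrite indicE.
  apply: mulr_ge0; first exact: mulr_ge0.
  by apply: mulr_ge0 => //; rewrite invr_ge0 ltW.
have [tx Qx rx] := sector_test_neq0 x0.
rewrite [\1_`[c, d0] _]indicE mem_set/= ?in_itv//= mulr1 /half_weight indicE mem_set// mulr1.
have x2 : 0 <= 2 * x 0 0 by rewrite mulr_ge0// (le_trans r2 (ltW rx)).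
rewrite (max_r x2) /sector_test.
have rx' : r / 2 < `|x 0 0| by rewrite gtr0_norm// (le_lt_trans r2).
have x00 : 0 < x 0 0 by exact: le_lt_trans r2 rx.
rewrite half_step_sign// x00 mulr1.
have := box_bump_itv k (fun=> - dl) (fun=> dl) (rV_tail x).
have := shell_step_le (sqn x).
move: M0 D0 rx.
move: (plateau_mass k1 0 (r / 2)) (shell_step (sqn x)) ((d - c) * (d0 - c0)) (box_bump k _ _ _) (x 0 0).
move=> M S D b s M0 D0 rs SD bb; exact: sector_bound.
Qed.

(** Of the three factors only the shell is really differentiated: the box cutoff does not depend on
    x_0, and [half_step] is constant wherever the other two factors are nonzero. *)
Lemma sector_test_partial x : partial 0 sector_test x =
  plateau_mass k1 0 (r / 2) * shell_step' (sqn x) * Num.max 0 (2 * x 0 0) *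
    box_bump k (fun=> - dl) (fun=> dl) (rV_tail x).
Proof.
set e : 'rV[R]_n.+1 := delta_mx 0 0.
have e0 : e 0 0 = 1 by rewrite mxE !eqxx.
have d1 : is_derive x e (shell_step \o @sqn R n.+1) (shell_step' (sqn x) * (2 * x 0 0)).
  by apply: is_derive_comp1; [exact: shell_step_is_derive|exact: is_derive_sqn].
have d2 : is_derive x e (half_step \o (fun x : 'rV[R]_n.+1 => x 0 0)) (plateau k1 0 (r / 2) (x 0 0) * 1).
  apply: is_derive_comp1; first exact: primitive_plateau_is_derive.
  by rewrite -e0; exact: is_derive_coord.
have d3 : is_derive x e (fun x => box_bump k (fun=> - dl) (fun=> dl) (rV_tail x)) 0.
  apply/is_derive_line.
  rewrite (_ : (fun h => _) = fun=> box_bump k (fun=> - dl) (fun=> dl) (rV_tail x)); first exact: is_derive_cst.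
  apply/funext => h; congr box_bump; apply/rowP => i.
  by rewrite /rV_tail !mxE/= mulr0 add0r.
have [_ E] := is_deriveM (is_deriveM d1 d2) d3.
rewrite /partial -[sector_test]/((shell_step \o @sqn R n.+1) * (half_step \o (fun x : 'rV[R]_n.+1 => x 0 0)) *
  (fun x => box_bump k (fun=> - dl) (fun=> dl) (rV_tail x))) E /GRing.scale/= mulr0 add0r.
have [->|b0] := eqVneq (box_bump k (fun=> - dl) (fun=> dl) (rV_tail x)) 0; first by rewrite mul0r mulr0.
have Qx := box_bump_neq0 b0.
have [cx|xc] := leP c (sqn x); last first.
  have -> : shell_step (sqn x) = 0 by rewrite shell_step0// negb_and -ltNge xc.
  have -> : shell_step' (sqn x) = 0.
    have xc0 : sqn x <= c0 by rewrite (le_trans (ltW xc))// (le_trans cd_le).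
    rewrite /shell_step'; have -> : plateau k c d (sqn x) = 0 by rewrite plateau0// negb_and -!leNgt (ltW xc).
    have -> : plateau k c0 d0 (sqn x) = 0 by rewrite plateau0// negb_and -!leNgt xc0.
    by move: (plateau_mass _ _ _) (plateau_mass _ _ _) => m m'; rewrite !mulr0 subrr.
  by rewrite !(mul0r, mulr0, addr0).
have rx := sector_coord cx Qx; rewrite half_step_sign//.
have -> : plateau k1 0 (r / 2) (x 0 0) = 0.
  rewrite plateau0// negb_and -!leNgt; move: rx; have [x0|x0] := leP (x 0 0) 0; first by [].
  by rewrite gtr0_norm// => /ltW ->; rewrite orbT.
move: (plateau_mass k1 0 (r / 2)) (shell_step' (sqn x)) (shell_step (sqn x)) (box_bump _ _ _ _) (x 0 0).
move=> M S S' b s; have [s0|s0] := ltP 0 s; rewrite /=.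
  by rewrite max_r ?mulr_ge0 ?(ltW s0)//; ring.
by rewrite max_l ?pmulr_rle0//; ring.
Qed.
End sector_test.

Lemma Rintegral_dominated_cvg d (T : measurableType d) (R : realType)
    (mu : {measure set T -> \bar R}) (f_ : nat -> T -> R) (f G : T -> R) :
  (forall k, measurable_fun setT (f_ k)) -> measurable_fun setT f ->
  (forall x, f_ k x @[k --> \oo] --> f x) -> mu.-integrable setT (EFin \o G) ->
  (forall k x, `|f_ k x| <= G x) ->
  \int[mu]_x f_ k x @[k --> \oo] --> \int[mu]_x f x.
Proof.
move=> mf_ mf cf iG fG.
have [|||||ig _ H] := @dominated_convergence _ T R mu setT measurableT
  (fun k x => (f_ k x)%:E) (EFin \o f) (EFin \o G).
- by move=> k; apply/measurable_EFinP.
- exact/measurable_EFinP.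
- by apply: aeW => x _; apply: cvg_EFin; [exact: nearW|exact: cf].
- exact: iG.
- by apply: aeW => x k _; rewrite lee_fin.
apply: fine_cvg; rewrite fineK//; exact: integrable_fin_num.
Qed.

Section half_weight_bound.
Context {R : realType} {n : nat}.
Variables (d : R) (d_ge0 : 0 <= d).
Implicit Types x : 'rV[R]_n.+1.

Lemma sqn_cbox x : sqn x <= d -> cbox n.+1 (1 + d) x.
Proof.
move=> xd; apply/cboxP => i.
rewrite -(@ler_pXn2r _ 2) ?nnegrE ?addr_ge0// real_normK ?num_real//.
by rewrite (le_trans (sqn_coord x i))// (le_trans xd)//; have := d_ge0; nra.
Qed.

Lemma max_coord_le x : sqn x <= d -> Num.max 0 (2 * x 0 0) <= 2 * (1 + d).
Proof.
move=> /sqn_cbox/cboxP/(_ 0) x0.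
rewrite ge_max mulr_ge0 ?addr_ge0//= ler_pM2l// (le_trans _ x0)//; exact: ler_norm.
Qed.

Lemma half_weight_le (Q : set 'rV[R]_n) x : sqn x <= d -> half_weight Q x <= 2 * (1 + d).
Proof.
move=> /max_coord_le; apply: le_trans; rewrite /half_weight ler_piMr ?le_max ?lexx// indicE.
Qed.

End half_weight_bound.

Section sector_inequality.
Context {R : realType} {n : nat}.
Notation leb := (@lebesgue_measure R).
Variables (c d c0 d0 r dl : R) (u : 'rV[R]_n.+1 -> R) (g : 'rV[R]_n.+1 -> 'rV[R]_n.+1).
Hypotheses (r_gt0 : 0 < r) (rc : r ^+ 2 <= c) (cd : c < d) (dc0 : d <= c0) (cd0 : c0 < d0).
Hypothesis dlr : forall y : 'rV[R]_n, obox (fun=> - dl) (fun=> dl) y -> sqn y <= r ^+ 2 / 2.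
Hypothesis ug : weak_gradient u g.
Let Q : set 'rV[R]_n := obox (fun=> - dl) (fun=> dl).

Let cd_le : c <= d. Proof. exact: ltW. Qed.

Let cd0_le : c0 <= d0. Proof. exact: ltW. Qed.

Let c_lt_d0 : c < d0. Proof. by rewrite (lt_le_trans cd)// (le_trans dc0). Qed.

Let d0_ge0 : 0 <= d0. Proof. by rewrite (le_trans _ (ltW c_lt_d0))// (le_trans _ rc)// exprn_ge0// ltW. Qed.

(** Limit of [shell_step'] as the plateaus become indicators and their masses become the lengths of
    the intervals. *)
Definition shell_jump (t : R) : R := (d0 - c0) * \1_`]c, d[ t - (d - c) * \1_`]c0, d0[ t.

Lemma shell_jump_le t : `|shell_jump t| <= (d0 - c0) * \1_`]c, d[ t + (d - c) * \1_`]c0, d0[ t.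
Proof.
apply: (le_trans (ler_normB _ _)).
by rewrite !ger0_norm// mulr_ge0 ?subr_ge0// indicE.
Qed.

Let B := ((d0 - c0) + (d - c)) * (2 * (1 + d0)).

Let shell_bound (S t : R) : `|S| <= (d0 - c0) * \1_`]c, d[ t + (d - c) * \1_`]c0, d0[ t ->
  `|S| <= ((d0 - c0) + (d - c)) /\ (S != 0 -> t <= d0).
Proof.
move=> SB; have D : 0 <= d - c by rewrite subr_ge0.
have D0 : 0 <= d0 - c0 by rewrite subr_ge0.
split.
  apply: (le_trans SB); apply: lerD; rewrite ler_piMr// indicE; by case: (_ \in _).
move=> S0; rewrite leNgt; apply/negP => td.
move: SB; rewrite !indicE !memNset ?mulr0 ?addr0 ?normr_le0 ?(negbTE S0)//= in_itv/=.
  by move=> /andP[_]; rewrite ltNge (ltW td).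
by move=> /andP[_]; rewrite ltNge (le_trans _ (ltW td))// (le_trans dc0).
Qed.

Let dom (S w x : R) : 0 <= w -> 0 <= x -> `|S| <= ((d0 - c0) + (d - c)) -> (S != 0 -> w <= 2 * (1 + d0) * x) ->
  `|S * w| <= B * x.
Proof.
move=> w0 x0 SB Sw; rewrite normrM (ger0_norm w0) /B -mulrA.
have [->|S0] := eqVneq S 0.
  rewrite normr0 mul0r; apply: mulr_ge0; first by rewrite addr_ge0// subr_ge0.
  by rewrite !mulr_ge0// addr_ge0.
by apply: ler_pM => //; exact: Sw.
Qed.

(** The weak gradient identity for [sector_test], as k tends to infinity. The side with [u]
    converges by dominated convergence; the side with [g] only has to be bounded, uniformly in k. *)
Lemma sector_inequality :
  `|\int[lebesgue_rV n.+1]_x (u x * (shell_jump (sqn x) * half_weight Q x))| <=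
  (d - c) * (d0 - c0) * \int[lebesgue_rV n.+1]_x
    (`|g x 0 0| * (r^-1 * half_weight Q x * \1_`[c, d0] (sqn x))).
Proof.
have [lu lg wg] := ug; have [mu _] := lu.
have r2 : (0 : R) < r / 2 by rewrite divr_gt0.
have mQ : measurable Q by exact: measurable_obox.
have mhw := measurable_half_weight mQ.
have msq : measurable_fun setT (@sqn R n.+1) by exact: measurable_sqn.
(* The mass of the cutoff on ]0, r/2[ tends to r/2 > 0, so some index gives a positive one; it must
   be positive to be cancelled at the end. *)
have [k1 k1_gt0] : exists k1, 0 < @plateau_mass R k1 0 (r / 2).
  have := @plateau_mass_cvg R 0 (r / 2) (ltW r2); rewrite subr0 => /cvgr_gt/(_ _ r2)[k1 _ H].
  by exists k1; apply: H => /=.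
pose m := plateau_mass k1 0 (r / 2).
have phiE k x : u x * partial 0 (sector_test c d c0 d0 r dl k1 k) x = m * (u x *
   (shell_step' c d c0 d0 k (sqn x) * (Num.max 0 (2 * x 0 0) *
    box_bump k (fun=> - dl) (fun=> dl) (rV_tail x)))).
  rewrite (sector_test_partial _ _ r_gt0 rc cd dc0 cd0 dlr) -/m.
  by move: m (u x) (shell_step' _ _ _ _ _ _) (Num.max _ _) (box_bump _ _ _ _) => *; ring.
set I := (X in `|X| <= _); set J := Rintegral _ _ _.
have mbb k : measurable_fun setT (fun x => box_bump k (fun=> - dl) (fun=> dl) (rV_tail x : 'rV[R]_n)).
  apply: (measurableT_comp _ (@measurable_rV_tail R n)); apply: continuous_measurable_rV.
  exact: (class_C_cont (box_bump_class_C 0 _ _ _)).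
have mmx : measurable_fun setT (fun x : 'rV[R]_n.+1 => Num.max 0 (2 * x 0 0)).
  apply: measurable_maxr; first exact: measurable_cst.
  by apply: measurable_funM => //; exact: measurable_coord.
have mS k : measurable_fun setT (fun x : 'rV[R]_n.+1 => shell_step' c d c0 d0 k (sqn x)).
  apply: (measurableT_comp _ msq); apply: measurable_funB; apply: measurable_funM => //;
  by apply: continuous_measurable_fun; exact: plateau_cont.
have mJ : measurable_fun setT (fun x : 'rV[R]_n.+1 => shell_jump (sqn x)).
  apply: (measurableT_comp _ msq); apply: measurable_funB; apply: measurable_funM => //;
  by apply: measurable_indic; exact: measurable_itv.
have : \int[lebesgue_rV n.+1]_x (u x * partial 0 (sector_test c d c0 d0 r dl k1 k) x) @[k --> \oo] -->
  \int[lebesgue_rV n.+1]_x (m * (u x * (shell_jump (sqn x) * half_weight Q x))).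
  apply: (@Rintegral_dominated_cvg _ _ _ _ _ _ (fun x => `|m * (u x * (B * \1_(cbox n.+1 (1 + d0)) x))|)).
  - move=> k; under eq_fun do rewrite phiE.
    by do 4 ?[apply: measurable_funM => //].
  - by do 4 ?[apply: measurable_funM => //].
  - move=> x; under eq_fun do rewrite phiE.
    do 2 (apply: cvgMr).
    apply: cvgM.
      apply: cvgB; apply: cvgM; try exact: plateau_mass_cvg; exact: plateau_cvg.
    rewrite /half_weight; apply: cvgMr; exact: box_bump_cvg.
  - under eq_fun do rewrite normrM.
    apply: (@eq_integrable _ _ _ _ _ _ (fun x => `|m|%:E * `|(u x * (B * \1_(cbox n.+1 (1 + d0)) x))%:E|)%E) => //.
    apply: integrableZl => //; apply: integrable_abse.
    apply: (@locally_integrable_mul _ _ _ _ (1 + d0) `|B|) => //.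
    + by apply: measurable_funM => //; apply: measurable_indic; exact: measurable_cbox.
    + move=> x; rewrite indicE; case: (boolP (x \in _)) => [|_]; last by rewrite mulr0 eqxx.
      by rewrite inE => /cboxP.
    + by move=> x; rewrite indicE normrM; case: (_ \in _); rewrite ?normr1 ?normr0 ?mulr1 ?mulr0.
  - move=> k x; rewrite phiE !(normrM m) ler_wpM2l// !(normrM (u x)) ler_wpM2l//.
    have [SB S0] := shell_bound (shell_step'_le k cd cd0 (sqn x)).
    have /andP[b0 b1] := box_bump_itv k (fun=> - dl) (fun=> dl) (rV_tail x).
    have m0 : 0 <= Num.max 0 (2 * x 0 0) by rewrite le_max lexx.
    apply: le_trans (ler_norm _); apply: dom SB _ => //; first exact: mulr_ge0.
    move=> /S0 xd; rewrite indicE mem_set ?mulr1; last exact: sqn_cbox.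
    by apply: le_trans (max_coord_le d0_ge0 xd); rewrite ler_piMr.
move=> lim.
have {}lim := @cvg_norm _ _ _ _ eventually_filter _ _ lim.
have iI : (lebesgue_rV n.+1).-integrable setT (fun x => (u x * (shell_jump (sqn x) * half_weight Q x))%:E).
  have JB x := shell_bound (shell_jump_le x).
  have JM x : shell_jump (sqn x) * half_weight Q x != 0 -> sqn x <= d0.
    by rewrite mulf_eq0 negb_or => /andP[/(JB (sqn x)).2].
  apply: (@locally_integrable_mul _ _ _ _ (1 + d0) B) => //.
  - exact: measurable_funM.
  - by move=> x /JM /(sqn_cbox d0_ge0)/cboxP.
  - move=> x; rewrite -[leRHS]mulr1; apply: dom (JB (sqn x)).1 _ => //; first exact: half_weight_ge0.
    by move=> /(JB (sqn x)).2 xd; rewrite mulr1; exact: half_weight_le.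
move: lim; rewrite RintegralZl// -/I normrM gtr0_norm// => lim.
(* Both sides of the identity carry the height [m] of [half_step]. *)
suff : m * `|I| <= m * ((d - c) * (d0 - c0) * J) by rewrite (ler_pM2l k1_gt0).
apply: (@cvgr_to_le _ _ _ _ _ _ _ lim); apply: nearW => k.
rewrite wg; last exact: sector_test_test.
set w := fun x : 'rV[R]_n.+1 => r^-1 * half_weight Q x * \1_`[c, d0] (sqn x).
have w0 x : 0 <= w x.
  by apply: mulr_ge0; [rewrite mulr_ge0 ?invr_ge0 ?half_weight_ge0// ltW|rewrite indicE].
have mw : measurable_fun setT w.
  apply: measurable_funM; first exact: measurable_funM.
  by apply: (measurableT_comp _ msq); apply: measurable_indic; exact: measurable_itv.
have ig : (lebesgue_rV n.+1).-integrable setT (fun x => (`|g x 0 0| * w x)%:E).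
  apply: (@eq_integrable _ _ _ _ _ measurableT (fun x => `|(g x 0 0 * w x)%:E|%E)) => //.
    by move=> x _; rewrite /= normrM (ger0_norm (w0 x)).
  apply: integrable_abse; apply: (@locally_integrable_mul _ _ _ _ (1 + d0) (r^-1 * (2 * (1 + d0)))) => //.
  - move=> x wx; apply/cboxP; apply: (sqn_cbox d0_ge0); rewrite leNgt; apply/negP => xd.
    move: wx; rewrite /w indicE memNset ?mulr0 ?eqxx//= in_itv/= => /andP[_].
    by rewrite leNgt xd.
  - move=> x; rewrite (ger0_norm (w0 x)) /w indicE; case: (boolP (_ \in _)) => [|_].
      rewrite inE/= in_itv/= => /andP[_ xd]; rewrite mulr1 ler_wpM2l ?invr_ge0 ?(ltW r_gt0)//.
      exact: half_weight_le.
    by rewrite mulr0; rewrite !mulr_ge0 ?invr_ge0 ?(ltW r_gt0) ?addr_ge0.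
rewrite normrN mulrA -RintegralZl//; apply: (le_trans (le_normr_Rintegral _ _)) => //.
  apply: (@class_C_csupp_mul_integrable _ _ _ _ (1 + d0)) => //.
    exact: (class_C_cont (sector_test_class_C _ _ _ _ _ _ _ _ 0)).
  exact: sector_test_csupp.
apply: le_Rintegral => //.
- apply: (@eq_integrable _ _ _ _ _ measurableT (fun x => `|(g x 0 0 * sector_test c d c0 d0 r dl k1 k x)%:E|%E)) => //.
  apply: integrable_abse; apply: (@class_C_csupp_mul_integrable _ _ _ _ (1 + d0)) => //.
    exact: (class_C_cont (sector_test_class_C _ _ _ _ _ _ _ _ 0)).
  exact: sector_test_csupp.
- apply: (@eq_integrable _ _ _ _ _ measurableT (fun x => (m * ((d - c) * (d0 - c0)))%:E * (`|g x 0 0| * w x)%:E)%E) => //.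
  exact: integrableZl.
move=> x _; rewrite normrM mulrCA ler_wpM2l//; apply: (le_trans (sector_test_le _ _ r_gt0 rc cd dc0 cd0 dlr x)).
by rewrite -/m -/Q [in leRHS](mulrC m) -[leLHS]mulrA.
Qed.
End sector_inequality.

(** * Pointwise decay of radial functions *)

Section right_averages.
Context {R : realType}.
Notation leb := (@lebesgue_measure R).

(** The profile is controlled only above T1; extending it by 0 makes the Lebesgue differentiation
    theorem on the whole line applicable. *)
Lemma locally_integrable_ray (F : R -> R) (T1 : R) : measurable_fun setT F ->
  (forall d, leb.-integrable `]T1, d[ (EFin \o F)) ->
  locally_integrable setT (F \_ `]T1, +oo[).
Proof.
move=> mF iF; split; first exact/(measurable_restrictT _ _).1/measurable_funTS.
  exact: openT.
move=> K _ cK; have [M [_ HM]] := compact_bounded cK.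
pose L := `|M| + 1; have ML : M < L by rewrite (le_lt_trans (ler_norm M))// ltrDl.
have /integrableP[_] := iF (L + 1); apply: le_lt_trans.
rewrite integral_mkcond [leRHS]integral_mkcond; apply: ge0_le_integral_nonmeasurable => t.
  by rewrite patchE; case: ifP => // _; rewrite lee_fin.
rewrite !patchE; case: ifPn => [|_]; last by case: ifP => // _; exact: abse_ge0.
rewrite inE => /(HM _ ML) tL; case: ifPn => [|tT].
  rewrite inE/= in_itv/= andbT => tT; rewrite mem_set//= in_itv/= tT/=.
  by rewrite (le_lt_trans (ler_norm t))// (le_lt_trans tL)// ltrDl.
by rewrite normr0; case: ifP => // _; exact: abse_ge0.
Qed.

Lemma right_average_cvg (F : R -> R) (T1 : R) : measurable_fun setT F ->
  (forall d, leb.-integrable `]T1, d[ (EFin \o F)) ->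
  {ae leb, forall a, T1 < a ->
    k.+1%:R * \int[leb]_(t in `]a, (a + k.+1%:R^-1)[) F t @[k --> \oo] --> F a}.
Proof.
move=> mF iF; have locF := locally_integrable_ray mF iF.
apply: (ae_imply (lebesgue_differentiation locF)) => a aF Ta.
pose E x n := `]x, x + n.+1%:R^-1[%classic : set R.
have kp k : (0 : R) < k.+1%:R^-1 by rewrite invr_gt0.
have muE y n : leb (E y n) = (n.+1%:R^-1)%:E.
  rewrite /E lebesgue_measure_itv/= lte_fin ltrDl kp.
  by rewrite -EFinD -addrA subrKC.
have nice_E y : nicely_shrinking y (E y).
  split=> [n|]; first exact: measurable_itv.
  (* The one-sided interval of length 1/(n+1) lies in the ball of that radius, whose measure is
     twice as large: this is the shrinking constant. *)
  exists (2%R, fun n => PosNum (kp n)); split => //= [|n z|n].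
  - exact: cvg_harmonic.
  - rewrite /E/= in_itv/= /ball/= ltr_distlC => /andP[yz ->].
    by rewrite (lt_trans _ yz)// ltrBlDr ltrDl.
  - rewrite (lebesgue_measure_ball _ (ltW _))// muE -EFinM lee_fin.
    by rewrite mulr_natl.
have := nice_lebesgue_differentiation nice_E locF aF.
rewrite patchE mem_set/= ?in_itv/= ?Ta//.
have EE k : (\int[leb]_(y in E a k) ((F \_ `]T1, +oo[) y)%:E = \int[leb]_(y in E a k) (F y)%:E)%E.
  apply: eq_integral => y; rewrite /E inE/= in_itv/= => /andP[ay _].
  by rewrite patchE mem_set//= in_itv/= (lt_trans Ta).
move/fine_cvgP => [_ /=]; apply: cvg_trans; apply: near_eq_cvg; apply: nearW => k /=.
rewrite EE muE inver gt_eqF// fineM//; first by rewrite /= invrK.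
apply: integrable_fin_num; first exact: measurable_itv.
apply: (integrableS _ _ _ (iF (a + k.+1%:R^-1))) => //; first exact: measurable_itv.
by move=> y; rewrite /E/= !in_itv/= => /andP[ay ->]; rewrite (lt_trans Ta).
Qed.

End right_averages.

Section shell_integrals.
Context {R : realType} {n : nat}.
Notation leb := (@lebesgue_measure R).

Lemma Rintegral_half_weight (Q : set 'rV[R]_n) (c : R) (f : R -> R) :
  measurable Q -> (lebesgue_rV n Q < +oo)%E -> (forall y, Q y -> sqn y <= c) ->
  leb.-integrable setT (EFin \o f) -> (forall t, t <= c -> f t = 0) ->
  \int[lebesgue_rV n.+1]_x (f (sqn x) * half_weight Q x) =
  fine (lebesgue_rV n Q) * \int[leb]_t f t.
Proof.
move=> mQ Qoo Qc fi fc.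
have mf : measurable_fun setT (EFin \o f) by exact: measurable_int fi.
have hp x : (((fun x => (f (sqn x) * half_weight Q x)%:E)^\+) x =
    (EFin \o f)^\+ (sqn x) * (half_weight Q x)%:E)%E.
  have h0 := half_weight_ge0 Q x.
  by rewrite !funeposE/= -!EFin_max -EFinM maxr_pMl// mul0r.
have hn x : (((fun x => (f (sqn x) * half_weight Q x)%:E)^\-) x =
    (EFin \o f)^\- (sqn x) * (half_weight Q x)%:E)%E.
  have h0 := half_weight_ge0 Q x.
  by rewrite !funenegE/= -!EFin_max -EFinM maxr_pMl// mul0r mulNr.
have Qf : lebesgue_rV n Q \is a fin_num by rewrite ge0_fin_numE.
rewrite /Rintegral integralE (eq_integral _ _ (fun x _ => hp x)) (eq_integral _ _ (fun x _ => hn x)).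
rewrite (@ge0_integral_half_weight _ n Q c)//; first last.
- by move=> t tc; rewrite !funeposE/= fc// maxxx.
- by apply: measurable_funepos.
rewrite (@ge0_integral_half_weight _ n Q c)//; first last.
- by move=> t tc; rewrite !funenegE/= fc// oppr0 maxxx.
- by apply: measurable_funeneg.
rewrite -fineM//; last exact: integrable_fin_num.
have fp := integrable_pos_fin_num measurableT fi.
have fE : (\int[leb]_t (f t)%:E = \int[leb]_t (EFin \o f)^\+ t - \int[leb]_t (EFin \o f)^\- t)%E.
  exact: integralE.
congr fine; rewrite fE; move: (integral _ _ _) (integral _ _ _) fp => A B fp.
rewrite muleBr//.
exact: fin_num_adde_defr.
Qed.

Variables (u : 'rV[R]_n.+1 -> R) (T1 : R) (F : R -> R).
Hypotheses (T1_gt0 : 0 < T1) (lu : locally_integrable_rV u) (mF : measurable_fun setT F).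
Hypothesis uF : {ae lebesgue_rV n.+1, forall x, T1 < sqn x -> u x = F (sqn x)}.

Lemma shell_mul_integrable (f : 'rV[R]_n.+1 -> R) (Q : set 'rV[R]_n) c d : 0 <= d ->
  locally_integrable_rV f -> measurable Q ->
  (lebesgue_rV n.+1).-integrable setT (fun x => (f x * (\1_`]c, d[ (sqn x) * half_weight Q x))%:E).
Proof.
move=> d0 lf mQ.
have e (x : 'rV[R]_n.+1) : \1_(`]c, d[%classic : set R) (sqn x) != 0 -> sqn x < d.
  rewrite indicE; case: (boolP (_ \in _)) => [|_]; last by rewrite eqxx.
  by rewrite inE/= in_itv/= => /andP[].
apply: (@locally_integrable_mul _ _ _ _ (1 + d) (2 * (1 + d))) => //.
- apply: measurable_funM; last exact: measurable_half_weight.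
  apply: (measurableT_comp _ (@measurable_sqn R n.+1)); apply: measurable_indic.
  exact: measurable_itv.
- move=> x; rewrite mulf_eq0 negb_or => /andP[/e xd _]; apply/cboxP; apply: sqn_cbox => //.
  exact: ltW.
- move=> x; rewrite ger0_norm; last by rewrite mulr_ge0 ?half_weight_ge0// indicE.
  have [->|/e xd] := eqVneq (\1_`]c, d[ (sqn x)) (0 : R); first by rewrite mul0r mulr_ge0// addr_ge0.
  apply: le_trans (half_weight_le d0 Q (ltW xd)).
  by rewrite ler_piMl ?half_weight_ge0// indicE.
Qed.

(** Integrability of the profile is inherited from u: the weighted integral of |u| over the shell is
    the integral of |F| times the measure of [Q], which is positive and finite. *)
Lemma shell_integral (Q : set 'rV[R]_n) c d : measurable Q -> (0 < lebesgue_rV n Q)%E ->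
  (lebesgue_rV n Q < +oo)%E -> (forall y, Q y -> sqn y <= c) -> T1 <= c ->
  leb.-integrable `]c, d[ (EFin \o F) /\
  \int[lebesgue_rV n.+1]_x (u x * (\1_`]c, d[ (sqn x) * half_weight Q x)) =
  fine (lebesgue_rV n Q) * \int[leb]_(t in `]c, d[) F t.
Proof.
move=> mQ Q0 Qoo Qc Tc.
have [dc|cd] := leP d c.
  rewrite set_itv_ge -?leNgt ?bnd_simp//.
  rewrite /Rintegral integral_set0 mulr0 integral0_eq//; first by split => //; exact: integrable_set0.
  by move=> x _; rewrite indicE memNset ?mul0r ?mulr0//.
have d0 : 0 <= d by rewrite (le_trans _ (ltW cd))// (le_trans (ltW T1_gt0)).
pose f (t : R) := \1_(`]c, d[%classic : set R) t * F t.
have mf : measurable_fun setT f.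
  by apply: measurable_funM => //; apply: measurable_indic; exact: measurable_itv.
have fc t : t <= c -> f t = 0.
  by move=> tc; rewrite /f indicE memNset ?mul0r//= in_itv/= ltNge tc.
have uE : {ae lebesgue_rV n.+1, forall x,
    u x * (\1_`]c, d[ (sqn x) * half_weight Q x) = f (sqn x) * half_weight Q x}.
  apply: filterS uF => x ux; rewrite /f mulrCA mulrA.
  have [xc|xc] := leP (sqn x) c; first by rewrite indicE memNset ?mul0r//= in_itv/= ltNge xc.
  by rewrite ux// (le_lt_trans Tc).
have iu := shell_mul_integrable c d0 lu mQ.
have fi : leb.-integrable setT (EFin \o f).
  apply/integrableP; split; first exact/measurable_EFinP.
  have /integrableP[mu_ uoo] := iu.
  rewrite -(@lte_pmul2l _ (lebesgue_rV n Q)) ?ge0_fin_numE//.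
  have := @ge0_integral_half_weight R n Q c (fun t => `|(f t)%:E|%E) mQ Qc.
  move=> <- //; first last.
  - by move=> t tc; rewrite fc// abse0.
  - by apply: measurableT_comp => //; exact/measurable_EFinP.
  rewrite gt0_muley//; apply: le_lt_trans uoo; rewrite le_eqVlt; apply/orP; left; apply/eqP.
  apply: ae_eq_integral => //.
  - apply: emeasurable_funM.
      apply: (measurableT_comp (f := fun t => `|(f t)%:E|%E) _ (@measurable_sqn R n.+1)).
      by apply: measurableT_comp => //; exact/measurable_EFinP.
    by apply/measurable_EFinP; exact: measurable_half_weight.
  - exact: measurableT_comp.
  - apply: filterS uE => x ux _; rewrite ux [in RHS]EFinM abseM.
    by rewrite [X in _ = (_ * X)%E]gee0_abs// lee_fin half_weight_ge0.
have fE : (EFin \o f) = ((EFin \o F) \_ `]c, d[)%E.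
  apply/funext => t; rewrite patchE /f/= indicE; case: ifP => _; by rewrite ?mul1r ?mul0r.
split.
  have mcd : measurable (`]c, d[%classic : set R) by exact: measurable_itv.
  by have := (integrable_mkcond (mu := leb) (EFin \o F) mcd).2; apply; rewrite -fE.
transitivity (\int[lebesgue_rV n.+1]_x (f (sqn x) * half_weight Q x)).
  congr fine; apply: ae_eq_integral => //.
  - exact: measurable_int iu.
  - apply/measurable_EFinP; apply: measurable_funM; last exact: measurable_half_weight.
    exact: (measurableT_comp mf (@measurable_sqn R n.+1)).
  - by apply: filterS uE => x ux _; rewrite ux.
rewrite (@Rintegral_half_weight Q c)//; congr (_ * _).
by rewrite /Rintegral [in RHS]integral_mkcond -fE.
Qed.
End shell_integrals.
Lemma obox_sqn_le (R : realType) n (e : R) (y : 'rV[R]_n) :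
  obox (fun=> - e) (fun=> e) y -> sqn y <= n%:R * e ^+ 2.
Proof.
move=> yQ; rewrite /sqn (le_trans (ler_sum _ (G := fun=> e ^+ 2) _))//.
  move=> i _; have /andP[y1 y2] := yQ i; nra.
by rewrite sumr_const card_ord mulr_natl.
Qed.

Lemma cross_average_le (R : realFieldType) (D m A1 A2 J : R) : 0 < D -> 0 < m ->
  `|D * A1 - m^-1 * A2| <= m^-1 * D * J -> `|m * A1 - D^-1 * A2| <= J.
Proof.
move=> D0 m0; have -> : D * A1 - m^-1 * A2 = (m^-1 * D) * (m * A1 - D^-1 * A2).
  by field; rewrite !gt_eqF.
have mD : 0 < m^-1 * D by rewrite mulr_gt0 ?invr_gt0.
by rewrite normrM (gtr0_norm mD) ler_pM2l.
Qed.

Lemma small_cube_sqn_le (R : realType) n (a : R) (y : 'rV[R]_n) : 0 < a ->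
  obox (fun=> - (Num.sqrt a / n.+1%:R)) (fun=> Num.sqrt a / n.+1%:R) y -> sqn y <= a.
Proof.
move=> a0 /obox_sqn_le yQ; apply: (le_trans yQ).
rewrite expr_div_n sqr_sqrtr ?(ltW a0)// mulrCA -[leRHS]mulr1 ler_wpM2l ?(ltW a0)//.
rewrite ler_pdivrMr ?exprn_gt0// mul1r -natrX ler_nat expnS expn1 (leq_trans (leqnSn n))//.
exact: leq_pmulr.
Qed.

Section pointwise_bound.
Context {R : realType} {n : nat}.
Notation leb := (@lebesgue_measure R).

(** The exceptional null set consists of non-Lebesgue points of the profile and is fixed before the
    shell and the cube, so these may later be chosen in terms of |x|. *)
Lemma radial_pointwise (u : 'rV[R]_n.+1 -> R) g (T1 : R) : 0 < T1 -> weak_gradient u g -> radial u ->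
  {ae lebesgue_rV n.+1, forall x : 'rV[R]_n.+1, T1 < sqn x ->
    forall r dl c0 d0 : R, 0 < r -> r ^+ 2 = sqn x -> r ^+ 2 < c0 -> c0 < d0 -> 0 < dl ->
    (forall y : 'rV[R]_n, obox (fun=> (- dl)%R) (fun=> dl) y -> sqn y <= r ^+ 2 / 2) ->
    fine (lebesgue_rV n (obox (fun=> (- dl)%R) (fun=> dl))) * `|u x| <=
    (d0 - c0)^-1 * \int[lebesgue_rV n.+1]_z
       (`|u z| * (\1_`]c0, d0[ (sqn z) * half_weight (obox (fun=> (- dl)%R) (fun=> dl)) z)) +
    \int[lebesgue_rV n.+1]_z (`|g z 0 0| *
      (r^-1 * half_weight (obox (fun=> (- dl)%R) (fun=> dl)) z * \1_`[r ^+ 2, d0] (sqn z)))}.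
Proof.
move=> T1_gt0 ug ru; have [lu lg _] := ug; have [mu _] := lu.
have [F mF uF] := radial_profile T1_gt0 mu ru.
have Qfin (dl : R) : (lebesgue_rV n (obox (fun=> (- dl)%R) (fun=> dl)) < +oo)%E.
  rewrite (le_lt_trans _ (cbox_fin n dl))//; apply: le_measure; rewrite ?inE.
  - exact: measurable_obox.
  - exact: measurable_cbox.
  - by move=> y yQ i; have /andP[/ltW y1 /ltW y2] := yQ i; rewrite /= in_itv/= y1.
have Qpos (dl : R) : 0 < dl -> (0 < lebesgue_rV n (obox (fun=> (- dl)%R) (fun=> dl)))%E.
  by move=> dl0; apply: lebesgue_obox_gt0 => i; rewrite gt0_cp.
(* Any cube on which |y|^2 <= T1 serves here; the size of its measure is irrelevant to
   integrability. *)
have iF d : leb.-integrable `]T1, d[ (EFin \o F).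
  have e0 : 0 < Num.sqrt T1 / n.+1%:R by rewrite divr_gt0// sqrtr_gt0.
  have [|||||//] := @shell_integral R n u T1 F T1_gt0 lu mF uF
    (obox (fun=> - (Num.sqrt T1 / n.+1%:R)) (fun=> Num.sqrt T1 / n.+1%:R)) T1 d => //.
  - exact: measurable_obox.
  - exact: Qpos.
  - by move=> y; exact: small_cube_sqn_le.
have := ae_sqn n.+1 (right_average_cvg mF iF).
have uF0 := uF; apply: filterS2 uF => x uF' Fx Tx r dl c0 d0 r0 rx rc cd dl0 Qr.
have mQ : measurable (obox (fun=> (- dl)%R) (fun=> dl) : set 'rV[R]_n) by exact: measurable_obox.
have Q0 := Qpos dl dl0; have Qoo := Qfin dl.
have {}Fx := Fx (lt_trans T1_gt0 Tx) Tx.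
rewrite uF'//; rewrite -rx in Tx Fx *; set Q := obox _ _ in mQ Q0 Qoo *; set J := (X in _ <= _ + X).
pose A c d := \int[lebesgue_rV n.+1]_z (u z * (\1_(`]c, d[%classic : set R) (sqn z) * half_weight Q z)).
have iA c d : 0 <= d -> (lebesgue_rV n.+1).-integrable setT
    (fun z => (u z * (\1_(`]c, d[%classic : set R) (sqn z) * half_weight Q z))%:E).
  by move=> d_ge0; exact: shell_mul_integrable.
have a0 : 0 <= r ^+ 2 by rewrite exprn_ge0// ltW.
have c00 : 0 <= c0 by rewrite (le_trans a0)// ltW.
have d00 : 0 <= d0 by rewrite (le_trans c00)// ltW.
have dc : 0 < d0 - c0 by rewrite subr_gt0.
have Qa y : Q y -> sqn y <= r ^+ 2.
  by move=> /Qr yr; rewrite (le_trans yr)//; nra.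
(* [sector_inequality] with first interval ]r^2, r^2 + 1/(k+1)[, divided by the two lengths. Up to
   the mass of the cube, the first term becomes a right average of the profile at r^2. *)
have step k : r ^+ 2 + k.+1%:R^-1 <= c0 ->
    `|k.+1%:R * A (r ^+ 2) (r ^+ 2 + k.+1%:R^-1) - (d0 - c0)^-1 * A c0 d0| <= J.
  move=> kc; have k0 : (0 : R) < k.+1%:R^-1 by rewrite invr_gt0.
  have ad : r ^+ 2 < r ^+ 2 + k.+1%:R^-1 by rewrite ltrDl.
  have := sector_inequality r0 (lexx _) ad kc cd Qr ug; rewrite -/Q -/J [_ + _ - _]addrAC subrr add0r.
  have -> : \int[lebesgue_rV n.+1]_z
      (u z * (shell_jump (r ^+ 2) (r ^+ 2 + k.+1%:R^-1) c0 d0 (sqn z) * half_weight Q z)) =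
      (d0 - c0) * A (r ^+ 2) (r ^+ 2 + k.+1%:R^-1) - k.+1%:R^-1 * A c0 d0.
    have d1 : 0 <= r ^+ 2 + k.+1%:R^-1 by rewrite addr_ge0// ltW.
    rewrite /A -!RintegralZl//; try exact: iA.
    rewrite -RintegralB//; first last.
    - apply: (@eq_integrable _ _ _ _ _ measurableT (fun z => k.+1%:R^-1%:E *
        (u z * (\1_(`]c0, d0[%classic : set R) (sqn z) * half_weight Q z))%:E)%E) => //.
      by apply: integrableZl => //; exact: iA.
    - apply: (@eq_integrable _ _ _ _ _ measurableT (fun z => (d0 - c0)%:E *
        (u z * (\1_(`]r ^+ 2, (r ^+ 2 + k.+1%:R^-1)[%classic : set R) (sqn z) * half_weight Q z))%:E)%E) => //.
      by apply: integrableZl => //; exact: iA.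
    apply: eq_Rintegral => z _; rewrite /shell_jump [_ + _ - _]addrAC subrr add0r.
    by move: (\1__ _) (\1__ _) (half_weight _ _) (u z) => *; ring.
  exact: cross_average_le.
have lim : k.+1%:R * A (r ^+ 2) (r ^+ 2 + k.+1%:R^-1) - (d0 - c0)^-1 * A c0 d0 @[k --> \oo] -->
    fine (lebesgue_rV n Q) * F (r ^+ 2) - (d0 - c0)^-1 * A c0 d0.
  apply: cvgB; last exact: cvg_cst.
  have AE k : k.+1%:R * A (r ^+ 2) (r ^+ 2 + k.+1%:R^-1) = fine (lebesgue_rV n Q) *
      (k.+1%:R * \int[leb]_(t in `]r ^+ 2, (r ^+ 2 + k.+1%:R^-1)[) F t).
    rewrite mulrCA; congr (_ * _).
    exact: (shell_integral T1_gt0 lu mF uF0 _ mQ Q0 Qoo Qa (ltW Tx)).2.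
  under eq_fun do rewrite AE.
  exact: cvgMr.
have {}lim := @cvg_norm _ _ _ _ eventually_filter _ _ lim.
have lJ : `|fine (lebesgue_rV n Q) * F (r ^+ 2) - (d0 - c0)^-1 * A c0 d0| <= J.
  apply: (@cvgr_to_le _ _ _ _ _ _ _ lim).
  have c0r : 0 < c0 - r ^+ 2 by rewrite subr_gt0.
  have [K _ HK] := near_infty_natSinv_lt (PosNum c0r); exists K => // k /HK /= Kk; apply: step.
  by rewrite -lerBrDl ltW.
have lA : `|A c0 d0| <= \int[lebesgue_rV n.+1]_z
    (`|u z| * (\1_(`]c0, d0[%classic : set R) (sqn z) * half_weight Q z)).
  apply: (le_trans (le_normr_Rintegral measurableT (iA _ _ d00))).
  rewrite le_eqVlt; apply/orP; left; apply/eqP; apply: eq_Rintegral => z _.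
  rewrite normrM [X in _ * X]ger0_norm// mulr_ge0 ?half_weight_ge0// indicE//.
rewrite -[fine _ in leLHS]ger0_norm ?fine_ge0// -normrM.
rewrite -(subrK ((d0 - c0)^-1 * A c0 d0) (_ * F _)) addrC (le_trans (ler_normD _ _))//.
apply: lerD => //; rewrite normrM gtr0_norm ?invr_gt0// ler_wpM2l// invr_ge0 ltW//.
Qed.
End pointwise_bound.

(** * Young's inequality and the choice of scales in the decay estimate *)

Section powR_facts.
Context {R : realType}.
Implicit Types x y s t p z : R.

Lemma powR_mul x s t : 0 < x -> x `^ s * x `^ t = x `^ (s + t).
Proof. by move=> x0; rewrite powRD// (gt_eqF x0) implybT. Qed.

(** Where |z| > tau, the factor (|z|/tau)^(p-1) exceeds 1. The free parameter tau lets the pointwise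
    bound do the work of Hölder's inequality. *)
Lemma young_le (tau z p : R) : 0 < tau -> 1 < p -> `|z| <= tau + tau `^ (1 - p) * `|z| `^ p.
Proof.
move=> tau0 p1; have [zt|tz] := leP `|z| tau.
  by rewrite (le_trans zt)// lerDl mulr_ge0// powR_ge0.
rewrite (@le_trans _ _ (tau `^ (1 - p) * `|z| `^ p))//; last by rewrite lerDr ltW.
have z0 : 0 < `|z| by exact: lt_trans tz.
have -> : `|z| `^ p = `|z| * `|z| `^ (p - 1).
  by rewrite -[X in X * _]powRr1 ?(ltW z0)// powR_mul//; congr powR; ring.
rewrite mulrCA ler_peMr ?(ltW z0)//.
have -> : tau `^ (1 - p) = (tau `^ (p - 1))^-1 by rewrite -powRN; congr powR; ring.
rewrite ler_pdivlMl ?powR_gt0// mulr1 ge0_ler_powR// ?nnegrE ?subr_ge0// ltW//.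
Qed.

Lemma powR_doubling (x r s : R) : 0 < r -> r <= x -> x <= 2 * r -> x `^ s <= 2 `^ `|s| * r `^ s.
Proof.
move=> r0 rx xr; have x0 : 0 < x by exact: lt_le_trans rx.
have r2 : 0 <= 2 * r by rewrite mulr_ge0// ltW.
have [s0|s0] := leP 0 s.
  rewrite ger0_norm//; have -> : (2 : R) `^ s * r `^ s = (2 * r) `^ s by rewrite powRM// ltW.
  by apply: ge0_ler_powR => //; rewrite nnegrE// ltW.
rewrite ltr0_norm//; have sN : 0 <= - s by rewrite oppr_ge0 ltW.
have -> : x `^ s = (x `^ (- s))^-1 by rewrite -powRN opprK.
have -> : r `^ s = (r `^ (- s))^-1 by rewrite -powRN opprK.
apply: (@le_trans _ _ (r `^ (- s))^-1).
  by rewrite lef_pV2 ?posrE ?powR_gt0//; apply: ge0_ler_powR => //; rewrite nnegrE ltW.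
rewrite ler_peMl ?invr_ge0 ?powR_ge0// -[leLHS](powRr0 2) ler_powR// ler1n//.
Qed.

End powR_facts.

Lemma Rintegral_le_affine d (T : measurableType d) (R : realType) (mu : {measure set T -> \bar R})
    (f w h : T -> R) (tau B m D : R) :
  (forall x, 0 <= f x) -> measurable_fun setT w -> (forall x, 0 <= w x) ->
  measurable_fun setT h -> (forall x, 0 <= h x) -> 0 <= tau -> 0 <= B ->
  (forall x, f x <= tau * w x + B * h x) ->
  (\int[mu]_x (w x)%:E <= m%:E)%E -> (\int[mu]_x (h x)%:E <= D%:E)%E ->
  \int[mu]_x f x <= tau * m + B * D.
Proof.
move=> f0 mw w0 mh h0 tau0 B0 fwh wm hD.
suff : (\int[mu]_x (f x)%:E <= (tau * m + B * D)%:E)%E.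
  have : (0 <= \int[mu]_x (f x)%:E)%E by apply: integral_ge0 => x _; rewrite lee_fin.
  by rewrite /Rintegral; case: (integral _ _ _).
apply: (@le_trans _ _ (\int[mu]_x (tau%:E * (w x)%:E + B%:E * (h x)%:E))%E).
  by apply: ge0_le_integral_nonmeasurable => x; rewrite ?lee_fin// -?EFinM -?EFinD ?lee_fin.
rewrite ge0_integralD//; first last.
- by apply: measurable_funeM; exact/measurable_EFinP.
- by move=> x _; rewrite -EFinM lee_fin mulr_ge0.
- by apply: measurable_funeM; exact/measurable_EFinP.
- by move=> x _; rewrite -EFinM lee_fin mulr_ge0.
rewrite ge0_integralZl_EFin//; first last.
- exact/measurable_EFinP.
- by move=> x _; rewrite lee_fin.
rewrite ge0_integralZl_EFin//; first last.
- exact/measurable_EFinP.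
- by move=> x _; rewrite lee_fin.
rewrite EFinD !EFinM; apply: leeD; apply: lee_wpmul2l; by rewrite ?lee_fin.
Qed.

Lemma affine_weight_le (R : realDomainType) (v w tau T P a B E : R) : 0 <= a -> 1 <= B * E ->
  v <= tau + T * P -> 0 <= w -> w <= a -> 0 <= T * P -> v * w <= tau * w + T * (a * B) * (E * P).
Proof.
move=> a0 BE vT w0 wa TP; apply: (le_trans (ler_wpM2r w0 vT)); rewrite mulrDl lerD2l.
apply: (le_trans (ler_wpM2l TP wa)).
rewrite [leRHS](_ : _ = T * P * a * (B * E)); last by ring.
by rewrite ler_peMr// mulr_ge0.
Qed.

Section radial_decay.
Context {R : realType}.
Notation leb := (@lebesgue_measure R).

(* The rate at which the error terms of [radial_decay] balance. *)
Definition decay_exponent (n : nat) (p gamma : R) : R := (n%:R - gamma * (p - 1) / p) / p.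

(** The side r/(n+1) is small enough because n <= (n+1)^2, and proportional to r, so that the mass
    of the cube scales like r^n. *)
Lemma sector_mass n (r : R) : 0 < r -> let dl := r / (2 * n.+1%:R) in
  [/\ 0 < dl, forall y : 'rV[R]_n, obox (fun=> (- dl)%R) (fun=> dl) y -> sqn y <= r ^+ 2 / 2 &
   lebesgue_rV n (obox (fun=> (- dl)%R) (fun=> dl)) = ((r ^+ n / n.+1%:R ^+ n)%:E)%E].
Proof.
move=> r0 dl; have n0 : (0 : R) < n.+1%:R by [].
have dl0 : 0 < dl by rewrite divr_gt0// mulr_gt0.
split=> //.
  move=> y /obox_sqn_le yQ; apply: (le_trans yQ).
  rewrite /dl expr_div_n mulrCA ler_wpM2l ?exprn_ge0 ?(ltW r0)//.
  rewrite ler_pdivrMr ?exprn_gt0 ?mulr_gt0// ler_pdivlMl// exprMn.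
  have nn : (n%:R : R) <= n.+1%:R by rewrite ler_nat.
  have n1 : (1 : R) <= n.+1%:R by rewrite ler1n.
  by move: (n%:R) (n.+1%:R : R) nn n1 => a b; nra.
transitivity ((\prod_(i < n) (dl - - dl))%:E : \bar R).
  by apply: (@lebesgue_obox R n (fun=> - dl) (fun=> dl)) => i; rewrite ge0_cp// ltW.
rewrite prodr_const card_ord -expr_div_n opprK; congr (_ ^+ _)%:E.
by rewrite /dl; field; rewrite lt0r_neq0// addrC natr1.
Qed.

Lemma half_weight_mass n (Q : set 'rV[R]_n) (a m : R) (J : set R) : measurable Q -> lebesgue_rV n Q = m%:E ->
  (forall y, Q y -> sqn y <= a) -> measurable J -> (forall t, J t -> a < t) ->
  (\int[lebesgue_rV n.+1]_z (\1_J (sqn z) * half_weight Q z)%:E = m%:E * leb J)%E.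
Proof.
move=> mQ Qm Qa mJ Ja; under eq_integral do rewrite EFinM.
have := @ge0_integral_half_weight R n Q a (fun t => (\1_J t)%:E) mQ Qa.
move=> -> //; first by rewrite Qm integral_indicT.
- by apply/measurable_EFinP; exact: measurable_indic.
- by move=> t ta; rewrite indicE memNset// => /Ja; rewrite ltNge ta.
Qed.

Variables (n : nat) (p gamma : R).
Hypotheses (p1 : 1 < p) (gamma_p : gamma <= p).
Let nu := decay_exponent n p gamma.

Lemma decay_exponentE : nu * p = n%:R - gamma + gamma / p.
Proof. by rewrite /nu /decay_exponent; field; rewrite gt_eqF// (lt_trans _ p1). Qed.

(** The three powers balance because nu p = n - gamma + gamma/p. With tau = r^-nu for the average
    and tau' = r^(-nu-gamma/p) for the gradient, every error term has size r^-nu r^n, that is, the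
    wanted bound times the mass of the cube. *)
Lemma decay_identities (r : R) : 0 < r ->
  [/\ (r `^ (1 + gamma / p))^-1 * ((r `^ (- nu)) `^ (1 - p) * (r * r `^ gamma)) = r `^ (- nu) * r ^+ n,
   (r `^ (- nu - gamma / p)) `^ (1 - p) = r `^ (- nu) * r ^+ n &
   r `^ (- nu - gamma / p) * (r^-1 * r `^ (1 + gamma / p)) = r `^ (- nu)].
Proof.
move=> r0; have E := decay_exponentE; rewrite -powR_mulrn ?(ltW r0)// -!powRrM -powRN.
have r1 : r = r `^ 1 by rewrite powRr1// ltW.
split.
- rewrite [X in X * r `^ gamma]r1 !powR_mul//; congr powR.
  by rewrite mulrBr mulr1 mulNr E; ring.
- rewrite powR_mul//; congr powR; rewrite mulrBr mulr1 mulrBl mulNr E.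
  by field; rewrite gt_eqF// (lt_trans _ p1).
- by rewrite -(powR_inv1 (ltW r0)) !powR_mul//; congr powR; ring.
Qed.

(** The 2 collects the two terms linear in tau and tau'; (n+1)^n is r^n over the mass of the cube; 8
    2^|gamma| D comes from the average of |u|^p and 4 from the gradient. *)
Definition decay_constant (D : R) : R := 2 + n.+1%:R ^+ n * (8 * 2 `^ `|gamma| * D + 4).

Lemma radial_decay (D R2 : R) (u : 'rV[R]_n.+1 -> R) g : 0 < R2 -> 0 <= D ->
  weak_gradient u g -> radial u ->
  (\int[lebesgue_rV n.+1]_z (`|g z 0 0| `^ p)%:E <= 1%:E)%E ->
  (\int[lebesgue_rV n.+1]_z
     (\1_[set z : 'rV[R]_n.+1 | (R2 < enorm z)%R] z * (enorm z `^ (- gamma) * `|u z| `^ p))%:E <= D%:E)%E ->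
  {ae lebesgue_rV n.+1, forall x : 'rV[R]_n.+1, Num.max 1 R2 < enorm x ->
    `|u x| <= decay_constant D * enorm x `^ (- nu)}.
Proof.
move=> R20 D0 ug ru gp up; have [[mu _] lg _] := ug; have [mg _] := lg 0.
have T0 : 0 < Num.max 1 R2 ^+ 2 by rewrite exprn_gt0// lt_max ltr01.
have := radial_pointwise T0 ug ru; apply: filterS => x xP rx.
set r := enorm x in rx *.
have [r1 rR2] : 1 < r /\ R2 < r by move: rx; rewrite gt_max => /andP[].
have r0 : 0 < r by rewrite (lt_trans _ r1).
have r2E : r ^+ 2 = sqn x by rewrite /r enormE sqr_sqrtr// sqn_ge0.
clearbody r; have [dl0 Qr Qm] := sector_mass n r0.
set dl := r / (2 * n.+1%:R) in dl0 Qr Qm *; set Q := obox _ _ in Qr Qm.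
(* Thickness of the shell in t. As gamma <= p and r > 1, it is at most r^2, so points of the shell
   satisfy r <= |z| <= 2r. *)
pose l := r `^ (1 + gamma / p).
have l0 : 0 < l by rewrite powR_gt0.
have lr : l <= r ^+ 2.
  rewrite -powR_mulrn ?(ltW r0)// ler_powR ?(ltW r1)// -[2%:R]/(1 + 1 : R) lerD2l.
  by rewrite ler_pdivrMr ?mul1r// (lt_trans _ p1).
have Tx : Num.max 1 R2 ^+ 2 < sqn x.
  by rewrite -r2E ltr_pXn2r// ?nnegrE ?(ltW r0)// le_max ler01.
(* The lower half of the shell is left to the interval shrinking to r^2; the upper half carries the
   average of u. *)
have c0 : r ^+ 2 < r ^+ 2 + l / 2 by rewrite ltrDl divr_gt0.
have d0 : r ^+ 2 + l / 2 < r ^+ 2 + l by rewrite ltrD2l ltr_pdivrMr// mulr_natr mulr2n ltrDl.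
have := xP Tx r dl _ _ r0 r2E c0 d0 dl0 Qr; rewrite -/Q Qm [fine _]/=.
have -> : (r ^+ 2 + l - (r ^+ 2 + l / 2)) = l / 2 by field.
set I1 := Rintegral _ _ _; set I2 := Rintegral _ _ _.
pose tau := r `^ (- nu); pose tau' := r `^ (- nu - gamma / p).
have tau0 : 0 < tau by rewrite powR_gt0.
have tau'0 : 0 < tau' by rewrite powR_gt0.
pose m := r ^+ n / n.+1%:R ^+ n.
have mQ : measurable Q by exact: measurable_obox.
have msq : measurable_fun setT (@sqn R n.+1) by exact: measurable_sqn.
have men := @measurable_enorm R n.+1.
have hw2 (z : 'rV[R]_n.+1) : sqn z <= r ^+ 2 + l -> half_weight Q z <= 4 * r.
  move=> zd; rewrite /half_weight; have : z 0 0 ^+ 2 <= (2 * r) ^+ 2.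
    by rewrite (le_trans (sqn_coord z 0))// (le_trans zd)// exprMn; move: (r ^+ 2) lr (ltW l0) => *; lra.
  rewrite -[X in X <= _]real_normK ?num_real// ler_pXn2r ?nnegrE ?mulr_ge0 ?(ltW r0)// => z2.
  have m4 : Num.max 0 (2 * z 0 0) <= 4 * r.
    rewrite ge_max mulr_ge0 ?(ltW r0)//=; have := le_trans (ler_norm _) z2.
    by move: (z 0 0) => *; lra.
  by apply: le_trans m4; rewrite ler_piMr// ?le_max ?lexx// indicE.
have I1P : I1 <= tau * (m * (l / 2)) + tau `^ (1 - p) * (4 * r * (2 `^ `|gamma| * r `^ gamma)) * D.
  pose B := (2 `^ `|gamma| * r `^ gamma).
  have B0 : 0 <= B by rewrite mulr_ge0// powR_ge0.
  pose S := [set z : 'rV[R]_n.+1 | R2 < enorm z].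
  apply: (@Rintegral_le_affine _ _ _ _ _
    (fun z => \1_`]r ^+ 2 + l / 2, r ^+ 2 + l[ (sqn z) * half_weight Q z)
    (fun z => \1_S z * (enorm z `^ (- gamma) * `|u z| `^ p))) => //.
  - by move=> z; rewrite mulr_ge0// mulr_ge0// half_weight_ge0.
  - apply: measurable_funM; last exact: measurable_half_weight.
    by apply: (measurableT_comp _ msq); apply: measurable_indic; exact: measurable_itv.
  - by move=> z; rewrite mulr_ge0// half_weight_ge0.
  - apply: measurable_funM.
      apply: measurable_indic; rewrite (_ : S = @enorm R n.+1 @^-1` [set` `]R2, +oo[]).
        exact: measurable_preimage_itv.
      by apply/funext => z; rewrite /S/= in_itv/= andbT.
    apply: measurable_funM; first exact: (measurableT_comp (measurable_powR _) men).
    apply: (measurableT_comp (measurable_powR _)); exact: measurableT_comp.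
  - by move=> z; rewrite !mulr_ge0 ?powR_ge0.
  - exact: ltW.
  - by rewrite !mulr_ge0 ?powR_ge0// ltW.
  - move=> z; rewrite [\1_`]_, _[ _]indicE; case: (boolP (_ \in _)) => [|_]; last first.
      by rewrite !(mul0r, mulr0) add0r !mulr_ge0 ?powR_ge0 ?(ltW r0).
    rewrite inE/= in_itv/= => /andP[z1 z2].
    have rz : r <= enorm z.
      rewrite enormE -(ler_pXn2r (n := 2)) ?nnegrE ?(ltW r0) ?sqrtr_ge0// sqr_sqrtr ?sqn_ge0//.
      by rewrite (le_trans _ (ltW z1))// lerDl ltW// divr_gt0.
    have zr : enorm z <= 2 * r.
      rewrite enormE -(ler_pXn2r (n := 2)) ?nnegrE ?mulr_ge0 ?(ltW r0) ?sqrtr_ge0// sqr_sqrtr ?sqn_ge0//.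
      by rewrite (le_trans (ltW z2))// exprMn; move: (r ^+ 2) lr (ltW l0) => *; lra.
    have z0 : 0 < enorm z by exact: lt_le_trans rz.
    rewrite indicE mem_set; last by rewrite /S/= (lt_le_trans rR2).
    rewrite !mul1r.
    have := hw2 z (ltW z2); have := half_weight_ge0 Q z; have := young_le (u z) tau0 p1.
    (* On the shell |z| and r are comparable, whatever the sign of gamma; inserting B |z|^-gamma >=
       1 produces the weighted integral bounded by [D]. *)
    have : 1 <= B * enorm z `^ (- gamma).
      rewrite powRN ler_pdivlMr ?powR_gt0// mul1r; exact: powR_doubling.
    move: (mulr_ge0 (powR_ge0 tau (1 - p)) (powR_ge0 `|u z| p)).
    move: (half_weight Q z) (`|u z| `^ p) (`|u z|) (tau `^ (1 - p)) (enorm z `^ _) => w P v T E TP Bz vP w0 wr.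
    by apply: affine_weight_le => //; rewrite mulr_ge0// ltW.
  - rewrite (@half_weight_mass _ _ (r ^+ 2 / 2) m)//; last 1 first.
    + move=> t /=; rewrite in_itv/= => /andP[+ _]; apply: le_lt_trans.
      by rewrite (@le_trans _ _ (r ^+ 2))//; [move: (exprn_ge0 2 (ltW r0)) => *; lra|exact: ltW].
    + rewrite lebesgue_measure_itv/= lte_fin d0 -EFinD -EFinM lee_fin le_eqVlt; apply/orP; left; apply/eqP; congr (_ * _).
      by field.
have I2P : I2 <= tau' * (r^-1 * (m * l)) + tau' `^ (1 - p) * 4 * 1.
  apply: (@Rintegral_le_affine _ _ _ _ _
    (fun z => r^-1 * half_weight Q z * \1_`[r ^+ 2, r ^+ 2 + l] (sqn z))
    (fun z => `|g z 0 0| `^ p)) => //.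
  - by move=> z; rewrite mulr_ge0// mulr_ge0// mulr_ge0 ?half_weight_ge0// invr_ge0 ltW.
  - apply: measurable_funM; first by apply: measurable_funM => //; exact: measurable_half_weight.
    by apply: (measurableT_comp _ msq); apply: measurable_indic; exact: measurable_itv.
  - by move=> z; rewrite mulr_ge0// mulr_ge0 ?half_weight_ge0// invr_ge0 ltW.
  - apply: (measurableT_comp (measurable_powR _)); exact: measurableT_comp.
  - exact: ltW.
  - by rewrite mulr_ge0// powR_ge0.
  - move=> z; rewrite [\1_`[_, _] _]indicE; case: (boolP (_ \in _)) => [|_]; last first.
      by rewrite !mulr0 add0r !mulr_ge0 ?powR_ge0.
    rewrite inE/= in_itv/= mulr1 => /andP[_ z2].
    (* The gradient integral carries no potential, and r^-1 times the weight is at most r^-1 4r =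
       4. *)
    have := affine_weight_le (B := 1) (E := 1) (ler0n R 4) _ (young_le (g z 0 0) tau'0 p1).
    rewrite !(mulr1, mul1r); apply => //.
    + by rewrite mulr_ge0 ?half_weight_ge0// invr_ge0 ltW.
    + by rewrite ler_pdivrMl//= mulrC hw2.
    + by rewrite mulr_ge0 ?powR_ge0.
  - rewrite (eq_integral (fun z => (r^-1)%:E * (\1_`[r ^+ 2, r ^+ 2 + l] (sqn z) * half_weight Q z)%:E)%E); last first.
      by move=> z _; rewrite -EFinM -mulrA [_ * half_weight _ _]mulrC.
    rewrite ge0_integralZl_EFin//; first last.
    + by rewrite invr_ge0 ltW.
    + apply/measurable_EFinP; apply: measurable_funM; last exact: measurable_half_weight.
      by apply: (measurableT_comp _ msq); apply: measurable_indic; exact: measurable_itv.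
    + by move=> z _; rewrite lee_fin mulr_ge0// half_weight_ge0.
    rewrite (@half_weight_mass _ _ (r ^+ 2 / 2) m)//; last 1 first.
    + move=> t /=; rewrite in_itv/= => /andP[+ _]; apply: lt_le_trans.
      by move: (exprn_gt0 2 r0) => *; lra.
    by rewrite lebesgue_measure_itv/= lte_fin ltrDl l0 -EFinD -!EFinM lee_fin [_ + l - _]addrAC subrr add0r.
have [id1 id2 id3] := decay_identities r0.
rewrite -/m -/tau -/tau' -/l in id1 id2 id3 * => uI.
rewrite /decay_constant -/tau.
have n0 : (0 : R) < n.+1%:R ^+ n by rewrite exprn_gt0.
have rn0 : 0 < r ^+ n by rewrite exprn_gt0.
have m0 : 0 < m by rewrite divr_gt0.
rewrite -(ler_pM2l m0) (le_trans uI)//.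
have l20 : 0 < (l / 2)^-1 by rewrite invr_gt0 divr_gt0.
have := lerD (ler_wpM2l (ltW l20) I1P) I2P => /le_trans; apply.
rewrite le_eqVlt; apply/orP; left; apply/eqP.
have -> : (l / 2)^-1 * (tau * (m * (l / 2)) + tau `^ (1 - p) * (4 * r * (2 `^ `|gamma| * r `^ gamma)) * D) =
    tau * m + 8 * 2 `^ `|gamma| * D * (l^-1 * (tau `^ (1 - p) * (r * r `^ gamma))).
  move: (tau `^ _) (r `^ _) (2 `^ _) l0 => A B C ll; field; exact: lt0r_neq0.
have -> : tau' * (r^-1 * (m * l)) = m * (tau' * (r^-1 * l)) by ring.
rewrite id1 id2 id3 /m; move: (2 `^ _) => C; field; exact: lt0r_neq0.
Qed.

End radial_decay.

(** * The potentials *)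

Lemma ae_and d (T : measurableType d) (R : realType) (mu : {measure set T -> \bar R}) (P Q : T -> Prop) :
  {ae mu, forall x, P x} -> {ae mu, forall x, Q x} -> {ae mu, forall x, P x /\ Q x}.
Proof.
move=> aP aQ; have := negligibleU aP aQ; apply: negligibleS => x /= /not_andP[];
by [left|right].
Qed.

Section essential_bounds.
Context {R : realType}.
Notation leb := (@lebesgue_measure R).

Lemma Lebesgue_measurable_minorant (V : R -> \bar R) : (forall r, 0 < r -> (0 <= V r)%E) ->
  Lebesgue_measurable_fun `]0, +oo[ V ->
  exists V0 : R -> \bar R, [/\ measurable_fun setT V0, forall r, (0 <= V0 r)%E &
    {ae leb, forall r, 0 < r -> V0 r = V r}].
Proof.
move=> V0 mV.
pose q k : R := ratr (odflt 0%Q (unpickle k)).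
have XN k : exists X : set R, measurable X /\ exists Z : set R, leb.-negligible Z /\
    X `|` Z = [set r | 0 < r /\ ((q k)%:E < V r)%E].
  pose O : set R := `]0, +oo[%classic.
  have mO : @measurable _ (g_sigma_algebraType (completed_algebra_gen (@lebesgue_measure R))) O.
    suff : completed_algebra_gen (@lebesgue_measure R) O by move=> OO; exact: (eq_ind_r (fun S : set (set R) => S O) OO (@g_sigma_completed_algebra_genE R)).
    exists O; first exact: measurable_itv.
    by exists set0; [exact: negligible_set0|rewrite setU0].
  have mOV := mV mO _ (emeasurable_itv `](q k)%:E, +oo[).
  have [X mX [Z nZ XZ]] : completed_algebra_gen (@lebesgue_measure R) (O `&` V @^-1` `](q k)%:E, +oo[%classic).
    exact: (eq_ind _ (fun S : set (set R) => S _) mOV _ (@g_sigma_completed_algebra_genE R)).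
  exists X; split => //; exists Z; split => //; rewrite XZ.
  by apply/seteqP; split => r; rewrite /O /setI/= !in_itv/= !andbT => -[].
have [X XP] := choice XN.
(* Truncating q at 0 keeps the supremum nonnegative and loses nothing, since V >= 0. *)
pose f k r : \bar R := (Num.max 0 (q k) * \1_(X k) r)%:E.
exists (fun r => esups (f ^~ r) 0%N); split.
- apply: measurable_fun_esups => k; apply/measurable_EFinP; apply: measurable_funM => //.
  by apply: measurable_indic; exact: (XP k).1.
- move=> r; apply: (@le_trans _ _ (f 0%N r)); last by apply: ereal_sup_ubound; exists 0%N.
  by rewrite lee_fin mulr_ge0// ?le_max ?lexx// indicE.
have [Z ZP] := choice (fun k => (XP k).2).
have nZ : leb.-negligible (\bigcup_k Z k) by apply: negligible_bigcup => k; exact: (ZP k).1.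
apply: (@ae_imply R _ _ leb (fun r => ~ (\bigcup_k Z k) r)).
  by move: nZ; apply: negligibleS => r /= /contrapT.
move=> r nr r0.
have Xr k : X k r <-> ((q k)%:E < V r)%E.
  have XZr : (X k `|` Z k) r <-> 0 < r /\ ((q k)%:E < V r)%E by rewrite (ZP k).2.
  split => [Xkr|qV]; first by have [] := XZr.1 (or_introl Xkr).
  by have [//|Zr] := XZr.2 (conj r0 qV); exfalso; apply: nr; exists k.
apply/eqP; rewrite eq_le; apply/andP; split.
  apply: ge_ereal_sup => _ [k _ <-]; rewrite /f indicE.
  have [|_] := boolP (r \in X k); last by rewrite mulr0; exact: V0.
  rewrite inE mulr1 => /Xr qV; case: (leP 0 (q k)) => _; [exact: ltW|exact: V0].
rewrite leNgt; apply/negP => lt.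
have f0 : (0 <= esups (f ^~ r) 0%N)%E.
  apply: (@le_trans _ _ (f 0%N r)); last by apply: ereal_sup_ubound; exists 0%N.
  by rewrite lee_fin mulr_ge0// ?le_max ?lexx// indicE.
have [y yS] : exists y, esups (f ^~ r) 0%N = y%:E.
  by move: f0 lt; case: (esups _ _) => [y _ _|_|]; [by exists y|rewrite ltNge leey|].
rewrite yS in lt f0.
have [z [yz zV]] : exists z : rat, y < ratr z /\ ((ratr z)%:E < V r)%E.
  move: lt; case: (V r) => [v|_|//].
    by rewrite lte_fin => /rat_in_itvoo[z]; rewrite in_itv/= => /andP[]; exists z.
  have : y < y + 1 by rewrite ltrDl.
  by move=> /rat_in_itvoo[z]; rewrite in_itv/= => /andP[yz _]; exists z; rewrite ltry.
have qz : q (pickle z) = ratr z by rewrite /q pickleK.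
have : (f (pickle z) r <= y%:E)%E by rewrite -yS; apply: ereal_sup_ubound; exists (pickle z).
rewrite /f indicE mem_set; last by apply/Xr; rewrite qz.
rewrite mulr1 lee_fin qz leNgt; move/negP; apply; apply: (lt_le_trans yz).
by rewrite le_max lexx orbT.
Qed.

Lemma ae_above (a : R) (P : R -> Prop) : {ae lebesgue_above a, forall r, P r} ->
  {ae leb, forall r, a < r -> P r}.
Proof.
move=> [Z [mZ Z0 ZP]]; exists (Z `&` `]a, +oo[%classic); split => //.
  by apply: measurableI => //; exact: measurable_itv.
by move=> r /= /not_implyP[ar Pr]; split; [exact: ZP|rewrite /= in_itv/= andbT].
Qed.

(** The lower bound is used first: it makes V(r) a positive real, so that the quotient is an
    ordinary one and its essential bound can be multiplied out. *)
Lemma potential_bounds (V : R -> \bar R) (K : R -> R) (R2 alpha beta gamma : R) : 0 < R2 ->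
  (forall r, 0 < r -> 0 < K r) ->
  {ae leb, forall r : R, R2 < r -> (V r < +oo)%E} ->
  (ess_sup (lebesgue_above R2)
      (fun r : R => (K r)%:E / ((r `^ alpha)%:E * V r `^ beta)) < +oo)%E ->
  (0 < ess_inf (lebesgue_above R2) (fun r : R => (r `^ gamma)%:E * V r))%E ->
  exists c L : R, [/\ 0 < c, 0 <= L &
    {ae leb, forall r, R2 < r -> exists v : R, [/\ V r = v%:E, c * r `^ (- gamma) <= v &
       K r <= L * (r `^ alpha * v `^ beta)]}].
Proof.
move=> R20 K0 Vfin; set S := ess_sup _ _; set I := ess_inf _ _ => Soo I0.
(* The essential infimum may be +oo; any positive real then does. *)
have [c c0 cI] : exists2 c : R, 0 < c & (c%:E <= I)%E.
  by move: I0; case: (I) => [c c0||//]; [exists c|exists 1; rewrite ?leey].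
have [L L0 SL] : exists2 L : R, 0 <= L & (S <= L%:E)%E.
  move: Soo; case: (S) => [s _|//|_]; last by exists 0; rewrite ?leNye.
  by exists (Num.max 0 s); rewrite ?le_max ?lexx// lee_fin le_max lexx orbT.
exists c, L; split => //.
have h1 := ae_above (ess_sup_ge (lebesgue_above R2)
  (fun r : R => (K r)%:E / ((r `^ alpha)%:E * V r `^ beta))%E).
have h2 := ae_above (ess_inf_le (lebesgue_above R2) (fun r : R => (r `^ gamma)%:E * V r)%E).
have bound r : (R2 < r -> (V r < +oo)%E) ->
    (R2 < r -> ((K r)%:E / ((r `^ alpha)%:E * V r `^ beta) <= S)%E) ->
    (R2 < r -> (I <= (r `^ gamma)%:E * V r)%E) -> R2 < r ->
    exists v : R, [/\ V r = v%:E, c * r `^ (- gamma) <= v & K r <= L * (r `^ alpha * v `^ beta)].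
  move=> Vr Sr Ir Rr; have r0 : 0 < r by exact: lt_trans Rr.
  have Ic := le_trans cI (Ir Rr).
  have rg : 0 < r `^ gamma by rewrite powR_gt0.
  have ra : 0 < r `^ alpha by rewrite powR_gt0.
  move: (Vr Rr) Ic (Sr Rr); case: (V r) => [v _|//|]; last first.
    by move=> _; rewrite gt0_muleNy ?lte_fin// leNgt ltNyr.
  rewrite -EFinM lee_fin => cv.
  have v0 : 0 < v by rewrite -(pmulr_rgt0 _ rg) (lt_le_trans c0).
  move=> Sv; exists v; split => //; first by rewrite powRN ler_pdivrMr// mulrC.
  have vb : 0 < r `^ alpha * v `^ beta by rewrite mulr_gt0// powR_gt0.
  move: (le_trans Sv SL); rewrite poweR_EFin -EFinM inver gt_eqF// -EFinM lee_fin.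
  by rewrite ler_pdivrMr.
apply: (ae_imply (ae_and (ae_and Vfin h1) h2)) => r [[V1 S1] I1]; exact: bound.
Qed.
End essential_bounds.

(** * A function of norm one *)

Lemma Lfun_finite d (T : measurableType d) (R : realType) (mu : {measure set T -> \bar R}) (p : R) (f : T -> R) :
  measurable_fun setT f -> (\int[mu]_x (`|f x| `^ p)%:E < +oo)%E -> f \in Lfun mu p%:E.
Proof.
move=> mf fp; apply/andP; split; rewrite inE//=; rewrite /finLfun/= /finite_norm unlock.
by apply: poweR_lty.
Qed.

Lemma csupp_bounded_integral (R : realType) n (M C q : R) (f : 'rV[R]_n -> R) : 0 < q -> 0 <= C ->
  (forall x, `|f x| <= C * \1_(cbox n M) x) ->
  (\int[lebesgue_rV n]_x (`|f x| `^ q)%:E < +oo)%E.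
Proof.
move=> q0 C0 fC.
apply: (@le_lt_trans _ _ (\int[lebesgue_rV n]_x ((C `^ q) * \1_(cbox n M) x)%:E)%E); last first.
  exact: integrable_lty (integrable_indic_cbox n M (C `^ q)).
apply: ge0_le_integral_nonmeasurable => x; rewrite lee_fin ?powR_ge0//.
have := fC x; rewrite indicE; case: (_ \in _); rewrite ?mulr1 ?mulr0 => fx.
  by apply: ge0_ler_powR => //; exact: ltW.
by rewrite (le_anti (introT andP (conj fx (normr_ge0 _)))) powR0 ?gt_eqF.
Qed.

Section bump_profile.
Context {R : realType} {n : nat}.
Notation leb := (@lebesgue_measure R).
Variables (c d c0 d0 : R) (k : nat).
Hypotheses (c_gt0 : 0 < c) (cd : c < d) (dc0 : d <= c0) (cd0 : c0 < d0).
Hypotheses (m1 : 0 < plateau_mass k c d) (m2 : 0 < plateau_mass k c0 d0).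

(** The radial function with profile [shell_step]: smooth, and supported in an annulus chosen inside
    the region where V is integrable. *)
Definition ring_bump (x : 'rV[R]_n.+1) : R := shell_step c d c0 d0 k (sqn x).

Let d0_ge0 : 0 <= d0. Proof. by rewrite (le_trans (ltW c_gt0))// (le_trans (ltW cd))// (le_trans dc0)// ltW. Qed.

Lemma ring_bump_class_C j : class_C j ring_bump.
Proof. by apply: class_C_comp; [exact: shell_step_Ck|exact: class_C_sqn]. Qed.

Lemma ring_bump_neq0 x : ring_bump x != 0 -> c <= sqn x <= d0.
Proof. by apply: contraNT; rewrite /ring_bump => h; rewrite shell_step0. Qed.

Lemma ring_bump_csupp : csupp (1 + d0) ring_bump.
Proof. by move=> x /ring_bump_neq0/andP[_ xd]; apply/cboxP; exact: (sqn_cbox d0_ge0). Qed.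

Lemma ring_bump_bounded : exists2 C : R, 0 <= C & forall x, `|ring_bump x| <= C * \1_(cbox n.+1 (1 + d0)) x.
Proof. exact: (continuous_csupp_bounded (class_C_cont (ring_bump_class_C 0)) ring_bump_csupp). Qed.

Lemma ring_bump_partial i x : partial i ring_bump x = shell_step' c d c0 d0 k (sqn x) * (2 * x 0 i).
Proof.
have [_ <-//] : is_derive x (delta_mx 0 i) (shell_step c d c0 d0 k \o @sqn R n.+1)
    (shell_step' c d c0 d0 k (sqn x) * (2 * x 0 i)).
by apply: is_derive_comp1; [exact: shell_step_is_derive|exact: is_derive_sqn].
Qed.

Lemma measurable_enorm_gradient : measurable_fun setT (fun x => enorm (gradient ring_bump x)).
Proof.
rewrite (_ : (fun x => _) = fun x => Num.sqrt (\sum_(i < n.+1) partial i ring_bump x ^+ 2)); last first.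
  by apply/funext => x; rewrite /enorm; congr Num.sqrt; apply: eq_bigr => i _; rewrite mxE.
apply: (measurableT_comp (continuous_measurable_fun (@sqrt_continuous R))).
apply: continuous_measurable_rV; apply: (@class_C_cont _ _ 0); apply: class_C_sum => i.
by apply: class_C_mul; apply: class_C_partial; exact: ring_bump_class_C.
Qed.

Lemma enorm_gradient_bounded : exists2 C : R, 0 <= C &
  forall x, `|enorm (gradient ring_bump x)| <= C * \1_(cbox n.+1 (1 + d0)) x.
Proof.
apply: continuous_csupp_bounded.
- rewrite (_ : (fun x => _) = fun x => Num.sqrt (\sum_(i < n.+1) partial i ring_bump x ^+ 2)); last first.
    by apply/funext => x; rewrite /enorm; congr Num.sqrt; apply: eq_bigr => i _; rewrite mxE.
  move=> x; apply: continuous_comp; last exact: sqrt_continuous.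
  apply: (@class_C_cont _ _ 0); apply: class_C_sum => i.
  by apply: class_C_mul; apply: class_C_partial; exact: ring_bump_class_C.
- move=> x; rewrite /enorm => gx.
  have [i] : exists i, partial i ring_bump x != 0.
    apply: contrapT => h; move: gx; rewrite big1 ?sqrtr0 ?eqxx// => i _.
    rewrite mxE; have [->|pi] := eqVneq (partial i ring_bump x) 0; first by rewrite expr0n.
    by exfalso; apply: h; exists i.
  by apply: csupp_partial; exact: ring_bump_csupp.
Qed.

(** If the gradient vanished almost everywhere, so would the first plateau times the half-space
    weight, because that plateau times 2 x_0 is, up to a positive mass, the derivative along x_0 on
    c < |x|^2 < d. But its integral is the measure of a cube times two positive masses. *)
Lemma ring_bump_energy_gt0 (p : R) : 0 < p ->
  (0 < \int[lebesgue_rV n.+1]_x (enorm (gradient ring_bump x) `^ p)%:E)%E.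
Proof.
move=> p0; have I0 : (0 <= \int[lebesgue_rV n.+1]_x (enorm (gradient ring_bump x) `^ p)%:E)%E.
  by apply: integral_ge0 => x _; rewrite lee_fin powR_ge0.
rewrite lt_neqAle I0 andbT; apply/negP => /eqP/esym E0.
have mg : measurable_fun setT (fun x => enorm (gradient ring_bump x) `^ p).
  exact: (measurableT_comp (measurable_powR _) measurable_enorm_gradient).
have := ge0_integral_eq0_ae measurableT mg (fun x => powR_ge0 _ _) E0.
pose e := Num.sqrt c / n.+1%:R; have e0 : 0 < e by rewrite divr_gt0// sqrtr_gt0.
pose Q : set 'rV[R]_n := obox (fun=> - e) (fun=> e).
have mQ : measurable Q by exact: measurable_obox.
have Qc y : Q y -> sqn y <= c by exact: small_cube_sqn_le.
pose G (t : R) := (plateau_mass k c0 d0 * plateau k c d t)%:E.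
have pl0 t : 0 <= plateau k c d t by case/andP: (plateau_itv k c d t).
have GQ := @ge0_integral_half_weight R n Q c G mQ Qc.
have {}GQ : (\int[lebesgue_rV n.+1]_x (G (sqn x) * (half_weight Q x)%:E) =
    lebesgue_rV n Q * (plateau_mass k c0 d0 * plateau_mass k c d)%:E)%E.
  rewrite GQ; first last.
  - move=> t tc; rewrite /G plateau0 ?mulr0//; by rewrite negb_and -!leNgt tc.
  - by move=> t; rewrite lee_fin mulr_ge0// ltW.
  - exact: (measurable_scaled_plateau k c d (plateau_mass k c0 d0)).
  congr (_ * _)%E; exact: scaled_plateau_integral (ltW m2).
move=> gE.
have : (\int[lebesgue_rV n.+1]_x (G (sqn x) * (half_weight Q x)%:E) = 0)%E.
  rewrite (ae_eq_integral (cst 0%E))//; first exact: integral0.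
  - apply: emeasurable_funM; last by apply/measurable_EFinP; exact: measurable_half_weight.
    exact: (measurableT_comp (measurable_scaled_plateau k c d _) (@measurable_sqn R n.+1)).
  - move: gE; apply: filterS => x /(_ I) gx _ /=; rewrite /G -EFinM; congr EFin.
    have [->|px] := eqVneq (plateau k c d (sqn x)) 0; first by rewrite mulr0 mul0r.
    have /andP[cx xd] : c < sqn x < d by apply: contraNT px => h; rewrite plateau0.
    have g0 : enorm (gradient ring_bump x) = 0.
      by apply/eqP; move/eqP: gx; rewrite powR_eq0 => /andP[].
    have p0x : partial 0 ring_bump x = 0.
      have := sqn_coord (gradient ring_bump x) 0; rewrite mxE.
      move/eqP: g0; rewrite enormE sqrtr_eq0 => s0 /le_trans/(_ s0).
      by rewrite le_eqVlt ltNge sqr_ge0 orbF sqrf_eq0 => /eqP.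
    move: p0x; rewrite ring_bump_partial /shell_step' [plateau k c0 d0 _]plateau0; last first.
      by rewrite negb_and -!leNgt (le_trans (ltW xd)).
    have mp : plateau_mass k c0 d0 * plateau k c d (sqn x) != 0 by exact: mulf_neq0 (lt0r_neq0 m2) px.
    rewrite mulr0 subr0; move: mp; move: (_ * plateau _ _ _ _) => A A0 /eqP; rewrite mulf_eq0 (negbTE A0) => /eqP x0.
    by rewrite /half_weight x0 maxxx mul0r mulr0.
rewrite GQ => /eqP; rewrite mule_eq0 => /orP[|].
  by rewrite gt_eqF//; apply: lebesgue_obox_gt0 => i; rewrite gt0_cp.
by move: m1 m2; move: (plateau_mass _ _ _) (plateau_mass _ _ _) => a b a0 b0; rewrite eqe gt_eqF// mulr_gt0.
Qed.

(** The function is bounded and supported between the radii r1 and r2. [integral_sqn_le] reduces to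
    an integral in t = s^2, where dt = 2s ds is at most 2 r2 ds. *)
Lemma ring_bump_potential (V0 : R -> \bar R) (p r1 r2 : R) : 0 < p -> 0 < r1 -> r1 ^+ 2 < c -> d0 < r2 ^+ 2 -> 0 < r2 ->
  measurable_fun setT V0 -> (forall r, (0 <= V0 r)%E) ->
  (\int[leb]_(r in `]r1, r2[) V0 r < +oo)%E ->
  (\int[lebesgue_rV n.+1]_x (V0 (enorm x) * (`|ring_bump x| `^ p)%:E) < +oo)%E.
Proof.
move=> p0 r10 r1c d0r2 r20 mV V00 VL.
have [C C0 CP] := integral_sqn_le n.+1 (r2 ^+ 2) (exprn_gt0 2 r10).
have [B B0 BP] := ring_bump_bounded.
pose I : set R := `]r1 ^+ 2, r2 ^+ 2[%classic.
pose F t := (V0 (Num.sqrt t) * (\1_I t)%:E)%E.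
have mI : measurable_fun setT (fun t => (\1_I t : R)%:E).
  by apply/measurable_EFinP; apply: measurable_indic; exact: measurable_itv.
have mF : measurable_fun setT F.
  apply: emeasurable_funM => //.
  exact: (measurableT_comp mV (continuous_measurable_fun (@sqrt_continuous R))).
have F0 t : (0 <= F t)%E by rewrite mule_ge0// lee_fin.
have Fout t : ~~ (r1 ^+ 2 < t < r2 ^+ 2) -> F t = 0%E.
  by move=> h; rewrite /F indicE memNset ?mule0// /I/= in_itv/=; exact/negP.
apply: (@le_lt_trans _ _ (\int[lebesgue_rV n.+1]_x ((B `^ p)%:E * F (sqn x)))%E).
  apply: ge0_le_integral_nonmeasurable => x; first by rewrite mule_ge0// lee_fin powR_ge0.
  have [->|ux] := eqVneq (ring_bump x) 0.
    by rewrite normr0 powR0 ?gt_eqF// mule0 mule_ge0// lee_fin powR_ge0.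
  have /andP[cx xd] := ring_bump_neq0 ux.
  rewrite /F -enormE indicE mem_set; last by rewrite /I/= in_itv/= (lt_le_trans r1c)// (le_lt_trans xd).
  rewrite mule1 muleC lee_wpmul2r// lee_fin; apply: ge0_ler_powR => //; first exact: ltW.
  by apply: (le_trans (BP x)); rewrite ler_piMr// indicE; case: (_ \in _).
rewrite ge0_integralZl_EFin//; first last.
- exact: powR_ge0.
- exact: (measurableT_comp mF (@measurable_sqn R n.+1)).
rewrite lte_mul_pinfty//; first by rewrite lee_fin powR_ge0.
apply: (le_lt_trans (CP F mF F0 Fout)); rewrite lte_mul_pinfty//.
have -> : (\int[leb]_t F t = \int[leb]_(t in `]0%R, +oo[) F t)%E.
  rewrite [RHS]integral_mkcond; apply: eq_integral => t _; rewrite patchE.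
  case: ifPn => // /negP t0; apply: Fout; apply/negP => /andP[r1t _]; apply: t0.
  by rewrite inE/= in_itv/= (le_lt_trans _ r1t)// exprn_ge0// ltW.
rewrite ge0_integral_sqr_subst//.
have iV : (\int[leb]_s ((V0 \_ `]r1, r2[) s) < +oo)%E by rewrite -integral_mkcond.
apply: (@le_lt_trans _ _ (\int[leb]_s ((2 * r2)%:E * (V0 \_ `]r1, r2[) s))%E); last first.
  rewrite ge0_integralZl_EFin//; first last.
  - by rewrite mulr_ge0// ltW.
  - by apply/(measurable_restrictT _ _).1 => //; exact: measurable_funTS.
  - by move=> s _; rewrite patchE; case: ifP.
  by rewrite lte_mul_pinfty// lee_fin mulr_ge0// ltW.
have V1 s : (0 <= (2 * r2)%:E * (V0 \_ `]r1, r2[) s)%E.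
  by apply: mule_ge0; [rewrite lee_fin mulr_ge0// ltW|rewrite patchE; case: ifP].
rewrite integral_mkcond; apply: ge0_le_integral_nonmeasurable => s; rewrite patchE; case: ifPn => //.
  by rewrite inE/= in_itv/= andbT => s0; rewrite mule_ge0// lee_fin mulr_ge0// ltW.
rewrite inE/= in_itv/= andbT add0r => s0.
have [sI|sI] := boolP (r1 ^+ 2 < s ^+ 2 < r2 ^+ 2); last by rewrite Fout// mul0e.
have := sI; rewrite !ltr_pXn2r ?nnegrE ?(ltW s0) ?(ltW r10) ?(ltW r20)// => /andP[r1s sr2].
rewrite patchE mem_set; last by rewrite /= in_itv/= r1s.
rewrite /F sqrtr_sqr gtr0_norm// indicE mem_set; last by rewrite /I/= in_itv.
by rewrite mule1 muleC lee_wpmul2r// lee_fin ler_pM2l// ltW.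
Qed.

End bump_profile.

Lemma enormZ (R : realType) n (s : R) (v : 'rV[R]_n) : 0 <= s -> enorm (s *: v) = s * enorm v.
Proof.
move=> s0; rewrite /enorm (eq_bigr (fun i => s ^+ 2 * v 0 i ^+ 2)); last by move=> i _; rewrite mxE exprMn.
by rewrite -mulr_sumr sqrtrM ?sqr_ge0// sqrtr_sqr ger0_norm.
Qed.

Section normalized_function.
Context {R : realType} {n : nat}.
Notation leb := (@lebesgue_measure R).
Variables (p : R) (V V0 : R -> \bar R).
Hypotheses (p1 : 1 < p) (pN : p < n.+1%:R).
Hypotheses (mV0 : measurable_fun setT V0) (V0_ge0 : forall r, (0 <= V0 r)%E).
Hypothesis V0V : {ae leb, forall r, 0 < r -> V0 r = V r}.

Lemma ae_potential : {ae lebesgue_rV n.+1, forall x : 'rV[R]_n.+1, V0 (enorm x) = V (enorm x)}.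
Proof.
have h1 := ae_enorm n.+1 V0V.
have h2 : {ae lebesgue_rV n.+1, forall x : 'rV[R]_n.+1, 0 < enorm x}.
  exists [set x : 'rV[R]_n.+1 | forall i, [set (0 : R)] (x 0 i)]; split.
  - by apply: (measurable_rV_forall (A := fun=> [set (0 : R)])) => i; exact: measurable_set1.
  - have := @lebesgue_rV_box R n.+1 (fun=> [set (0 : R)]) (fun=> @measurable_set1 R 0).
    by rewrite big_ord_recl lebesgue_measure_set1 mul0e.
  - move=> x /= /negP; rewrite -leNgt enormE => x0 i; apply/eqP; rewrite -sqrf_eq0 eq_le sqr_ge0 andbT.
    by apply: (le_trans (sqn_coord x i)); rewrite -sqrtr_eq0 eq_le x0 sqrtr_ge0.
by move: h1 h2; apply: filterS2 => x h1 h2; apply: h1.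
Qed.

Let mV0x : measurable_fun setT (fun x : 'rV[R]_n.+1 => V0 (enorm x)).
Proof. exact: (measurableT_comp mV0 (@measurable_enorm R n.+1)). Qed.

(* Without an admissible pair the supremum defining [R_infty] would be [-oo]. *)
Lemma exists_normalized (r1 r2 : R) : 0 < r1 -> r1 < r2 -> (\int[leb]_(r in `]r1, r2[) V r < +oo)%E ->
  exists u : 'rV[R]_n.+1 -> R, W_rad p V u /\ W_norm p V u = 1%E.
Proof.
move=> r10 r12 VL; have r20 : 0 < r2 by exact: lt_trans r12.
have p0 : 0 < p by rewrite (lt_trans _ p1).
have V0L : (\int[leb]_(r in `]r1, r2[) V0 r < +oo)%E.
  apply: le_lt_trans VL; rewrite integral_mkcond [leRHS]integral_mkcond; apply: integral_ge_ae.
  - by apply/(measurable_restrictT _ _).1 => //; exact: measurable_funTS.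
  - by move=> r; rewrite patchE; case: ifP.
  - apply: (ae_imply V0V) => r h; rewrite !patchE; case: ifPn => //.
    by rewrite inE/= in_itv/= => /andP[r1r _]; rewrite h// (lt_trans r10).
have r22 : r1 ^+ 2 < r2 ^+ 2 by rewrite ltr_pXn2r// nnegrE ltW.
(* Three steps of a quarter of the gap place the two adjacent intervals strictly between r1^2 and
   r2^2. *)
pose h := (r2 ^+ 2 - r1 ^+ 2) / 4.
have h0 : 0 < h by rewrite divr_gt0// subr_gt0.
pose c := r1 ^+ 2 + h; pose d := c + h; pose d0 := d + h.
have r1c : r1 ^+ 2 < c by rewrite ltrDl.
have c0 : 0 < c by rewrite (lt_trans _ r1c)// exprn_gt0.
have cd : c < d by rewrite ltrDl.
have dd0 : d < d0 by rewrite ltrDl.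
have d0r2 : d0 < r2 ^+ 2 by rewrite /d0 /d /c /h; move: (r1 ^+ 2) (r2 ^+ 2) r22 => *; lra.
have [k [m1 m2]] : exists k, 0 < plateau_mass k c d /\ 0 < plateau_mass k d d0.
  have l1 := @plateau_mass_cvg R c d (ltW cd); have l2 := @plateau_mass_cvg R d d0 (ltW dd0).
  have dc : 0 < d - c by rewrite subr_gt0.
  have dd : 0 < d0 - d by rewrite subr_gt0.
  have /cvgr_gt/(_ _ dc)[K1 _ H1] := l1; have /cvgr_gt/(_ _ dd)[K2 _ H2] := l2.
  by exists (maxn K1 K2); split; [apply: H1; exact: leq_maxl|apply: H2; exact: leq_maxr].
clearbody d0 d c.
pose w : 'rV[R]_n.+1 -> R := ring_bump c d d d0 k.
have wC j : class_C j w by exact: ring_bump_class_C.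
have wsupp : csupp (1 + d0) w by exact: ring_bump_csupp.
have EG := ring_bump_energy_gt0 (n := n) c0 (lexx d) m1 m2 p0.
have [CG CG0 GP] := enorm_gradient_bounded (n := n) k c0 cd (lexx d) dd0.
have EGoo := csupp_bounded_integral p0 CG0 GP.
have EV := ring_bump_potential (n := n) k c0 cd (lexx d) dd0 p0 r10 r1c d0r2 r20 mV0 V0_ge0 V0L.
rewrite -/w in EG EGoo EV.
have wB := ring_bump_bounded (n := n) k c0 cd (lexx d) dd0.
have mEG := measurable_enorm_gradient (n := n) c d d d0 k.
rewrite -/w in wB mEG; have wE x : w x = shell_step c d d d0 k (sqn x) by [].
clearbody w; have [B B0 BP] := wB.
have mw : measurable_fun setT w by apply: continuous_measurable_rV; exact: class_C_cont (wC 0%N).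
have mEGp : measurable_fun setT (fun x => (enorm (gradient w x) `^ p)%:E).
  by apply/measurable_EFinP; exact: (measurableT_comp (measurable_powR _) mEG).
have mVp (v : 'rV[R]_n.+1 -> R) : measurable_fun setT v ->
    measurable_fun setT (fun x => V0 (enorm x) * (`|v x| `^ p)%:E)%E.
  move=> mv; apply: emeasurable_funM => //; apply/measurable_EFinP.
  by apply: (measurableT_comp (measurable_powR _)); exact: measurableT_comp.
pose g0 x := ((enorm (gradient w x) `^ p)%:E + V0 (enorm x) * (`|w x| `^ p)%:E)%E.
have mg0 : measurable_fun setT g0 by apply: emeasurable_funD => //; exact: mVp.
have Vp0 (v : 'rV[R]_n.+1 -> R) x : (0 <= V0 (enorm x) * (`|v x| `^ p)%:E)%E.
  by rewrite mule_ge0// lee_fin powR_ge0.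
have g00 x : (0 <= g0 x)%E by rewrite adde_ge0// lee_fin powR_ge0.
have [P P0 PE] : exists2 P : R, 0 < P & (\int[lebesgue_rV n.+1]_x g0 x = P%:E)%E.
  have gE : (\int[lebesgue_rV n.+1]_x g0 x = \int[lebesgue_rV n.+1]_x (enorm (gradient w x) `^ p)%:E +
      \int[lebesgue_rV n.+1]_x (V0 (enorm x) * (`|w x| `^ p)%:E))%E.
    rewrite ge0_integralD//; [by move=> x _; rewrite lee_fin powR_ge0|exact: mVp].
  have EG' : (\int[lebesgue_rV n.+1]_x (enorm (gradient w x) `^ p)%:E < +oo)%E.
    apply: le_lt_trans EGoo; apply: ge0_le_integral_nonmeasurable => x; rewrite lee_fin ?powR_ge0//.
    by rewrite ger0_norm// sqrtr_ge0.
  have EV0 : (0 <= \int[lebesgue_rV n.+1]_x (V0 (enorm x) * (`|w x| `^ p)%:E))%E by exact: integral_ge0.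
  have goo : (\int[lebesgue_rV n.+1]_x g0 x < +oo)%E by rewrite gE lte_add_pinfty.
  have gpos : (0 < \int[lebesgue_rV n.+1]_x g0 x)%E by rewrite gE (lt_le_trans EG)// leeDl.
  by move: goo gpos; case: (integral _ _ _) => [P _ P0|//|//]; exists P.
(* The norm is homogeneous: scaling by s multiplies its p-th power [P] by s^p. *)
pose s := P `^ (- p^-1).
have s0 : 0 < s by rewrite powR_gt0.
have sP : s `^ p * P = 1.
  by rewrite -powRrM mulNr mulVf ?gt_eqF// powR_inv1 ?mulVf ?gt_eqF// ltW.
pose u x := s * w x.
have uC : class_C 1 u by apply: (@class_C_mul _ _ 1 (fun=> s)); [exact: class_C_cst|exact: wC].
have usupp : csupp (1 + d0) u by move=> x; rewrite mulf_eq0 negb_or => /andP[_]; exact: wsupp.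
have uP i x : partial i u x = s * partial i w x.
  have dw : is_derive x (delta_mx 0 i : 'rV[R]_n.+1) w (partial i w x) by exact: class_C_derivable (wC 1%N).
  by have [_ E] := is_deriveZ s dw; exact: E.
have guE x : gradient u x = s *: gradient w x by apply/rowP => i; rewrite !mxE uP.
have wu := weak_gradient_class_C uC usupp.
have gu := grad_ae wu.
have mu_ : measurable_fun setT u by apply: continuous_measurable_rV; exact: class_C_cont uC.
have uB x : `|u x| <= (s * B) * \1_(cbox n.+1 (1 + d0)) x.
  by rewrite normrM gtr0_norm// -mulrA ler_pM2l.
have VuE x : (V0 (enorm x) * (`|u x| `^ p)%:E = (s `^ p)%:E * (V0 (enorm x) * (`|w x| `^ p)%:E))%E.
  by rewrite normrM gtr0_norm// powRM ?(ltW s0)// EFinM muleCA.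
have aeV := ae_potential.
exists u; split; first split; first split; first split.
- apply: Lfun_finite => //; apply: (csupp_bounded_integral _ _ uB); last by rewrite mulr_ge0// ltW.
  by rewrite /sobolev_exponent divr_gt0 ?subr_gt0// mulr_gt0.
- by exists (gradient u).
- move=> i; have [_ lgu _] : weak_gradient u (grad u) by apply: getPex; exists (gradient u).
  have pB : exists2 C : R, 0 <= C & forall x, `|partial i u x| <= C * \1_(cbox n.+1 (1 + d0)) x.
    apply: continuous_csupp_bounded; last exact: csupp_partial.
    exact: class_C_cont (class_C_partial i uC).
  have [C C0 CP] := pB; have [mgi _] := lgu i; apply: Lfun_finite => //.
  apply: le_lt_trans (csupp_bounded_integral p0 C0 CP); apply: integral_le_ae.
  + apply/measurable_EFinP; apply: (measurableT_comp (measurable_powR _)); apply: measurableT_comp => //.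
    by apply: continuous_measurable_rV; exact: class_C_cont (class_C_partial i uC).
  + by move=> x; rewrite lee_fin powR_ge0.
  + by apply: filterS gu => x ->; rewrite mxE.
- apply: (@le_lt_trans _ _ (\int[lebesgue_rV n.+1]_x (V0 (enorm x) * (`|u x| `^ p)%:E))%E).
    apply: integral_le_ae => //; first exact: mVp.
    by apply: filterS aeV => x ->.
  under eq_integral do rewrite VuE.
  rewrite ge0_integralZl_EFin//; [|exact: mVp|exact: powR_ge0].
  by rewrite lte_mul_pinfty// lee_fin powR_ge0.
- exists (fun r => s * shell_step c d d d0 k (r ^+ 2)); apply: aeW => x.
  by rewrite /u wE enormE sqr_sqrtr// sqn_ge0.
rewrite /W_norm.
have -> : (\int[lebesgue_rV n.+1]_x ((enorm (grad u x) `^ p)%:E + V (enorm x) * (`|u x| `^ p)%:E) =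
    \int[lebesgue_rV n.+1]_x ((s `^ p)%:E * g0 x))%E.
  have mg1 : measurable_fun setT (fun x => (s `^ p)%:E * g0 x)%E by exact: measurable_funeM.
  have g10 x : (0 <= (s `^ p)%:E * g0 x)%E by rewrite mule_ge0// lee_fin powR_ge0.
  have fg : {ae lebesgue_rV n.+1, forall x,
      ((enorm (grad u x) `^ p)%:E + V (enorm x) * (`|u x| `^ p)%:E = (s `^ p)%:E * g0 x)%E}.
    move: gu aeV; apply: filterS2 => x -> <-.
    by rewrite VuE guE enormZ ?(ltW s0)// powRM ?(ltW s0) ?sqrtr_ge0// EFinM -muleDr.
  apply/eqP; rewrite eq_le; apply/andP; split; [apply: integral_le_ae|apply: integral_ge_ae] => //;
  by apply: filterS fg => x ->.
rewrite ge0_integralZl_EFin//; last exact: powR_ge0.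
by rewrite PE -EFinM sP poweR_EFin powR1.
Qed.
End normalized_function.

(** * The tail estimate *)

Section growth_bounds.
Context {R : realType}.
Implicit Types (A B v r : R).

Lemma powR_le_inv_base (v b theta : R) : 0 < b -> b <= v -> theta <= 0 -> v `^ theta <= b `^ theta.
Proof.
move=> b0 bv t0; have v0 : 0 < v by exact: lt_le_trans bv.
have tN : 0 <= - theta by rewrite oppr_ge0.
have -> : v `^ theta = (v `^ (- theta))^-1 by rewrite -powRN opprK.
have -> : b `^ theta = (b `^ (- theta))^-1 by rewrite -powRN opprK.
by rewrite lef_pV2 ?posrE ?powR_gt0//; apply: ge0_ler_powR => //; rewrite nnegrE ltW.
Qed.

(* Above the lower bound [c r^-gamma] a larger power of the potential costs only a power of [r]. *)
Lemma potential_power (c gamma beta beta' v r : R) : 0 < c -> 0 < r -> c * r `^ (- gamma) <= v -> beta <= beta' ->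
  v `^ beta <= c `^ (beta - beta') * r `^ (gamma * (beta' - beta)) * v `^ beta'.
Proof.
move=> c0 r0 cv bb; have cr : 0 < c * r `^ (- gamma) by rewrite mulr_gt0// powR_gt0.
have v0 : 0 < v by exact: lt_le_trans cv.
have -> : v `^ beta = v `^ (beta - beta') * v `^ beta' by rewrite powR_mul//; congr powR; ring.
rewrite ler_wpM2r ?powR_ge0//.
have -> : c `^ (beta - beta') * r `^ (gamma * (beta' - beta)) = (c * r `^ (- gamma)) `^ (beta - beta').
  rewrite powRM ?(ltW c0) ?powR_ge0// -powRrM; congr (_ * powR _ _); ring.
by apply: powR_le_inv_base => //; rewrite subr_le0.
Qed.

Lemma mul_powR_le_sum (p A B : R) : 1 < p -> 0 <= A -> 0 <= B -> A `^ (p - 1) * B <= A `^ p + B `^ p.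
Proof.
move=> p1 A0 B0.
have E x : 0 <= x -> x `^ p = x `^ (p - 1) * x.
  move=> x0; rewrite -[X in _ * X]powRr1// -powRD.
    by congr powR; ring.
  by rewrite subrK gt_eqF ?(lt_trans _ p1).
have p0 : 0 <= p - 1 by rewrite subr_ge0 ltW.
have [AB|BA] := leP A B.
  apply: (@le_trans _ _ (B `^ p)); last by rewrite lerDr powR_ge0.
  by rewrite (E B B0) ler_wpM2r//; apply: ge0_ler_powR.
apply: (@le_trans _ _ (A `^ p)); last by rewrite lerDl powR_ge0.
by rewrite (E A A0) ler_wpM2l ?powR_ge0// ltW.
Qed.

(** A weighted mean inequality with crude constant: each factor is at most the same power of the
    sum, and the exponents add up to 1. *)
Lemma powR_prod3_le_sum (a b c X Y Z : R) : 0 <= a -> 0 <= b -> 0 <= c -> a + b + c = 1 ->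
  0 <= X -> 0 <= Y -> 0 < Z -> X `^ a * Y `^ b * Z `^ c <= X + Y + Z.
Proof.
move=> a0 b0 c0 abc X0 Y0 Z0; set S := X + Y + Z.
have S0 : 0 < S by rewrite ltr_wpDl// addr_ge0.
have -> : S = S `^ a * S `^ b * S `^ c by rewrite !powR_mul// abc powRr1// ltW.
have Xa : X `^ a <= S `^ a by apply: ge0_ler_powR; rewrite ?nnegrE// ?(ltW S0)// /S; lra.
have Yb : Y `^ b <= S `^ b by apply: ge0_ler_powR; rewrite ?nnegrE// ?(ltW S0)// /S; lra.
have Zc : Z `^ c <= S `^ c by apply: ge0_ler_powR; rewrite ?nnegrE// ?(ltW S0)// ?(ltW Z0)// /S; lra.
by apply: ler_pM => //; rewrite ?mulr_ge0 ?powR_ge0//; apply: ler_pM => //; exact: powR_ge0.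
Qed.

Variables (p q alpha beta gamma c L N : R).
Hypotheses (p1 : 1 < p) (q1 : 1 < q) (qb : p * beta < q) (c0 : 0 < c) (L0 : 0 <= L) (gN : gamma < N).

Let p0 : 0 < p. Proof. exact: lt_trans p1. Qed.

(** To be read with r = |x|, v = V(|x|), A = |u(x)|, B = |h(x)| and k = K(|x|): the pointwise
    estimate whose integral over |x| >= R is O(R^-eps). *)
Definition integrand_bound (M eps s r v A B k : R) :=
  k * A `^ (q - 1) * B <= M * r `^ (- eps) * (v * A `^ p + v * B `^ p + r `^ (- s)).

Lemma subcritical_bound : q < p -> q_star p N alpha beta gamma < q ->
  exists M eps s, [/\ 0 <= M, 0 < eps, N < s & forall r v A B k, 0 < r -> 0 <= A -> 0 <= B ->
    c * r `^ (- gamma) <= v -> k <= L * (r `^ alpha * v `^ beta) -> integrand_bound M eps s r v A B k].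
Proof.
(* a' is the power of r left once V^beta has been raised to V^(q/p); the third factor of the product
   must absorb it. *)
move=> qp qs; pose a' := alpha + gamma * (q / p - beta).
have th0 : 0 < (p - q) / p by rewrite divr_gt0// subr_gt0.
have gap : 0 < - N * ((p - q) / p) - a'.
  move: qs; rewrite /q_star mulrA ltr_pdivrMr; last by rewrite subr_gt0.
  move=> qs.
  have -> : - N * ((p - q) / p) - a' = (q * (N - gamma) - p * (alpha - gamma * beta + N)) / p.
    by rewrite /a'; field; rewrite gt_eqF.
  by rewrite divr_gt0// subr_gt0.
set G := - N * ((p - q) / p) - a' in gap.
(* The gap [G] is positive because q exceeds [q_star]. Half of it becomes the decay rate, the other
   half pushes s above N. *)
pose eps := G / 2; pose s := N + eps / ((p - q) / p).
have eps0 : 0 < eps by rewrite divr_gt0.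
have sE : - eps - s * ((p - q) / p) = a'.
  rewrite /s mulrDl divfK ?gt_eqF// /eps /G; lra.
exists (L * c `^ (beta - q / p)), eps, s; split => //.
- by rewrite mulr_ge0// powR_ge0.
- by rewrite ltrDl divr_gt0.
move=> r v A B k r0 A0 B0 cv kL; rewrite /integrand_bound.
have v0 : 0 < v by apply: lt_le_trans cv; rewrite mulr_gt0// powR_gt0.
have bq : beta <= q / p by rewrite ler_pdivlMr// mulrC ltW.
have kv := potential_power c0 r0 cv bq.
have X0 : 0 <= v * A `^ p by rewrite mulr_ge0 ?powR_ge0// ltW.
have Y0 : 0 <= v * B `^ p by rewrite mulr_ge0 ?powR_ge0// ltW.
have Z0 : 0 < r `^ (- s) by rewrite powR_gt0.
have a0 : 0 <= (q - 1) / p by rewrite divr_ge0 ?subr_ge0// ltW.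
have b0 : 0 <= p^-1 by rewrite invr_ge0 ltW.
have abc : (q - 1) / p + p^-1 + (p - q) / p = 1 by field; rewrite gt_eqF.
have := powR_prod3_le_sum a0 b0 (ltW th0) abc X0 Y0 Z0.
rewrite !powRM ?powR_ge0 ?(ltW v0)// -!powRrM.
have -> : p * ((q - 1) / p) = q - 1 by field; rewrite gt_eqF.
rewrite mulfV ?gt_eqF// (powRr1 B0) => prod.
apply: (@le_trans _ _ (L * (r `^ alpha * (c `^ (beta - q / p) * r `^ (gamma * (q / p - beta)) * v `^ (q / p))) *
    A `^ (q - 1) * B)).
  rewrite ler_wpM2r// ler_wpM2r ?powR_ge0// (le_trans kL)// ler_wpM2l// ler_wpM2l ?powR_ge0//.
apply: le_trans (ler_wpM2l _ prod); last by rewrite !mulr_ge0 ?powR_ge0.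
have vE : v `^ (q / p) = v `^ ((q - 1) / p) * v `^ p^-1.
  by rewrite powR_mul//; congr powR; field; rewrite gt_eqF.
have rE : r `^ alpha * r `^ (gamma * (q / p - beta)) = r `^ (- eps) * r `^ (- s * ((p - q) / p)).
  by rewrite !powR_mul//; congr powR; rewrite -/a' -sE; ring.
rewrite vE le_eqVlt; apply/orP; left; apply/eqP.
transitivity (L * c `^ (beta - q / p) * (r `^ alpha * r `^ (gamma * (q / p - beta))) *
  (v `^ ((q - 1) / p) * v `^ p^-1) * A `^ (q - 1) * B); first by ring.
by rewrite rE; ring.
Qed.

Lemma supercritical_bound (n : nat) (Cd : R) : N = n%:R + 1 -> 0 <= Cd -> p <= q -> beta <= 1 ->
  0 < p * (N - 1) - gamma * (p - 1) -> q_2star p N alpha beta gamma < q ->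
  exists M eps s, [/\ 0 <= M, 0 < eps, N < s & forall r v A B k, 0 < r -> 0 <= A -> 0 <= B ->
    c * r `^ (- gamma) <= v -> k <= L * (r `^ alpha * v `^ beta) ->
    A <= Cd * r `^ (- decay_exponent n p gamma) -> integrand_bound M eps s r v A B k].
Proof.
move=> Nn Cd0 pq b1 D0 qs; set nu := decay_exponent n p gamma.
have nuE : nu * p = n%:R - gamma + gamma / p by exact: decay_exponentE.
have nu2 : nu * p ^+ 2 = p * (N - 1) - gamma * (p - 1).
  by rewrite expr2 mulrA nuE Nn; field; rewrite gt_eqF.
(* The decay of A^(q-p) against the power of r produced by raising V^beta to V. Since nu p^2 is the
   denominator in [q_2star], the surplus is positive when q exceeds [q_2star]. *)
pose eps := nu * (q - p) - (alpha + gamma * (1 - beta)).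
have eps0 : 0 < eps.
  move: qs; rewrite /q_2star mulrA ltr_pdivrMr// -nu2 => qs.
  rewrite -(pmulr_rgt0 _ p0) -(pmulr_rgt0 _ p0) /eps.
  have -> : p * (p * (nu * (q - p) - (alpha + gamma * (1 - beta)))) =
      q * (nu * p ^+ 2) - p * (nu * p ^+ 2) - p * p * (alpha + gamma * (1 - beta)) by ring.
  move: qs; rewrite nu2; move: (q * _) => Q; nra.
(* Any s > N would do: the term r^-s is only added so that both cases share one form. *)
exists (L * c `^ (beta - 1) * Cd `^ (q - p)), eps, (N + 1); split => //.
- by rewrite !mulr_ge0 ?powR_ge0.
- by rewrite ltrDl.
move=> r v A B k r0 A0 B0 cv kL AC; rewrite /integrand_bound.
have v0 : 0 < v by apply: lt_le_trans cv; rewrite mulr_gt0// powR_gt0.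
have := potential_power c0 r0 cv b1; rewrite (powRr1 (ltW v0)) => kv.
have qp0 : 0 <= q - p by rewrite subr_ge0.
have AE : A `^ (q - 1) <= A `^ (p - 1) * (Cd `^ (q - p) * r `^ (- nu * (q - p))).
  have -> : A `^ (q - 1) = A `^ (p - 1) * A `^ (q - p).
    rewrite -powRD; first by congr powR; ring.
    have -> : p - 1 + (q - p) = q - 1 by ring.
    by rewrite subr_eq0 gt_eqF.
  rewrite ler_wpM2l ?powR_ge0// powRrM -powRM ?powR_ge0//.
  by apply: ge0_ler_powR; rewrite ?nnegrE ?mulr_ge0 ?powR_ge0.
have AB := mul_powR_le_sum p1 A0 B0.
apply: (@le_trans _ _ (L * (r `^ alpha * (c `^ (beta - 1) * r `^ (gamma * (1 - beta)) * v)) *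
    (A `^ (p - 1) * (Cd `^ (q - p) * r `^ (- nu * (q - p)))) * B)).
  rewrite ler_wpM2r//; apply: (@le_trans _ _ (L * (r `^ alpha * (c `^ (beta - 1) * r `^ (gamma * (1 - beta)) * v)) * A `^ (q - 1))).
    rewrite ler_wpM2r ?powR_ge0// (le_trans kL)// ler_wpM2l// ler_wpM2l ?powR_ge0//.
  by rewrite ler_wpM2l// !mulr_ge0 ?powR_ge0// ltW.
have rE : r `^ alpha * r `^ (gamma * (1 - beta)) * r `^ (- nu * (q - p)) = r `^ (- eps).
  by rewrite !powR_mul//; congr powR; rewrite /eps; ring.
have -> : L * (r `^ alpha * (c `^ (beta - 1) * r `^ (gamma * (1 - beta)) * v)) *
    (A `^ (p - 1) * (Cd `^ (q - p) * r `^ (- nu * (q - p)))) * B =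
  L * c `^ (beta - 1) * Cd `^ (q - p) * (r `^ alpha * r `^ (gamma * (1 - beta)) * r `^ (- nu * (q - p))) *
   (v * (A `^ (p - 1) * B)) by ring.
rewrite rE ler_wpM2l ?mulr_ge0 ?powR_ge0//.
rewrite -mulrDr (@le_trans _ _ (v * (A `^ p + B `^ p)))//; last by rewrite lerDl powR_ge0.
by rewrite ler_wpM2l// ltW.
Qed.

End growth_bounds.

(** * Integrability of |x|^-s at infinity *)

Section tail_integral.
Context {R : realType}.

Lemma dyadic_shell (r : R) : 1 < r -> exists k : nat, 2 ^+ k <= r < 2 ^+ k.+1.
Proof.
move=> r1; have r0 : 0 <= r by rewrite (le_trans _ (ltW r1)).
have ex : exists k : nat, r < 2 ^+ k.
  exists (Num.bound r); apply: (lt_le_trans (archi_boundP r0)).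
  by rewrite -natrX ler_nat ltnW// ltn_expl.
have := ex_minnP ex; case: ex_minnP => -[|k] rk kmin _; first by move: rk; rewrite expr0 ltNge ltW.
by exists k; rewrite rk andbT leNgt; apply/negP => /kmin; rewrite ltnn.
Qed.

Lemma geometric_partial_le (a t : R) K : 0 <= a -> 0 <= t -> t < 1 ->
  \sum_(0 <= k < K) a * t ^+ k <= a / (1 - t).
Proof.
move=> a0 t0 t1; rewrite -mulr_sumr ler_wpM2l// -[leRHS]mul1r ler_pdivlMr ?subr_gt0//.
suff -> : (\sum_(0 <= k < K) t ^+ k) * (1 - t) = 1 - t ^+ K by rewrite gerBl exprn_ge0.
elim: K => [|K ih]; first by rewrite big_nil mul0r expr0 subrr.
by rewrite big_nat_recr//= mulrDl ih exprS; ring.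
Qed.

Lemma cbox_measure m (M : R) : 0 <= M -> lebesgue_rV m (cbox m M) = (((2 * M) ^+ m)%:E)%E.
Proof.
move=> M0; rewrite (@lebesgue_rV_box R m (fun=> `[- M, M]%classic)); last by move=> i; exact: measurable_itv.
have E : (@lebesgue_measure R `[(- M)%R, M]%classic = (2 * M)%:E)%E.
  rewrite lebesgue_measure_itv/= lte_fin; case: ltP => [_|MM]; first by rewrite -EFinD opprK mulr_natl.
  have -> : M = 0 by apply/eqP; rewrite eq_le M0 andbT; move: MM; lra.
  by rewrite mulr0.
by under eq_bigr do rewrite E; rewrite prodEFin prodr_const card_ord.
Qed.

(** On the dyadic shell 2^k <= |x| < 2^(k+1) the integrand is at most 2^(-ks), and the shell lies in
    a cube of side 4 2^k. The sum over k is geometric with ratio 2^(m-s) < 1. *)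
Lemma tail_integral m (s : R) : m%:R < s ->
  (\int[lebesgue_rV m]_x (\1_[set x : 'rV[R]_m | (1 < enorm x)%R] x * enorm x `^ (- s))%:E < +oo)%E.
Proof.
move=> ms; have s0 : 0 < s by rewrite (le_lt_trans _ ms).
pose f k (x : 'rV[R]_m) : \bar R := ((2 ^+ k) `^ (- s) * \1_(cbox m (2 ^+ k.+1)) x)%:E.
have f0 k x : (0 <= f k x)%E by rewrite lee_fin mulr_ge0 ?powR_ge0.
have mf k : measurable_fun setT (f k).
  apply/measurable_EFinP; apply: measurable_funM => //; apply: measurable_indic; exact: measurable_cbox.
apply: (@le_lt_trans _ _ (\int[lebesgue_rV m]_x \sum_(0 <= k <oo) f k x)%E).
  apply: ge0_le_integral_nonmeasurable => x; first by rewrite lee_fin mulr_ge0 ?powR_ge0// indicE.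
  rewrite indicE; case: (boolP (_ \in _)) => [|_]; last by rewrite mul0r; exact: nneseries_ge0.
  rewrite inE/= => x1; have [k /andP[kx xk]] := dyadic_shell x1; rewrite mul1r.
  apply: (@le_trans _ _ (f k x)); last first.
    apply: le_trans (nneseries_lim_ge k.+1 _); last by [].
    by rewrite big_nat_recr//= leeDr// sume_ge0.
  rewrite /f indicE mem_set; last first.
    apply/cboxP => i; exact: le_trans (coord_le_enorm x i) (ltW xk).
  rewrite mulr1 lee_fin; by apply: powR_le_inv_base; rewrite ?exprn_gt0 ?oppr_le0 ?(ltW s0).
rewrite integral_nneseries//.
pose t : R := 2 `^ (m%:R - s).
have fE k : (\int[lebesgue_rV m]_x f k x = (4 ^+ m * t ^+ k)%:E)%E.
  under eq_integral do rewrite /f EFinM.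
  have mI : measurable_fun setT (fun x : 'rV[R]_m => (\1_(cbox m (2 ^+ k.+1)) x : R)%:E).
    by apply/measurable_EFinP; apply: measurable_indic; exact: measurable_cbox.
  rewrite ge0_integralZl_EFin//.
  rewrite integral_indicT; last exact: measurable_cbox.
  transitivity (((2 ^+ k) `^ (- s))%:E * ((2 * 2 ^+ k.+1) ^+ m)%:E)%E.
    by congr (_ * _)%E; apply: cbox_measure; rewrite exprn_ge0.
  rewrite -EFinM; congr EFin.
  have -> : (2 * 2 ^+ k.+1 : R) = 4 * 2 ^+ k by rewrite exprS; ring.
  have k0 : (0 : R) < 2 ^+ k by rewrite exprn_gt0.
  rewrite exprMn mulrCA -[(2 ^+ k) ^+ m]powR_mulrn ?(ltW k0)// powR_mul//; congr (_ * _).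
  by rewrite addrC -powR_mulrn// -powRrM mulrC powRrM powR_mulrn ?powR_ge0.
under eq_eseriesr do rewrite fE.
have t1 : t < 1.
  have -> : t = (2 `^ (s - m%:R))^-1 by rewrite /t -powRN; congr powR; ring.
  have sm : 0 < s - m%:R by rewrite subr_gt0.
  have : 1 `^ (s - m%:R) < 2 `^ (s - m%:R) by apply: gt0_ltr_powR; rewrite ?nnegrE// ltr1n.
  by rewrite powR1 => h; rewrite invf_lt1// powR_gt0.
have t0 : 0 <= t by rewrite powR_ge0.
apply: (@le_lt_trans _ _ (4 ^+ m / (1 - t))%:E); last exact: ltry.
apply: lime_le; first by apply: is_cvg_nneseries => k _ _; rewrite lee_fin mulr_ge0 ?exprn_ge0.
by apply: nearW => K; rewrite sumEFin lee_fin; apply: geometric_partial_le => //; rewrite exprn_ge0.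
Qed.
End tail_integral.

Section normalized_bounds.
Context {R : realType} {n : nat}.
Notation leb := (@lebesgue_measure R).
Variables (p : R) (V V0 : R -> \bar R).
Hypotheses (p1 : 1 < p) (mV0 : measurable_fun setT V0) (V0_ge0 : forall r, (0 <= V0 r)%E).
Hypothesis V0V : {ae leb, forall r, 0 < r -> V0 r = V r}.

Let p0 : 0 < p. Proof. exact: lt_trans p1. Qed.

Lemma poweRV_eq1 (I : \bar R) : (0 <= I)%E -> (I `^ p^-1 = 1)%E -> I = 1%E.
Proof.
case: I => [r r0|_|//].
  rewrite poweR_EFin => -[h]; congr EFin.
  have -> : r = (r `^ p^-1) `^ p by rewrite -powRrM mulVf ?gt_eqF// powRr1.
  by rewrite h powR1.
by rewrite poweRyr// gt_eqF// invr_gt0.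
Qed.

Lemma measurable_potential_term (w : 'rV[R]_n.+1 -> R) : measurable_fun setT w ->
  measurable_fun setT (fun x => V0 (enorm x) * (`|w x| `^ p)%:E)%E.
Proof.
move=> mw; apply: emeasurable_funM; first exact: (measurableT_comp mV0 (@measurable_enorm R n.+1)).
by apply/measurable_EFinP; apply: (measurableT_comp (measurable_powR _)); exact: measurableT_comp.
Qed.

(** Each Borel term is compared with the whole integrand of the norm: that integrand contains V and
    need not be Borel, so its integral is not split. *)
Lemma normalized_bounds (w : 'rV[R]_n.+1 -> R) : W p V w -> W_norm p V w = 1%E ->
  [/\ weak_gradient w (grad w), (\int[lebesgue_rV n.+1]_x (V0 (enorm x) * (`|w x| `^ p)%:E) <= 1)%E &
    (\int[lebesgue_rV n.+1]_x (`|grad w x 0 0| `^ p)%:E <= 1)%E].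
Proof.
move=> [[_ [g wg] _] _]; rewrite /W_norm => wn.
have gw : weak_gradient w (grad w) by apply: getPex; exists g.
have [[mw _] lg _] := gw; have [mg _] := lg 0.
have aeV := @ae_potential R n V V0 V0V.
have mVw := measurable_potential_term mw.
have Vw0 x : (0 <= V0 (enorm x) * (`|w x| `^ p)%:E)%E by rewrite mule_ge0// lee_fin powR_ge0.
have I1 : (\int[lebesgue_rV n.+1]_x (V0 (enorm x) * (`|w x| `^ p)%:E) <=
    \int[lebesgue_rV n.+1]_x ((enorm (grad w x) `^ p)%:E + V (enorm x) * (`|w x| `^ p)%:E))%E.
  apply: integral_ge_ae => //; apply: filterS aeV => x <-.
  by rewrite leeDr// lee_fin powR_ge0.
have I2 : (\int[lebesgue_rV n.+1]_x (`|grad w x 0 0| `^ p)%:E <=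
    \int[lebesgue_rV n.+1]_x ((enorm (grad w x) `^ p)%:E + V (enorm x) * (`|w x| `^ p)%:E))%E.
  apply: integral_ge_ae.
  - by apply/measurable_EFinP; apply: (measurableT_comp (measurable_powR _)); exact: measurableT_comp.
  - by move=> x; rewrite lee_fin powR_ge0.
  - apply: filterS aeV => x <-; rewrite (@le_trans _ _ (enorm (grad w x) `^ p)%:E) ?leeDl//.
    by rewrite lee_fin; apply: ge0_ler_powR; rewrite ?nnegrE ?sqrtr_ge0 ?(ltW p0) ?coord_le_enorm.
have I0 := le_trans (integral_ge0 (lebesgue_rV n.+1) (fun x _ => Vw0 x)) I1.
by move: I1 I2; rewrite (poweRV_eq1 I0 wn).
Qed.

End normalized_bounds.

Lemma cvg_powR_oo (R : realType) (C eps : R) : 0 <= C -> 0 < eps -> C * r `^ (- eps) @[r --> +oo] --> 0.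
Proof.
move=> C0 e0; apply/cvgr0Pnorm_lt => e ep.
pose b := e / (C + 1); have b0 : 0 < b by rewrite divr_gt0// ltr_wpDl.
exists (b `^ (- eps^-1)); split; first exact: num_real.
move=> r rb; have r0 : 0 < r by rewrite (le_lt_trans _ rb)// powR_ge0.
have rE : r `^ (- eps) < b.
  have -> : b = (b `^ (- eps^-1)) `^ (- eps).
    by rewrite -powRrM mulrNN mulVf ?gt_eqF// powRr1// ltW.
  rewrite !(powRN _ eps) ltf_pV2 ?posrE ?powR_gt0//.
  by apply: gt0_ltr_powR; rewrite ?nnegrE ?powR_ge0// ltW.
rewrite ger0_norm ?mulr_ge0 ?powR_ge0//.
apply: (@le_lt_trans _ _ (C * b)); first by rewrite ler_wpM2l// ltW.
rewrite /b mulrA ltr_pdivrMr ?ltr_wpDl//; move: C0 ep; nra.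
Qed.

(** * Uniform bound on the tail for normalized pairs *)

Section tail_bound.
Context {R : realType} {n : nat}.
Notation leb := (@lebesgue_measure R).
Variables (p q : R) (V V0 : R -> \bar R) (K : R -> R) (R2 alpha beta gamma c L : R).
Hypotheses (p1 : 1 < p) (mV0 : measurable_fun setT V0) (V0_ge0 : forall r, (0 <= V0 r)%E).
Hypothesis V0V : {ae leb, forall r, 0 < r -> V0 r = V r}.
Hypotheses (K_gt0 : forall r, 0 < r -> 0 < K r) (R20 : 0 < R2) (gp : gamma <= p) (c0 : 0 < c).
Hypothesis aeK : {ae leb, forall r, R2 < r -> exists v : R, [/\ V r = v%:E, c * r `^ (- gamma) <= v &
  K r <= L * (r `^ alpha * v `^ beta)]}.
Variables (M eps s : R).
Hypotheses (M0 : 0 <= M) (eps0 : 0 < eps).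
Hypothesis Mbound : forall r v A B k, 0 < r -> 0 <= A -> 0 <= B ->
  c * r `^ (- gamma) <= v -> k <= L * (r `^ alpha * v `^ beta) ->
  A <= decay_constant n gamma c^-1 * r `^ (- decay_exponent n p gamma) ->
  integrand_bound p q M eps s r v A B k.

Let tail (x : 'rV[R]_n.+1) : R := \1_[set x : 'rV[R]_n.+1 | 1 < enorm x] x * enorm x `^ (- s).

Let mtail : measurable_fun setT (fun x => (tail x)%:E).
Proof.
apply/measurable_EFinP; apply: measurable_funM.
  apply: measurable_indic; rewrite (_ : [set x : 'rV[R]_n.+1 | _] = @enorm R n.+1 @^-1` [set` `]1, +oo[]).
    exact: measurable_preimage_itv (@measurable_enorm R n.+1).
  by apply/funext => z; rewrite /= in_itv/= andbT.
exact: (measurableT_comp (measurable_powR _) (@measurable_enorm R n.+1)).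
Qed.

Let ae_bounds : {ae lebesgue_rV n.+1, forall x : 'rV[R]_n.+1, R2 < enorm x -> exists v : R,
  [/\ V0 (enorm x) = v%:E, c * enorm x `^ (- gamma) <= v &
      K (enorm x) <= L * (enorm x `^ alpha * v `^ beta)]}.
Proof.
have aeV := @ae_potential R n V V0 V0V; have aeK' := ae_enorm n.+1 aeK.
move: aeV aeK'; apply: filterS2 => x -> + Rx; apply => //; exact: lt_trans Rx.
Qed.

(** The right side is independent of the pair: the potential terms of u and h integrate to at most 1
    each, and the third term does not involve them. *)
Lemma tail_bound (u h : 'rV[R]_n.+1 -> R) (r : R) : Num.max 1 R2 < r ->
  W_rad p V u -> W p V h -> W_norm p V u = 1%E -> W_norm p V h = 1%E ->
  (\int[lebesgue_rV n.+1]_(x in ~` eball r) (K (enorm x) * `|u x| `^ (q - 1) * `|h x|)%:E <=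
   (M * r `^ (- eps))%:E * (1 + 1 + \int[lebesgue_rV n.+1]_x (tail x)%:E))%E.
Proof.
move=> rR [Wu ru] Wh un hn.
have [wu uV ug] := normalized_bounds p1 mV0 V0_ge0 V0V Wu un.
have [wh hV _] := normalized_bounds p1 mV0 V0_ge0 V0V Wh hn.
have [[mu_ _] _ _] := wu; have [[mh _] _ _] := wh.
have mVu := measurable_potential_term p mV0 mu_; have mVh := measurable_potential_term p mV0 mh.
have Vw0 (w : 'rV[R]_n.+1 -> R) x : (0 <= V0 (enorm x) * (`|w x| `^ p)%:E)%E.
  by rewrite mule_ge0// lee_fin powR_ge0.
have tail0 x : (0 <= (tail x)%:E)%E by rewrite lee_fin mulr_ge0 ?powR_ge0// indicE.
have cV : (0 : R) <= c^-1 by rewrite invr_ge0 ltW.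
(* V >= c r^-gamma turns the unit potential energy into the weighted bound that [radial_decay]
   expects, with D = 1/c. *)
have ugam : (\int[lebesgue_rV n.+1]_z
    (\1_[set z : 'rV[R]_n.+1 | (R2 < enorm z)%R] z * (enorm z `^ (- gamma) * `|u z| `^ p))%:E <= (c^-1)%:E)%E.
  apply: (@le_trans _ _ (\int[lebesgue_rV n.+1]_x ((c^-1)%:E * (V0 (enorm x) * (`|u x| `^ p)%:E)))%E).
    apply: integral_le_ae.
    - exact: measurable_funeM.
    - by move=> x; rewrite mule_ge0.
    - apply: filterS ae_bounds => x xb; rewrite indicE; case: (boolP (_ \in _)) => [|_]; last first.
        by rewrite mul0r mule_ge0.
      rewrite inE/= => /xb[v [-> cv _]]; rewrite mul1r -!EFinM lee_fin mulrA ler_wpM2r ?powR_ge0//.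
      by rewrite ler_pdivlMl.
  rewrite (@ge0_integralZl_EFin _ _ R _ _ measurableT _ (fun x _ => Vw0 u x) mVu _ cV).
  by rewrite -[X in (_ <= X)%E]mule1; apply: lee_wpmul2l uV; rewrite lee_fin.
have ud := radial_decay p1 gp R20 cV wu ru ug ugam.
pose B x := ((M * r `^ (- eps))%:E * (V0 (enorm x) * (`|u x| `^ p)%:E + V0 (enorm x) * (`|h x| `^ p)%:E + (tail x)%:E))%E.
have mS : measurable_fun setT (fun x => V0 (enorm x) * (`|u x| `^ p)%:E + V0 (enorm x) * (`|h x| `^ p)%:E)%E.
  exact: emeasurable_funD.
have S0 x : (0 <= V0 (enorm x) * (`|u x| `^ p)%:E + V0 (enorm x) * (`|h x| `^ p)%:E)%E by rewrite adde_ge0.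
have Mr : 0 <= M * r `^ (- eps) by rewrite mulr_ge0// powR_ge0.
have B0 x : (0 <= B x)%E by rewrite mule_ge0// adde_ge0.
have mSt : measurable_fun setT (fun x => V0 (enorm x) * (`|u x| `^ p)%:E + V0 (enorm x) * (`|h x| `^ p)%:E + (tail x)%:E)%E.
  exact: emeasurable_funD.
apply: (@le_trans _ _ (\int[lebesgue_rV n.+1]_x B x)%E).
  rewrite integral_mkcond; apply: integral_le_ae => //; first exact: measurable_funeM.
  move: ae_bounds ud; apply: filterS2 => x xb xd; rewrite patchE; case: ifPn => // .
  rewrite inE/= => /negP; rewrite -leNgt => rx.
  have [r1 rR2] : 1 < r /\ R2 < r by move: rR; rewrite gt_max => /andP[].
  have x1 : 1 < enorm x by exact: lt_le_trans rx.
  have x0 : 0 < enorm x by exact: lt_trans x1.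
  have [v [Vv cv Kv]] := xb (lt_le_trans rR2 rx).
  have := Mbound x0 (normr_ge0 (u x)) (normr_ge0 (h x)) cv Kv (xd (lt_le_trans rR rx)).
  rewrite /integrand_bound /B Vv => bnd.
  have -> : ((M * r `^ (- eps))%:E * (v%:E * (`|u x| `^ p)%:E + v%:E * (`|h x| `^ p)%:E + (tail x)%:E) =
    (M * r `^ (- eps) * (v * `|u x| `^ p + v * `|h x| `^ p + tail x))%:E)%E by [].
  rewrite lee_fin (le_trans bnd)//.
  rewrite /tail indicE mem_set// mul1r ler_wpM2r//.
    have v0 : 0 <= v by rewrite (le_trans _ cv)// mulr_ge0 ?powR_ge0// ltW.
    by rewrite !addr_ge0 ?mulr_ge0 ?powR_ge0.
  (* The factor |x|^-eps is largest on the boundary |x| = r, which lets it leave the integral. *)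
  rewrite ler_wpM2l//; apply: powR_le_inv_base => //; first exact: lt_trans r1.
  by rewrite oppr_le0 ltW.
have St0 x : (0 <= V0 (enorm x) * (`|u x| `^ p)%:E + V0 (enorm x) * (`|h x| `^ p)%:E + (tail x)%:E)%E.
  exact: adde_ge0.
rewrite (@ge0_integralZl_EFin _ _ R _ _ measurableT _ (fun x _ => St0 x) mSt _ Mr).
apply: lee_wpmul2l; first by rewrite lee_fin.
rewrite (@ge0_integralD _ _ R _ _ measurableT _ _ (fun x _ => S0 x) mS (fun x _ => tail0 x) mtail).
rewrite leeD2r//.
rewrite (@ge0_integralD _ _ R _ _ measurableT _ _ (fun x _ => Vw0 u x) mVu (fun x _ => Vw0 h x) mVh).
exact: (leeD uV hV).
Qed.

End tail_bound.

Theorem theorem2p5 (R : realType) (N : nat) (p : R)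
  (V : R -> \bar R) (K : R -> R) (R2 alpha beta gamma : R)
  (p_gt1 : 1 < p) (p_ltN : p < N%:R)
  (V_ge0 : forall r, 0 < r -> (0 <= V r)%E)
  (V_meas : Lebesgue_measurable_fun `]0, +oo[ V)
  (V_L1 : exists r1 r2 : R, [/\ 0 < r1, r1 < r2 &
    (\int[lebesgue_measure]_(r in `]r1, r2[) V r < +oo)%E])
  (K_gt0 : forall r, 0 < r -> 0 < K r)
  (K_meas : Lebesgue_measurable_fun `]0, +oo[ K)
  (K_Ls_loc : exists2 s : R, 1 < s & forall a b : R, 0 < a ->
    (\int[lebesgue_measure]_(r in `[a, b]) ((K r `^ s)%:E) < +oo)%E)
  (R2_gt0 : 0 < R2)
  (V_fin : {ae lebesgue_measure, forall r : R, R2 < r -> (V r < +oo)%E})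
  (beta_ge0 : 0 <= beta) (beta_le1 : beta <= 1)
  (K_V_bound :
    (ess_sup (lebesgue_above R2)
      (fun r : R => (K r)%:E / ((r `^ alpha)%:E * V r `^ beta)) < +oo)%E)
  (gamma_lep : gamma <= p)
  (V_bound :
    (0 < ess_inf (lebesgue_above R2) (fun r : R => (r `^ gamma)%:E * V r))%E) :
  forall q2 : R,
    Num.max (Num.max 1 (p * beta))
            (Num.max (q_star p N%:R alpha beta gamma)
                     (q_2star p N%:R alpha beta gamma)) < q2 ->
    R_infty N p V K q2 r @[r --> +oo] --> 0%E.
Proof.
move=> q qmax.
have [[q1 qb] [qs qss]] : (1 < q /\ p * beta < q) /\
    (q_star p N%:R alpha beta gamma < q /\ q_2star p N%:R alpha beta gamma < q).
  by move: qmax; rewrite !gt_max => /andP[/andP[? ?] /andP[? ?]].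
(* The argument singles out the coordinate x_0, so N is written n + 1; N = 0 contradicts 1 < p <
   N. *)
case: N p_ltN qs qss qmax => [|n] pN qs qss qmax.
  by have := lt_trans p_gt1 pN; rewrite ltNge ler01.
have [V0 [mV0 V0_ge0 V0V]] := Lebesgue_measurable_minorant V_ge0 V_meas.
have [c [L [c0 L0 aeK]]] := potential_bounds R2_gt0 K_gt0 V_fin K_V_bound V_bound.
have nN : n.+1%:R = n%:R + 1 :> R by rewrite natr1.
have gN : gamma < n.+1%:R by exact: le_lt_trans pN.
(* The denominator of [q_2star] is positive because gamma <= p < N. *)
have D0 : 0 < p * (n.+1%:R - 1) - gamma * (p - 1).
  have h1 : gamma * (p - 1) <= p * (p - 1) by rewrite ler_wpM2r// subr_ge0 ltW.
  have h2 : p * (p - 1) < p * (n.+1%:R - 1) by rewrite ltr_pM2l ?(lt_trans _ p_gt1)// ltrD2r.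
  by rewrite subr_gt0 (le_lt_trans h1).
have Cd0 : 0 <= decay_constant n gamma c^-1.
  by rewrite /decay_constant !addr_ge0// !mulr_ge0 ?addr_ge0 ?mulr_ge0 ?powR_ge0 ?invr_ge0 ?exprn_ge0// ltW.
have [M [eps [s [M0 eps0 sN Mbound]]]] : exists M eps s : R, [/\ 0 <= M, 0 < eps, n.+1%:R < s &
    forall r v A B k, 0 < r -> 0 <= A -> 0 <= B ->
    c * r `^ (- gamma) <= v -> k <= L * (r `^ alpha * v `^ beta) ->
    A <= decay_constant n gamma c^-1 * r `^ (- decay_exponent n p gamma) ->
    integrand_bound p q M eps s r v A B k].
  have [qp|pq] := ltP q p.
    have [M [eps [s [M0 eps0 sN H]]]] := subcritical_bound p_gt1 q1 qb c0 L0 gN qp qs.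
    by exists M, eps, s; split => // r v A B k r0 A0 B0 cv kL _; exact: H.
  exact: (supercritical_bound p_gt1 q1 c0 L0 nN Cd0 pq beta_le1 D0 qss).
have tail_fin := tail_integral sN.
set z := (\int[_]_x _)%E in tail_fin.
have z0 : (0 <= z)%E by apply: integral_ge0 => x _; rewrite lee_fin mulr_ge0 ?powR_ge0// indicE.
have zE : z = (fine z)%:E by rewrite fineK// ge0_fin_numE.
pose C := M * (1 + 1 + fine z).
have C0 : 0 <= C by rewrite mulr_ge0// !addr_ge0// fine_ge0.
have [w [Ww wn]] : exists w : 'rV[R]_n.+1 -> R, W_rad p V w /\ W_norm p V w = 1%E.
  have [r1 [r2 [r10 r12 VL]]] := V_L1.
  exact: (exists_normalized p_gt1 pN mV0 V0_ge0 V0V r10 r12 VL).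
apply: (@squeeze_cvge _ _ _ _ (fun=> 0%E) _ (fun r => (C * r `^ (- eps))%:E)); last first.
- by apply: cvg_EFin; [exact: nearW|exact: cvg_powR_oo].
- exact: cvg_cst.
exists (Num.max 1 R2); split; first exact: num_real.
move=> r rR; have r0 : 0 < r by rewrite (lt_trans _ rR)// lt_max ltr01.
apply/andP; split.
  (* The supremum is nonnegative because the pair (w, w) is admissible and K > 0. *)
  apply: (@le_trans _ _ (\int[lebesgue_rV n.+1]_(x in ~` eball r)
      (K (enorm x) * `|w x| `^ (q - 1) * `|w x|)%:E)%E).
    apply: integral_ge0 => x /negP; rewrite -leNgt => rx.
    rewrite lee_fin !mulr_ge0 ?powR_ge0//; apply: ltW; apply: K_gt0; exact: lt_le_trans rx.
  by apply: ereal_sup_ubound; exists (w, w) => //; split => //; case: Ww.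
apply: ge_ereal_sup => _ [[u h] [Wu Wh un hn] <-] /=.
have := tail_bound p_gt1 mV0 V0_ge0 V0V R2_gt0 gamma_lep c0 aeK M0 eps0 Mbound rR Wu Wh un hn.
rewrite -/z => /le_trans; apply; rewrite zE -!EFinD -EFinM lee_fin /C; nra.
Qed.
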